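(* Let $G$ be a group and let $X$ be a simply-connected angled $G$-complex on which $G$ acts properly and cocompactly, and suppose $X$ has negative sectional curvature. If $H$ is a subgroup of $G$ and $Y\subseteq X$ is a connected $H$-invariant subcomplex of $X$ with finitely many $H$-orbits of cells ($H$-cocompact), then there is a simply-connected $H$-invariant, $H$-cocompact subcomplex $Z$ of $X$ with $Y\subseteq Z\subseteq X$.
   Context: All complexes are combinatorial 2-dimensional CW complexes and all maps are combinatorial. A $G$-complex is a complex with a cellular action of $G$ without inversions (the setwise stabilizer of a cell fixes it pointwise); it is proper (resp. cocompact) if the action is proper (resp. has finitely many orbits of cells). The link $\mathrm{link}(x)$ of a $0$-cell $x$ is the graph with a vertex for each end of a $1$-cell at $x$ and an edge for each corner of a $2$-cell at $x$. An angled $G$-complex is a 2-dimensional $G$-complex together with a $G$-invariant assignment of a real number $\measuredangle(c)$ (the angle) to each corner $c$ of each $2$-cell; so each edge $e$ of $\mathrm{link}(x)$ carries an angle $\measuredangle(e)$. The angled complex $X$ has sectional curvature $\le \alpha$ if (i) for every $0$-cell $x$ and every finite connected subgraph $\Delta\subseteq \mathrm{link}(x)$ with at least one edge and no vertex of valence one, $2\pi-\pi\,|V(\Delta)|+\sum_{e\in E(\Delta)}(\pi-\measuredangle(e))\le\alpha$; and (ii) for every $2$-cell $f$, $\sum_{c\in\mathrm{corners}(f)}\measuredangle(c)-\pi(|\partial f|-2)\le 0$, where $|\partial f|$ is the length of the boundary path of $f$. $X$ has negative sectional curvature if it has sectional curvature $\le\alpha$ for some $\alpha<0$. *)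

(* Defs.v *)
From Stdlib Require Import Reals List Arith Relations Lra.
Import ListNotations.
Open Scope R_scope.

Record group := Group {
  gcar :> Type;
  gmul : gcar -> gcar -> gcar;
  gone : gcar;
  ginv : gcar -> gcar;
  gmulA : forall a b c, gmul a (gmul b c) = gmul (gmul a b) c;
  gmul1 : forall a, gmul gone a = a;
  gmulV : forall a, gmul (ginv a) a = gone
}.

Definition subgroup (G : group) (H : G -> Prop) : Prop :=
  H (gone G) /\
  (forall a b, H a -> H b -> H (gmul G a b)) /\
  (forall a, H a -> H (ginv G a)).

(* Combinatorial 2-complexes.  1-cells carry a reference orientation;
   a dart (e, true) traverses e from esrc to etgt, (e, false) backwards.
   Each 2-cell is attached along a nonempty closed combinatorial path. *)
Section Paths.
Variables (V E : Type) (esrc etgt : E -> V).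

Definition dsrc' (d : E * bool) : V := if snd d then esrc (fst d) else etgt (fst d).
Definition dtgt' (d : E * bool) : V := if snd d then etgt (fst d) else esrc (fst d).

Fixpoint path_ok' (u : V) (p : list (E * bool)) (v : V) : Prop :=
  match p with
  | [] => u = v
  | d :: q => dsrc' d = u /\ path_ok' (dtgt' d) q v
  end.
End Paths.

Record complex := Complex {
  vtx : Type;
  edg : Type;
  fc  : Type;
  esrc : edg -> vtx;
  etgt : edg -> vtx;
  fbnd : fc -> list (edg * bool);
  fbnd_closed : forall f, fbnd f <> [] /\
     exists v, @path_ok' vtx edg esrc etgt v (fbnd f) v
}.

Section ComplexDefs.
Variable X : complex.

Definition dart := (edg X * bool)%type.
Definition dsrc (d : dart) : vtx X := @dsrc' (vtx X) (edg X) (esrc X) (etgt X) d.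
Definition dtgt (d : dart) : vtx X := @dtgt' (vtx X) (edg X) (esrc X) (etgt X) d.
Definition dinv (d : dart) : dart := (fst d, negb (snd d)).
Definition path_ok (u : vtx X) (p : list dart) (v : vtx X) : Prop :=
  @path_ok' (vtx X) (edg X) (esrc X) (etgt X) u p v.
Definition pinv (p : list dart) : list dart := rev (map dinv p).
Definition rot (k : nat) (l : list dart) : list dart := skipn k l ++ firstn k l.

Record subcx := Subcx {
  sV : vtx X -> Prop;
  sE : edg X -> Prop;
  sF : fc X -> Prop
}.

Definition is_subcomplex (S : subcx) : Prop :=
  (forall e, sE S e -> sV S (esrc X e) /\ sV S (etgt X e)) /\
  (forall f, sF S f -> forall d, In d (fbnd X f) -> sE S (fst d)).

Definition full : subcx := Subcx (fun _ => True) (fun _ => True) (fun _ => True).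

Definition subcx_le (S T : subcx) : Prop :=
  (forall v, sV S v -> sV T v) /\ (forall e, sE S e -> sE T e) /\
  (forall f, sF S f -> sF T f).

Definition path_in (S : subcx) (u : vtx X) (p : list dart) (v : vtx X) : Prop :=
  sV S u /\ path_ok u p v /\ forall d, In d p -> sE S (fst d).

Definition connected (S : subcx) : Prop :=
  (exists v, sV S v) /\
  forall u v, sV S u -> sV S v -> exists p, path_in S u p v.

Definition elem_htpy (S : subcx) (u v : vtx X) (p q : list dart) : Prop :=
  path_in S u p v /\ path_in S u q v /\
  ( (exists a b d, p = a ++ b /\ q = a ++ d :: dinv d :: b)
  \/ (exists a b f k r, sF S f /\ k < length (fbnd X f)
        /\ (r = rot k (fbnd X f) \/ r = rot k (pinv (fbnd X f)))
        /\ p = a ++ b /\ q = a ++ r ++ b) )%nat.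

Definition homotopic (S : subcx) (u v : vtx X) : relation (list dart) :=
  clos_refl_sym_trans _ (elem_htpy S u v).

Definition simply_connected (S : subcx) : Prop :=
  connected S /\
  forall v p, path_in S v p v -> homotopic S v v p [].

(* Corner i of the 2-cell f sits between dart i and dart (i+1 mod n) of
   its boundary path; as an edge of the link of the vertex dtgt(dart i)
   it joins the end dinv(dart i) to the end dart (i+1 mod n). *)
Definition corner_ends (f : fc X) (i : nat) (a b : dart) : Prop :=
  exists di dj,
    nth_error (fbnd X f) i = Some di /\
    nth_error (fbnd X f) (Nat.modulo (S i) (length (fbnd X f))) = Some dj /\
    a = dinv di /\ b = dj.

Definition corner_end (c : fc X * nat) (s : bool) (v : dart) : Prop :=
  exists a b, corner_ends (fst c) (snd c) a b /\ v = (if s then a else b).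

(* A finite connected subgraph Delta of link(x), given by its lists of
   vertices (ends of 1-cells at x, i.e. darts starting at x) and of edges
   (corners of 2-cells at x), having at least one edge and no vertex of
   valence one. *)
Definition good_link_subgraph (x : vtx X) (Lv : list dart) (Lc : list (fc X * nat)) : Prop :=
  NoDup Lv /\ NoDup Lc /\ Lc <> [] /\
  (forall d, In d Lv -> dsrc d = x) /\
  (forall c, In c Lc -> (snd c < length (fbnd X (fst c)))%nat /\
      exists a b, corner_ends (fst c) (snd c) a b /\ In a Lv /\ In b Lv) /\
  (forall u w, In u Lv -> In w Lv ->
      clos_refl_trans _ (fun u' w' => exists c, In c Lc /\
         ((corner_end c true u' /\ corner_end c false w') \/
          (corner_end c true w' /\ corner_end c false u'))) u w) /\
  (forall v, In v Lv ->
      ~ (exists inc : (fc X * nat) * bool,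
           (In (fst inc) Lc /\ corner_end (fst inc) (snd inc) v) /\
           forall inc', In (fst inc') Lc /\ corner_end (fst inc') (snd inc') v -> inc' = inc)).

Definition sum_R (l : list R) : R := fold_right Rplus 0 l.

Definition sectional_curvature_le (ang : fc X -> nat -> R) (alpha : R) : Prop :=
  (forall x Lv Lc, good_link_subgraph x Lv Lc ->
     2 * PI - PI * INR (length Lv)
       + sum_R (map (fun c => PI - ang (fst c) (snd c)) Lc) <= alpha) /\
  (forall f, sum_R (map (ang f) (seq 0 (length (fbnd X f))))
       - PI * (INR (length (fbnd X f)) - 2) <= 0).

Definition negative_sectional_curvature (ang : fc X -> nat -> R) : Prop :=
  exists alpha, alpha < 0 /\ sectional_curvature_le ang alpha.

End ComplexDefs.
Arguments sV {X}. Arguments sE {X}. Arguments sF {X}.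

(* Cellular actions without inversions: the action preserves the chosen
   orientations of 1-cells and maps boundary paths of 2-cells exactly
   (so a cell stabilised setwise is fixed pointwise). *)
Record action (G : group) (X : complex) := Action {
  av : G -> vtx X -> vtx X;
  ae : G -> edg X -> edg X;
  af : G -> fc X -> fc X;
  av1 : forall x, av (gone G) x = x;
  ae1 : forall x, ae (gone G) x = x;
  af1 : forall x, af (gone G) x = x;
  avM : forall g h x, av (gmul G g h) x = av g (av h x);
  aeM : forall g h x, ae (gmul G g h) x = ae g (ae h x);
  afM : forall g h x, af (gmul G g h) x = af g (af h x);
  ae_src : forall g e, esrc X (ae g e) = av g (esrc X e);
  ae_tgt : forall g e, etgt X (ae g e) = av g (etgt X e);
  af_bnd : forall g f, fbnd X (af g f) = map (fun d => (ae g (fst d), snd d)) (fbnd X f)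
}.

Arguments av {G X}. Arguments ae {G X}. Arguments af {G X}.

Section ActionDefs.
Variables (G : group) (X : complex) (A : action G X).

Definition proper_action : Prop :=
  (forall x, exists L : list G, forall g, av A g x = x -> In g L) /\
  (forall e, exists L : list G, forall g, ae A g e = e -> In g L) /\
  (forall f, exists L : list G, forall g, af A g f = f -> In g L).

Definition invariant (H : G -> Prop) (S : subcx X) : Prop :=
  (forall h x, H h -> sV S x -> sV S (av A h x)) /\
  (forall h e, H h -> sE S e -> sE S (ae A h e)) /\
  (forall h f, H h -> sF S f -> sF S (af A h f)).

Definition cocompact_in (H : G -> Prop) (S : subcx X) : Prop :=
  exists (Lv : list (vtx X)) (Le : list (edg X)) (Lf : list (fc X)),
    (forall x, In x Lv -> sV S x) /\ (forall e, In e Le -> sE S e) /\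
    (forall f, In f Lf -> sF S f) /\
    (forall x, sV S x -> exists h y, H h /\ In y Lv /\ x = av A h y) /\
    (forall e, sE S e -> exists h y, H h /\ In y Le /\ e = ae A h y) /\
    (forall f, sF S f -> exists h y, H h /\ In y Lf /\ f = af A h y).

(* Angles are G-invariant: the corner i of g.f is the image of corner i of f. *)
Definition invariant_angles (ang : fc X -> nat -> R) : Prop :=
  forall g f i, ang (af A g f) i = ang f i.

End ActionDefs.

(* Main.v *)
(** Write a weighted count of H-orbits, an orbit of cells with stabiliser S counting 1/|S|.

    Consider complexes Z immersed in X, with H acting cocompactly, which contain Y and onto whose
    fundamental group that of Y surjects.  Two facts bound the size of Z.  First, the relative
    chain complex of (Z, Y) is exact in degrees 0 and 1, so that C_1(Z, Y) is a summand of
    C_0(Z, Y) + C_2(Z, Y); a trace argument over R[H] then gives E <= V + F for the weighted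
    numbers of cells of Z outside Y.  Second, if no edge outside Y is free or isolated, the
    combinatorial Gauss-Bonnet formula bounds 2 pi (V - E + F) by alpha V plus the contribution of
    the corners of X at vertices of Y.  As alpha < 0, V is bounded in terms of Y alone, and every
    vertex of Z lies within a fixed distance of Y.

    Such complexes arise by making 2-cells of X available along paths from Y and folding, all at
    once: the vertices are paths of X from Y modulo free reduction, paths of Y and the boundaries
    of these 2-cells.  Collapsing free faces and cutting off isolated edges makes the result
    reduced without changing homotopies.  The union of the images in X of all reduced Z lies in a
    bounded neighbourhood of Y, hence is H-cocompact; and it is simply connected because finitely
    many reduced complexes, together with a null-homotopy in X of a given loop, are dominated by
    a single one. *)

Require Import Defs.
From Stdlib Require Import Reals List.
From Stdlib Require Import Arith Relations Lra Lia Classical ClassicalEpsilon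
  FunctionalExtensionality PropExtensionality ProofIrrelevance Permutation.
Import ListNotations.
Open Scope R_scope.

(** The weighted orbit count plays the part of von Neumann dimension; its monotonicity under
    retracts is obtained from finitely supported kernels alone, traces of powers of a contraction
    replacing the spectral projection. Subcomplexes of X would not do: one that contains Y may have
    loops not coming from Y. A folded complex over X can be enlarged by finitely many 2-cells
    without that defect, and its links still embed in those of X, so the curvature bound carries
    over. Gauss-Bonnet with E <= V + F leaves -alpha V <= m |LY|, where LY represents the vertex
    orbits of Y and m bounds the total of |pi - angle| at a vertex of X. Distance to Y is
    H-invariant, so a vertex at distance k exhibits k distinct orbits, each of weight at least 1/K
    if K bounds the stabilisers; hence k <= K m |LY| / (-alpha). This radius is the same for all Z,
    and that uniformity lets two reduced complexes be placed in one larger complex and survive its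
    reduction. *)

Notation dec := excluded_middle_informative.

(** * Indicators and sums over lists *)

Definition indic (P : Prop) : R := if dec P then 1 else 0.

Lemma indic_true (P : Prop) : P -> indic P = 1.
Proof. intros; unfold indic; destruct (dec P); tauto. Qed.

Lemma indic_false (P : Prop) : ~ P -> indic P = 0.
Proof. intros; unfold indic; destruct (dec P); tauto. Qed.

Lemma indic_iff (P Q : Prop) : (P <-> Q) -> indic P = indic Q.
Proof. intros; unfold indic; destruct (dec P), (dec Q); tauto. Qed.

Lemma indic_bounds (P : Prop) : 0 <= indic P <= 1.
Proof. unfold indic; destruct (dec P); lra. Qed.

Definition filterP {T} (P : T -> Prop) (l : list T) : list T :=
  filter (fun x => if dec (P x) then true else false) l.

Lemma filterP_In {T} (P : T -> Prop) l x : In x (filterP P l) <-> In x l /\ P x.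
Proof.
  unfold filterP; rewrite filter_In; destruct (dec (P x)); intuition congruence.
Qed.

Lemma filterP_NoDup {T} (P : T -> Prop) l : NoDup l -> NoDup (filterP P l).
Proof. apply NoDup_filter. Qed.

Lemma filterP_length_lt {T} (P : T -> Prop) l x :
  In x l -> ~ P x -> (length (filterP P l) < length l)%nat.
Proof.
  unfold filterP; induction l as [|a l IH]; simpl; [tauto|].
  intros [->|Hx] HP.
  - destruct (dec (P x)); [tauto|].
    pose proof (filter_length_le (fun x => if dec (P x) then true else false) l). lia.
  - specialize (IH Hx HP). destruct (dec (P a)); simpl; lia.
Qed.

Lemma sumR_app (l1 l2 : list R) : sum_R (l1 ++ l2) = sum_R l1 + sum_R l2.
Proof. induction l1; simpl; lra. Qed.

Lemma sumR_perm (l1 l2 : list R) : Permutation l1 l2 -> sum_R l1 = sum_R l2.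
Proof. induction 1; simpl; lra. Qed.

Section SumList.
Context {T : Type}.
Implicit Types (f g : T -> R) (L : list T).

Lemma sumR_ext f g L : (forall a, In a L -> f a = g a) -> sum_R (map f L) = sum_R (map g L).
Proof.
  induction L as [|a L IH]; simpl; intros H; [reflexivity|].
  rewrite H, IH; auto.
Qed.

Lemma sumR_plus f g L :
  sum_R (map (fun a => f a + g a) L) = sum_R (map f L) + sum_R (map g L).
Proof. induction L; simpl; lra. Qed.

Lemma sumR_scal c f L : sum_R (map (fun a => c * f a) L) = c * sum_R (map f L).
Proof. induction L; simpl; lra. Qed.

Lemma sumR_le f g L :
  (forall a, In a L -> f a <= g a) -> sum_R (map f L) <= sum_R (map g L).
Proof.
  induction L as [|a L IH]; simpl; intros H; [lra|].
  pose proof (H a (or_introl eq_refl)). specialize (IH (fun b Hb => H b (or_intror Hb))). lra.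
Qed.

Lemma sumR_const c L : sum_R (map (fun _ => c) L) = INR (length L) * c.
Proof. induction L; simpl length; [simpl; lra|]. rewrite S_INR. simpl map. simpl sum_R. lra. Qed.

Lemma sumR_filter_nz f L :
  sum_R (map f L) = sum_R (map f (filterP (fun a => f a <> 0) L)).
Proof.
  unfold filterP; induction L as [|a L IH]; simpl; [reflexivity|].
  destruct (dec (f a <> 0)) as [H|H]; simpl; [lra|].
  apply NNPP in H. lra.
Qed.

Lemma sumR_support f L1 L2 : NoDup L1 -> NoDup L2 ->
  (forall a, f a <> 0 -> In a L1) -> (forall a, f a <> 0 -> In a L2) ->
  sum_R (map f L1) = sum_R (map f L2).
Proof.
  intros N1 N2 H1 H2. rewrite (sumR_filter_nz f L1), (sumR_filter_nz f L2).
  apply sumR_perm, Permutation_map, NoDup_Permutation; auto using filterP_NoDup.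
  intros x; rewrite !filterP_In; intuition.
Qed.

End SumList.

Lemma sumR_swap {A B} (f : A -> B -> R) LA LB :
  sum_R (map (fun a => sum_R (map (f a) LB)) LA)
  = sum_R (map (fun b => sum_R (map (fun a => f a b) LA)) LB).
Proof.
  induction LA as [|a LA IH]; simpl.
  - symmetry. rewrite (sumR_const 0). lra.
  - rewrite IH, <- sumR_plus. reflexivity.
Qed.

(** * Sums of finitely supported functions *)

Definition fsupp {T} (f : T -> R) : Prop := exists L, forall a, f a <> 0 -> In a L.

(* Junk value 0 when the support is infinite. *)
Definition fsum {T} (f : T -> R) : R :=
  match dec (exists L, NoDup L /\ forall a, f a <> 0 -> In a L) with
  | left H => sum_R (map f (proj1_sig (constructive_indefinite_description _ H)))
  | right _ => 0
  end.

Lemma classic_eq_dec {T} (x y : T) : {x = y} + {x <> y}.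
Proof. apply dec. Qed.

Lemma NoDup_cover {T} (L : list T) : exists L', NoDup L' /\ forall a, In a L' <-> In a L.
Proof.
  exists (nodup classic_eq_dec L). split; [apply NoDup_nodup|]. intros; apply nodup_In.
Qed.

Lemma finite_list {T} (P : T -> Prop) :
  (exists L, forall a, P a -> In a L) -> exists L, NoDup L /\ forall a, In a L <-> P a.
Proof.
  intros [L HL]. destruct (NoDup_cover L) as (L' & N & HL').
  exists (filterP P L'). split; [now apply filterP_NoDup|].
  intros a; rewrite filterP_In, HL'. firstorder.
Qed.

Lemma finite_union {A B} (P : A -> B -> Prop) (l : list A) :
  (forall a, exists m, forall b, P a b -> In b m) ->
  exists m, forall a b, In a l -> P a b -> In b m.
Proof.
  intros H. induction l as [|a l [m IH]]; [exists []; simpl; tauto|].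
  destruct (H a) as [m' Hm']. exists (m' ++ m).
  intros x b [<-|Hx] E; apply in_or_app; eauto.
Qed.

Section Fsum.
Context {T : Type}.
Implicit Types (f g : T -> R).

Lemma fsum_eq f L : NoDup L -> (forall a, f a <> 0 -> In a L) -> fsum f = sum_R (map f L).
Proof.
  intros N H. unfold fsum. destruct (dec _) as [E|E].
  - destruct (constructive_indefinite_description _ E) as (L' & N' & H'); simpl.
    now apply sumR_support.
  - exfalso; eauto.
Qed.

Lemma fsupp_nodup f : fsupp f -> exists L, NoDup L /\ forall a, f a <> 0 -> In a L.
Proof.
  intros [L H]. destruct (NoDup_cover L) as (L' & N & H'). exists L'; split; auto.
  intros; apply H'; auto.
Qed.

Lemma fsum_ext f g : (forall a, f a = g a) -> fsum f = fsum g.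
Proof. intros H; f_equal; now apply functional_extensionality. Qed.

Lemma fsupp_sub f g : fsupp f -> (forall a, f a = 0 -> g a = 0) -> fsupp g.
Proof. intros [L H] Hfg. exists L. intros a Ha. apply H. auto. Qed.

Lemma fsupp_plus f g : fsupp f -> fsupp g -> fsupp (fun a => f a + g a).
Proof.
  intros [L H] [L' H']. exists (L ++ L'). intros a Ha. apply in_or_app.
  destruct (Req_dec (f a) 0) as [E|E]; [right|left; auto].
  apply H'; lra.
Qed.

Lemma fsupp_mulr f g : fsupp f -> fsupp (fun a => f a * g a).
Proof. intros H; apply (fsupp_sub f); auto. intros a ->; lra. Qed.

Lemma fsupp_mull f g : fsupp g -> fsupp (fun a => f a * g a).
Proof. intros H; apply (fsupp_sub g); auto. intros a ->; lra. Qed.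

Lemma fsupp_0 : fsupp (fun _ : T => 0).
Proof. exists []; intros; lra. Qed.

Lemma fsupp_delta (b : T) : fsupp (fun a => indic (a = b)).
Proof.
  exists [b]. intros a Ha. left. unfold indic in Ha. destruct (dec (a = b)); [auto|lra].
Qed.

Lemma fsum_plus f g : fsupp f -> fsupp g ->
  fsum (fun a => f a + g a) = fsum f + fsum g.
Proof.
  intros [L1 H1] [L2 H2]. destruct (NoDup_cover (L1 ++ L2)) as (L & N & HL).
  rewrite !(fsum_eq _ L); auto; try apply sumR_plus;
    intros a Ha; apply HL, in_or_app; auto.
  destruct (Req_dec (f a) 0); [right; apply H2; lra|auto].
Qed.

Lemma fsum_scal c f : fsupp f -> fsum (fun a => c * f a) = c * fsum f.
Proof.
  intros Hf. destruct (fsupp_nodup f Hf) as (L & N & HL).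
  rewrite !(fsum_eq _ L); auto; [apply sumR_scal|].
  intros a Ha; apply HL. intros E; apply Ha; rewrite E; lra.
Qed.

Lemma fsum_minus f g : fsupp f -> fsupp g ->
  fsum (fun a => f a - g a) = fsum f - fsum g.
Proof.
  intros Hf Hg. rewrite (fsum_ext _ (fun a => f a + (-1) * g a)) by (intros; lra).
  rewrite fsum_plus, fsum_scal; auto; [lra|]. now apply fsupp_mull.
Qed.

Lemma fsum_le f g : fsupp f -> fsupp g -> (forall a, f a <= g a) -> fsum f <= fsum g.
Proof.
  intros [L1 H1] [L2 H2] H. destruct (NoDup_cover (L1 ++ L2)) as (L & N & HL).
  rewrite !(fsum_eq _ L); auto; try (intros a Ha; apply HL, in_or_app; auto).
  apply sumR_le; auto.
Qed.

Lemma fsum_0 : fsum (fun _ : T => 0) = 0.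
Proof. rewrite (fsum_eq _ []); [reflexivity|constructor|]. intros; lra. Qed.

Lemma fsum_ge0 f : (forall a, 0 <= f a) -> 0 <= fsum f.
Proof.
  intros H. unfold fsum. destruct (dec _); [|lra].
  induction (proj1_sig _); simpl; [lra|]. specialize (H a); lra.
Qed.

Lemma fsum_single f b : (forall a, a <> b -> f a = 0) -> fsum f = f b.
Proof.
  intros H. rewrite (fsum_eq f [b]); [simpl; lra| |].
  - constructor; [simpl; tauto|constructor].
  - intros a Ha. left. apply NNPP. intros E. apply Ha, H. congruence.
Qed.

Lemma fsum_delta f b : fsum (fun a => indic (a = b) * f a) = f b.
Proof.
  rewrite (fsum_single _ b).
  - rewrite indic_true; auto; lra.
  - intros a Ha. rewrite indic_false; auto; lra.
Qed.

Lemma fsum_NoDup_le f L : fsupp f -> (forall a, 0 <= f a) -> NoDup L ->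
  sum_R (map f L) <= fsum f.
Proof.
  intros [L' H] Hp N.
  destruct (NoDup_cover (L ++ L')) as (M & NM & HM).
  rewrite (fsum_eq f M); auto; [|intros; apply HM, in_or_app; auto].
  assert (HI : forall a, In a L -> In a M) by (intros; apply HM, in_or_app; auto).
  clear H HM L'. revert M NM HI. induction L as [|a L IH]; intros M NM HI; simpl.
  - assert (E : sum_R (map (fun _ : T => 0) M) <= sum_R (map f M)) by (apply sumR_le; auto).
    rewrite sumR_const in E. lra.
  - inversion_clear N. destruct (in_split a M) as (M1 & M2 & ->); [apply HI; simpl; auto|].
    rewrite map_app; simpl. rewrite sumR_app; simpl.
    assert (E : sum_R (map f L) <= sum_R (map f (M1 ++ M2))).
    { apply IH; auto; [now apply NoDup_remove_1 in NM|].
      intros b Hb. specialize (HI b (or_intror Hb)). apply in_app_or in HI. apply in_or_app.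
      destruct HI as [|[<-|]]; auto; tauto. }
    rewrite map_app, sumR_app in E. lra.
Qed.

Lemma fsum_term_le f a : fsupp f -> (forall a, 0 <= f a) -> f a <= fsum f.
Proof.
  intros Hf Hp. pose proof (fsum_NoDup_le f [a] Hf Hp) as E. simpl in E.
  assert (N : NoDup [a]) by (constructor; [simpl; tauto|constructor]).
  specialize (E N); lra.
Qed.

End Fsum.

(** The support is required to lie in a finite rectangle: finite rows and columns alone would leave
    outer sums of infinite support, which take the junk value. *)
Lemma fsum_swap {A B} (f : A -> B -> R) :
  (exists LA LB, forall a b, f a b <> 0 -> In a LA /\ In b LB) ->
  fsum (fun a => fsum (f a)) = fsum (fun b => fsum (fun a => f a b)).
Proof.
  intros (LA0 & LB0 & H0).
  destruct (NoDup_cover LA0) as (LA & NA & HA). destruct (NoDup_cover LB0) as (LB & NB & HB).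
  assert (H : forall a b, f a b <> 0 -> In a LA /\ In b LB)
    by (intros a b E; rewrite HA, HB; auto).
  assert (E1 : forall a, fsum (f a) = sum_R (map (f a) LB))
    by (intros a; apply fsum_eq; auto; intros b E; now apply (H a)).
  assert (E2 : forall b, fsum (fun a => f a b) = sum_R (map (fun a => f a b) LA))
    by (intros b; apply fsum_eq; auto; intros a E; now apply (H a b)).
  rewrite (fsum_ext _ _ E1), (fsum_ext _ _ E2).
  rewrite (fsum_eq _ LA), (fsum_eq _ LB); auto.
  - apply sumR_swap.
  - intros b E. apply NNPP; intros Hn. apply E.
    rewrite (sumR_ext _ (fun _ => 0)); [rewrite sumR_const; lra|].
    intros a _. apply NNPP. intros Z. apply Hn, (H a b Z).
  - intros a E. apply NNPP; intros Hn. apply E.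
    rewrite (sumR_ext _ (fun _ => 0)); [rewrite sumR_const; lra|].
    intros b _. apply NNPP. intros Z. apply Hn, (H a b Z).
Qed.

Lemma fsum_reindex {A B} (g : A -> B) (g' : B -> A) (f : B -> R) :
  (forall a, g' (g a) = a) -> (forall b, g (g' b) = b) -> fsupp f ->
  fsum (fun a => f (g a)) = fsum f.
Proof.
  intros K K' Hf. destruct (fsupp_nodup f Hf) as (L & N & HL).
  rewrite (fsum_eq f L), (fsum_eq _ (map g' L)); auto.
  - rewrite map_map. apply sumR_ext. intros; now rewrite K'.
  - apply FinFun.Injective_map_NoDup; auto. intros x y E. rewrite <- (K' x), <- (K' y); congruence.
  - intros a Ha. rewrite <- (K a). apply in_map, HL; auto.
Qed.

Lemma fsupp_reindex {A B} (g : A -> B) (g' : B -> A) (f : B -> R) :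
  (forall a, g' (g a) = a) -> fsupp f -> fsupp (fun a => f (g a)).
Proof.
  intros K [L H]. exists (map g' L). intros a Ha. rewrite <- (K a). now apply in_map, H.
Qed.

Lemma fsupp_sum {A B} (f : A + B -> R) :
  fsupp (fun a => f (inl a)) -> fsupp (fun b => f (inr b)) -> fsupp f.
Proof.
  intros [L H] [L' H']. exists (map inl L ++ map inr L').
  intros [a|b] E; apply in_or_app; [left|right]; apply in_map; auto.
Qed.

Lemma fsum_sum {A B} (f : A + B -> R) : fsupp f ->
  fsum f = fsum (fun a => f (inl a)) + fsum (fun b => f (inr b)).
Proof.
  intros Hf. destruct (fsupp_nodup f Hf) as (L & N & HL).
  assert (exists LA LB, NoDup LA /\ NoDup LB /\ (forall a, In a LA <-> In (inl a) L)
            /\ (forall b, In b LB <-> In (inr b) L)) as (LA & LB & NA & NB & HA & HB).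
  { clear -L. destruct (finite_list (fun a : A => In (inl a) L)) as (LA & NA & HA).
    - exists (flat_map (fun x => match x with inl a => [a] | inr _ => [] end) L).
      intros a Ha. apply in_flat_map. exists (inl a); simpl; auto.
    - destruct (finite_list (fun b : B => In (inr b) L)) as (LB & NB & HB).
      + exists (flat_map (fun x => match x with inr a => [a] | inl _ => [] end) L).
        intros a Ha. apply in_flat_map. exists (inr a); simpl; auto.
      + exists LA, LB; auto. }
  rewrite (fsum_eq (fun a => f (inl a)) LA), (fsum_eq (fun a => f (inr a)) LB); auto.
  - rewrite (fsum_eq f (map inl LA ++ map inr LB)).
    + rewrite map_app, sumR_app, !map_map. reflexivity.
    + apply NoDup_app.
      * apply FinFun.Injective_map_NoDup; auto. intros x y E; congruence.
      * apply FinFun.Injective_map_NoDup; auto. intros x y E; congruence.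
      * intros x Hx Hy. apply in_map_iff in Hx, Hy. destruct Hx as (? & <- & _), Hy as (? & E & _).
        discriminate.
    + intros [a|b] E; apply in_or_app; [left|right]; apply in_map; [apply HA|apply HB]; auto.
  - intros b E; apply HB; auto.
  - intros b E; apply HA; auto.
Qed.

Lemma fsum_pair {A B} (f : A * B -> R) : fsupp f ->
  fsum f = fsum (fun a => fsum (fun b => f (a, b))).
Proof.
  intros [L0 H0].
  destruct (NoDup_cover (map fst L0)) as (LA & NA & HA).
  destruct (NoDup_cover (map snd L0)) as (LB & NB & HB).
  assert (H : forall a b, f (a, b) <> 0 -> In a LA /\ In b LB).
  { intros a b E. rewrite HA, HB. apply H0 in E. split.
    - now apply (in_map fst) in E. - now apply (in_map snd) in E. }
  rewrite (fsum_ext _ (fun a => sum_R (map (fun b => f (a, b)) LB))).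
  2:{ intros a. apply fsum_eq; auto. intros b E; now apply (H a). }
  rewrite (fsum_eq _ LA); auto.
  2:{ intros a E. apply NNPP; intros Hn. apply E.
      rewrite (sumR_ext _ (fun _ => 0)); [rewrite sumR_const; lra|].
      intros b _. apply NNPP. intros Z. apply Hn, (H a b Z). }
  rewrite (fsum_eq f (list_prod LA LB)).
  - clear. induction LA as [|a LA IH]; simpl; [reflexivity|].
    rewrite map_app, sumR_app, IH, map_map. reflexivity.
  - clear -NA NB. induction NA; simpl; [constructor|]. apply NoDup_app; auto.
    + apply FinFun.Injective_map_NoDup; auto. intros u v E; congruence.
    + intros [u v] H1 H2. apply in_map_iff in H1. destruct H1 as (w & E & _).
      inversion E; subst. apply in_prod_iff in H2. tauto.
  - intros [a b] E. apply in_prod; now apply (H a b).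
Qed.

(** * Group actions on sets, weights and mass transport *)

Lemma gmulVr (G : group) (a : G) : gmul G a (ginv G a) = gone G.
Proof.
  rewrite <- (gmul1 G (gmul G a (ginv G a))), <- (gmulV G (ginv G a)) at 1.
  rewrite <- gmulA, (gmulA G (ginv G a) a), gmulV, gmul1, gmulV. reflexivity.
Qed.

Lemma gmul1r (G : group) (a : G) : gmul G a (gone G) = a.
Proof. now rewrite <- (gmulV G a), gmulA, gmulVr, gmul1. Qed.

Lemma ginvK (G : group) (a : G) : ginv G (ginv G a) = a.
Proof. now rewrite <- (gmul1r G (ginv G (ginv G a))), <- (gmulV G a), gmulA, gmulV, gmul1. Qed.

Record gset (G : group) := GSet {
  gscar :> Type;
  ga : G -> gscar -> gscar;
  ga1 : forall s, ga (gone G) s = s;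
  gaM : forall g h s, ga (gmul G g h) s = ga g (ga h s)
}.
Arguments ga {_ _} _ _.

Lemma gaV {G : group} {S : gset G} (h : G) (s : S) : ga (ginv G h) (ga h s) = s.
Proof. now rewrite <- gaM, gmulV, ga1. Qed.

Lemma gaVr {G : group} {S : gset G} (h : G) (s : S) : ga h (ga (ginv G h) s) = s.
Proof. now rewrite <- gaM, gmulVr, ga1. Qed.

Section GSets.
Context {G : group}.

Definition stab_le (S : gset G) (K : nat) : Prop :=
  forall s : S, exists L : list G, (length L <= K)%nat /\ forall h, ga h s = s -> In h L.

(** The representatives in [L] may lie outside [D], which makes the notion pass to subsets at
    once. *)
Definition cofinite {S : gset G} (D : S -> Prop) : Prop :=
  exists L : list S, forall s, D s -> exists h y, In y L /\ s = ga h y.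

Definition invar {S : gset G} (D : S -> Prop) : Prop := forall h s, D s -> D (ga h s).

Lemma invar_iff {S : gset G} (D : S -> Prop) : invar D -> forall h s, D (ga h s) <-> D s.
Proof.
  intros H h s. split; [|apply H]. intros E. apply (H (ginv G h)) in E. now rewrite gaV in E.
Qed.

Lemma cofinite_sub {S : gset G} (D D' : S -> Prop) :
  cofinite D -> (forall s, D' s -> D s) -> cofinite D'.
Proof. intros [L H] HD. exists L. auto. Qed.

Lemma transporter_finite {S : gset G} {K} (s t : S) : stab_le S K ->
  exists L : list G, forall h, ga h s = t -> In h L.
Proof.
  intros HK. destruct (classic (exists h0, ga h0 s = t)) as [[h0 H0]|Hn].
  - destruct (HK s) as (L & _ & HL).
    exists (map (fun k => gmul G h0 k) L). intros h E.
    replace h with (gmul G h0 (gmul G (ginv G h0) h)) by now rewrite gmulA, gmulVr, gmul1.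
    apply in_map, HL. rewrite gaM, E, <- H0. apply gaV.
  - exists []. intros h E. exfalso; eauto.
Qed.

Lemma transporter_finite_list {S : gset G} {K} (s : S) (L : list S) : stab_le S K ->
  exists L' : list G, forall h, In (ga h s) L -> In h L'.
Proof.
  intros HK. destruct (finite_union (fun t h => ga h s = t) L) as [M HM].
  - intros t. eapply transporter_finite, HK.
  - exists M. intros h Hh. now apply (HM (ga h s)).
Qed.

(** Up to translation [s] is one of finitely many [y]. If [ga h y] is related to [t], then
    [ga (ginv G h) t] lies in the finite row of [y], and finite stabilisers leave finitely many such
    [h]. Local finiteness of cocompact complexes comes from this. *)
Lemma column_finite {S T : gset G} {K} (r : S -> T -> Prop) (D : S -> Prop) :
  stab_le T K -> cofinite D ->
  (forall h s t, r s t -> r (ga h s) (ga h t)) ->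
  (forall s, exists L, forall t, r s t -> In t L) ->
  forall t, exists L, forall s, D s -> r s t -> In s L.
Proof.
  intros HK [L0 H0] Hinv Hrow t.
  assert (HL : forall L0 : list S, exists L, forall h y, In y L0 -> r (ga h y) t -> In (ga h y) L).
  { intros L. induction L as [|y L [M IH]].
    - exists []. simpl; tauto.
    - destruct (Hrow y) as [Ly Hy].
      destruct (transporter_finite_list t Ly HK) as [LH HH].
      exists (map (fun k => ga (ginv G k) y) LH ++ M).
      intros h y' [<-|Hy'] Hr; apply in_or_app; [left|right; auto].
      assert (Hk : In (ginv G h) LH).
      { apply HH, Hy. apply (Hinv (ginv G h)) in Hr. now rewrite gaV in Hr. }
      apply in_map_iff. exists (ginv G h). split; auto.
      now rewrite ginvK. }
  destruct (HL L0) as [L HL']. exists L. intros s Ds Hr.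
  destruct (H0 s Ds) as (h & y & Hy & ->). auto.
Qed.

Lemma invar_bounded {S : gset G} (D : S -> Prop) (f : S -> R) :
  cofinite D -> (forall h s, f (ga h s) = f s) -> (forall s, f s <> 0 -> D s) ->
  exists c, 0 < c /\ forall s, Rabs (f s) <= c.
Proof.
  intros [L HL] Hf HD.
  exists (1 + sum_R (map (fun s => Rabs (f s)) L)).
  assert (P : forall L : list S, 0 <= sum_R (map (fun s => Rabs (f s)) L)).
  { induction L0 as [|a L0 IH]; simpl; [lra|]. pose proof (Rabs_pos (f a)). lra. }
  split; [specialize (P L); lra|]. intros s.
  destruct (Req_dec (f s) 0) as [E|E].
  - rewrite E, Rabs_R0. specialize (P L). lra.
  - destruct (HL s (HD s E)) as (h & y & Hy & ->). rewrite Hf. clear -Hy P.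
    induction L as [|a L IH]; simpl; [destruct Hy|].
    destruct Hy as [<-|Hy]; [specialize (P L); lra|]. specialize (IH Hy).
    pose proof (Rabs_pos (f a)). lra.
Qed.

(* Plays the role of 1/|Stab| on a set of orbit representatives of D, and 0 elsewhere. *)
Record weight {S : gset G} (D : S -> Prop) (rho : S -> R) : Prop := Weight {
  w_pos : forall s, 0 <= rho s;
  w_le1 : forall s, rho s <= 1;
  w_supp : forall s, rho s <> 0 -> D s;
  w_fin : fsupp rho;
  w_fin_orb : forall s, fsupp (fun h => rho (ga h s));
  w_sum : forall s, D s -> fsum (fun h => rho (ga h s)) = 1
}.

(** The weight at a representative is 1/|Stab|. The last clause, a value of at least 1/K somewhere
    on every orbit, later turns a bound on total weight into a bound on the number of orbits. *)
Lemma weight_exists {S : gset G} {K} (D : S -> Prop) (L : list S) :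
  stab_le S K -> invar D ->
  (forall s, D s -> exists h y, In y L /\ s = ga h y) ->
  exists rho, weight D rho /\ (forall s, rho s <> 0 -> In s L) /\
    (forall s, D s -> exists h, 1 <= INR K * rho (ga h s)).
Proof.
  intros HK HD HL.
  set (orb := fun (s t : S) => In t L /\ exists h : G, t = ga h s).
  assert (Horb : forall h s, orb (ga h s) = orb s).
  { intros h s. apply functional_extensionality; intros t. apply propositional_extensionality.
    unfold orb. split; intros [Ht [k ->]]; split; auto.
    - exists (gmul G k h). now rewrite gaM.
    - exists (gmul G k (ginv G h)). now rewrite gaM, gaV. }
  (* Translates have equal predicates [orb], so one representative is chosen for a whole orbit; the
     differing defaults are removed by [epsilon_inh_irrelevance]. *)
  set (c := fun s : S => epsilon (inhabits s) (orb s)).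
  assert (Hc : forall s, D s -> orb s (c s)).
  { intros s Ds. apply epsilon_spec. destruct (HL s Ds) as (h & y & Hy & ->).
    exists y; split; auto. exists (ginv G h). now rewrite gaV. }
  assert (Hcc : forall s h, D s -> c (ga h s) = c s).
  { intros s h Ds. unfold c. rewrite Horb. apply epsilon_inh_irrelevance.
    exists (c s). now apply Hc. }
  (* The order of the stabiliser of [t]. *)
  set (N := fun t : S => fsum (fun h : G => indic (ga h t = t))).
  assert (FN : forall s t : S, fsupp (fun h : G => indic (ga h s = t))).
  { intros s t. destruct (transporter_finite s t HK) as [M HM]. exists M.
    intros h E. apply HM. unfold indic in E. destruct (dec _); [auto|lra]. }
  assert (HN1 : forall t, 1 <= N t).
  { intros t. pose proof (fsum_term_le (fun h => indic (ga h t = t)) (gone G) (FN t t)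
      (fun h => proj1 (indic_bounds _))) as E. simpl in E.
    rewrite (indic_true _ (ga1 _ _ t)) in E. exact E. }
  assert (HNK : forall t, N t <= INR K).
  { intros t. destruct (HK t) as (M & HM & HM').
    destruct (finite_list (fun h => ga h t = t)) as (M' & N' & H'); [eauto|].
    unfold N. rewrite (fsum_eq _ M'); auto.
    - rewrite (sumR_ext _ (fun _ => 1)).
      + rewrite sumR_const. rewrite Rmult_1_r. apply le_INR.
        etransitivity; [|exact HM]. apply NoDup_incl_length; auto.
        intros h Hh. apply HM', H', Hh.
      + intros h Hh. apply indic_true, H', Hh.
    - intros h E. apply H'. unfold indic in E. destruct (dec _); [auto|lra]. }
  set (rho := fun t : S => indic (D t /\ c t = t) / N t).
  assert (Rnz : forall t, rho t <> 0 -> D t /\ c t = t).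
  { intros t E. apply NNPP. intros Hn. apply E. unfold rho. rewrite (indic_false _ Hn). lra. }
  assert (RinL : forall t, rho t <> 0 -> In t L).
  { intros t E. apply Rnz in E. destruct E as [Dt <-]. apply (Hc t Dt). }
  assert (Rform : forall s, D s -> forall h, rho (ga h s) = / N (c s) * indic (ga h s = c s)).
  { intros s Ds h. unfold rho. rewrite Hcc; auto.
    rewrite (indic_iff (D (ga h s) /\ c s = ga h s) (ga h s = c s)).
    - unfold indic. destruct (dec _) as [->|]; unfold Rdiv; lra.
    - rewrite (invar_iff D HD). intuition. }
  exists rho. split; [|split]; auto.
  - constructor.
    + intros s. unfold rho. pose proof (HN1 s). pose proof (indic_bounds (D s /\ c s = s)).
      unfold Rdiv. apply Rmult_le_pos; [lra|]. left. apply Rinv_0_lt_compat. lra.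
    + intros s. unfold rho. pose proof (HN1 s). pose proof (indic_bounds (D s /\ c s = s)).
      apply (Rmult_le_reg_r (N s)); [lra|]. unfold Rdiv. rewrite Rmult_assoc, Rinv_l; lra.
    + intros s E; now apply Rnz.
    + exists L; auto.
    + intros s. destruct (transporter_finite_list s L HK) as [M HM]. exists M. auto.
    + intros s Ds. rewrite (fsum_ext _ _ (Rform s Ds)), fsum_scal; auto.
      destruct (Hc s Ds) as [_ [h0 Eh0]].
      replace (fsum (fun h => indic (ga h s = c s))) with (N (c s)).
      * apply Rinv_l. pose proof (HN1 (c s)). lra.
      * unfold N.
        rewrite <- (fsum_reindex (fun k => gmul G k h0) (fun k => gmul G k (ginv G h0))
                      (fun h => indic (ga h s = c s))); auto.
        -- apply fsum_ext. intros k. now rewrite gaM, <- Eh0.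
        -- intros k. now rewrite <- gmulA, gmulVr, gmul1r.
        -- intros k. now rewrite <- gmulA, gmulV, gmul1r.
  - intros s Ds. destruct (Hc s Ds) as [_ [h0 Eh0]]. exists h0.
    rewrite Rform, indic_true; auto. pose proof (HN1 (c s)). pose proof (HNK (c s)).
    rewrite Rmult_1_r. apply (Rmult_le_reg_r (N (c s))); [lra|].
    rewrite Rmult_assoc, Rinv_l; lra.
Qed.

Lemma weight_pullback {S S' : gset G} (p : S' -> S) D rho (D' : S' -> Prop) rho' :
  (forall h s, p (ga h s) = ga h (p s)) -> weight D rho ->
  (forall s, D' s -> D (p s)) -> (forall s, D' s -> rho' s = rho (p s)) ->
  (forall s, ~ D' s -> rho' s = 0) -> invar D' -> fsupp rho' -> weight D' rho'.
Proof.
  intros Hp W HD Hr Hr0 Hi Hf. constructor; auto.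
  - intros s. destruct (classic (D' s)); [rewrite Hr|rewrite Hr0]; auto; [apply W|lra].
  - intros s. destruct (classic (D' s)); [rewrite Hr|rewrite Hr0]; auto; [apply W|lra].
  - intros s E. apply NNPP. intros Hn. apply E. auto.
  - intros s. apply (fsupp_sub (fun h => rho (ga h (p s)))); [apply W|].
    intros h E. destruct (classic (D' (ga h s))); [rewrite Hr, Hp|rewrite Hr0]; auto.
  - intros s Ds. rewrite <- (w_sum D rho W (p s)); auto. apply fsum_ext.
    intros h. rewrite Hr, Hp; auto.
Qed.

Lemma weight_sum_mono {S : gset G} {K} (D : S -> Prop) L rho :
  weight D rho -> stab_le S K -> (forall s, rho s <> 0 -> In s L) ->
  fsum rho <= INR (length L).
Proof.
  intros W HK H. destruct (NoDup_cover L) as (L' & N & HL').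
  rewrite (fsum_eq _ L'); auto; [|intros; apply HL'; auto].
  etransitivity; [apply (sumR_le _ (fun _ => 1)); intros; apply W|].
  rewrite sumR_const, Rmult_1_r. apply le_INR, NoDup_incl_length; auto.
  intros a; apply HL'.
Qed.

(** With [w s t] read as mass sent from [s] to [t], the mass sent equals the mass received, per
    orbit. A factor 1, the sum over h of [rho' (ga h t)], is inserted on the left, the pair (s, t)
    is replaced by its translate by the inverse of h, and the sum over h of [rho] then collapses to
    1. This is both the trace property needed for R[G] and the double counting behind
    Gauss-Bonnet. *)
Lemma mass_transport {S T : gset G} D rho D' rho' (w : S -> T -> R) :
  @weight S D rho -> @weight T D' rho' ->
  (forall h s t, w (ga h s) (ga h t) = w s t) ->
  (forall s t, w s t <> 0 -> D s /\ D' t) ->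
  (forall s, fsupp (w s)) -> (forall t, fsupp (fun s => w s t)) ->
  fsum (fun s => rho s * fsum (w s)) = fsum (fun t => rho' t * fsum (fun s => w s t)).
Proof.
  intros W W' Hw HD Frow Fcol.
  assert (E1 : forall s, rho s * fsum (w s) =
     fsum (fun t => fsum (fun h : G => rho s * w s t * rho' (ga h t)))).
  { intros s. rewrite <- fsum_scal by auto. apply fsum_ext. intros t.
    rewrite fsum_scal by apply W'. destruct (Req_dec (w s t) 0) as [E|E].
    - rewrite E; lra.
    - rewrite (w_sum _ _ W' t); [lra|]. now apply (HD s t). }
  assert (E2 : forall t, rho' t * fsum (fun s => w s t) =
     fsum (fun s => fsum (fun h : G => rho (ga (ginv G h) s) * w s t * rho' t))).
  { intros t. rewrite <- fsum_scal by auto. apply fsum_ext. intros s.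
    assert (F : fsupp (fun h : G => rho (ga (ginv G h) s))).
    { apply (fsupp_reindex (fun h => ginv G h) (fun h => ginv G h) (fun h => rho (ga h s))).
      - apply ginvK.
      - apply W. }
    rewrite (fsum_ext _ (fun h : G => (w s t * rho' t) * rho (ga (ginv G h) s)))
      by (intros; lra).
    rewrite fsum_scal by auto.
    destruct (Req_dec (w s t) 0) as [E|E].
    - rewrite E; lra.
    - rewrite (fsum_reindex (fun h => ginv G h) (fun h => ginv G h) (fun h => rho (ga h s))).
      + rewrite (w_sum _ _ W s); [lra|]. now apply (HD s t).
      + apply ginvK.
      + apply ginvK.
      + apply W. }
  rewrite (fsum_ext _ _ E1), (fsum_ext _ _ E2).
  destruct (w_fin _ _ W) as [LS HLS]. destruct (w_fin _ _ W') as [LT HLT].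
  assert (exists LT1, forall s t, In s LS -> w s t <> 0 -> In t LT1) as [LT1 HLT1]
    by apply (finite_union (fun s t => w s t <> 0)), Frow.
  assert (exists LS1, forall t s, In t LT -> w s t <> 0 -> In s LS1) as [LS1 HLS1]
    by apply (finite_union (fun t s => w s t <> 0)), Fcol.
  assert (exists LH, forall t h, In t LT1 -> rho' (ga h t) <> 0 -> In h LH) as [LH HLH]
    by (apply (finite_union (fun t h => rho' (ga h t) <> 0)), W').
  assert (nz3 : forall a b c : R, a * b * c <> 0 -> a <> 0 /\ b <> 0 /\ c <> 0).
  { intros a b c E. repeat split; intros ->; apply E; ring. }
  rewrite (fsum_ext _ (fun s => fsum (fun h : G => fsum (fun t => rho s * w s t * rho' (ga h t))))).
  2:{ intros s. apply (fsum_swap (fun t h => rho s * w s t * rho' (ga h t))).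
      exists LT1, LH. intros t h E. apply nz3 in E. destruct E as (E & Ew & E').
      apply HLS in E. split; [eapply HLT1; eauto|]. eapply HLH; eauto. }
  assert (LHf : forall s h, (exists t, rho s * w s t * rho' (ga h t) <> 0) -> In s LS /\ In h LH).
  { intros s h [t E]. apply nz3 in E. destruct E as (E & Ew & E').
    apply HLS in E. split; auto. eapply HLH; eauto. }
  assert (zero : forall {A} (f : A -> R), fsum f <> 0 -> exists a, f a <> 0).
  { intros A f E. apply NNPP. intros Hn. apply E. rewrite (fsum_ext _ (fun _ => 0)).
    - apply fsum_0. - intros a. apply NNPP. intros Ha. eauto. }
  rewrite (fsum_swap (fun s h => fsum (fun t => rho s * w s t * rho' (ga h t)))).
  2:{ exists LS, LH. intros s h E. apply LHf. now apply zero in E. }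
  (* substitute (s,t) -> (h^-1 s, h^-1 t) *)
  rewrite (fsum_ext _ (fun h : G => fsum (fun t => fsum (fun s => rho (ga (ginv G h) s) * w s t * rho' t)))).
  - rewrite (fsum_swap (fun h t => fsum (fun s => rho (ga (ginv G h) s) * w s t * rho' t))).
    2:{ exists LH, LT. intros h t E. apply zero in E. destruct E as [s E].
        assert (E0 := E). apply nz3 in E. destruct E as (E & Ew & E'). split; auto.
        apply (LHf (ga (ginv G h) s)). exists (ga (ginv G h) t). now rewrite Hw, gaVr. }
    apply fsum_ext. intros t.
    apply (fsum_swap (fun h s => rho (ga (ginv G h) s) * w s t * rho' t)).
    exists LH, LS1. intros h s E. assert (E0 := E). apply nz3 in E. destruct E as (E & Ew & E').
    split.
    + apply (LHf (ga (ginv G h) s)). exists (ga (ginv G h) t). now rewrite Hw, gaVr.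
    + eapply HLS1; eauto.
  - intros h.
    rewrite (fsum_swap (fun s t => rho s * w s t * rho' (ga h t))).
    2:{ exists LS, LT1. intros s t E. apply nz3 in E. destruct E as (E & Ew & E'). split; auto.
        eapply HLT1; eauto. }
    rewrite <- (fsum_reindex (fun t => ga h t) (fun t => ga (ginv G h) t)
              (fun t => fsum (fun s => rho (ga (ginv G h) s) * w s t * rho' t))).
    + apply fsum_ext. intros t.
      rewrite <- (fsum_reindex (fun s => ga h s) (fun s => ga (ginv G h) s)
              (fun s => rho (ga (ginv G h) s) * w s (ga h t) * rho' (ga h t))).
      * apply fsum_ext. intros s. now rewrite gaV, Hw.
      * intros s; apply gaV.
      * intros s; apply gaVr.
      * apply fsupp_mulr, fsupp_mull; auto.
    + intros s; apply gaV.
    + intros s; apply gaVr.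
    + exists LT. intros t E. apply zero in E. destruct E as [s E]. apply nz3 in E. apply HLT; tauto.
Qed.

End GSets.

(** * Equivariant operators on finitely supported functions *)

Definition dot {A} (u v : A -> R) : R := fsum (fun a => u a * v a).
Definition delta {A} (a : A) : A -> R := fun b => indic (b = a).
Definition ap {A B} (k : B -> A -> R) (u : A -> R) : B -> R := fun b => fsum (fun a => k b a * u a).
Definition tker {A B} (k : B -> A -> R) : A -> B -> R := fun a b => k b a.

Lemma fsupp_dl {A} (a : A) : fsupp (delta a).
Proof. apply fsupp_delta. Qed.

Ltac fs := first [solve [auto] | apply fsupp_delta | apply fsupp_plus; fs
  | apply fsupp_mulr; fs | apply fsupp_mull; fs].

Section Kernels.
Context {A B : Type} (k : B -> A -> R).
Hypothesis colf : forall a, fsupp (fun b => k b a).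

Lemma dot_pos (u : A -> R) : 0 <= dot u u.
Proof. apply fsum_ge0. intros; nra. Qed.

Lemma dot_comm (u v : A -> R) : dot u v = dot v u.
Proof. apply fsum_ext. intros; ring. Qed.

Lemma dot_delta (u : A -> R) a : dot (delta a) u = u a.
Proof. apply fsum_delta. Qed.

Lemma dot_lin (u v w : A -> R) x y : fsupp u -> fsupp v ->
  dot (fun a => x * u a + y * v a) w = x * dot u w + y * dot v w.
Proof.
  intros Hu Hv. unfold dot.
  rewrite (fsum_ext _ (fun a => x * (u a * w a) + y * (v a * w a))) by (intros; ring).
  rewrite fsum_plus, !fsum_scal; fs.
Qed.

Lemma fsupp_lin (u v : A -> R) x y : fsupp u -> fsupp v -> fsupp (fun a => x * u a + y * v a).
Proof. intros; apply fsupp_plus; now apply fsupp_mull. Qed.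

Lemma dot_amgm (u v : A -> R) l : 0 < l -> fsupp u -> fsupp v ->
  dot u v <= l * dot u u + dot v v / l.
Proof.
  intros Hl Hu Hv. unfold dot, Rdiv. rewrite Rmult_comm with (r2 := / l).
  rewrite <- !fsum_scal, <- fsum_plus; try fs.
  apply fsum_le; try fs.
  - intros a. apply (Rmult_le_reg_l l); auto.
    replace (l * (l * (u a * u a) + / l * (v a * v a)))
      with ((l * u a) * (l * u a) + v a * v a) by (field; lra).
    pose proof (Rle_0_sqr (l * u a - v a)). pose proof (Rle_0_sqr (l * u a)).
    pose proof (Rle_0_sqr (v a)). unfold Rsqr in *. nra.
Qed.

Lemma ap_fsupp (u : A -> R) : fsupp u -> fsupp (ap k u).
Proof.
  intros [L HL].
  assert (exists M, forall a b, In a L -> k b a <> 0 -> In b M) as [M HM]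
      by apply (finite_union (fun a b => k b a <> 0)), colf.
  exists M. intros b E. apply NNPP. intros Hn. apply E. unfold ap.
  rewrite (fsum_ext _ (fun _ => 0)); [apply fsum_0|]. intros a.
  destruct (Req_dec (u a) 0) as [->|E']; [ring|].
  destruct (Req_dec (k b a) 0) as [->|E'']; [ring|]. exfalso; eauto.
Qed.

Lemma ap_lin (u v : A -> R) x y : fsupp u -> fsupp v -> forall b,
  ap k (fun a => x * u a + y * v a) b = x * ap k u b + y * ap k v b.
Proof.
  intros Hu Hv b. unfold ap.
  rewrite (fsum_ext _ (fun a => x * (k b a * u a) + y * (k b a * v a))) by (intros; ring).
  rewrite fsum_plus, !fsum_scal; fs.
Qed.

Lemma ap_delta a b : ap k (delta a) b = k b a.
Proof.
  unfold ap. rewrite (fsum_ext _ (fun x => indic (x = a) * k b x)).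
  - apply fsum_delta.
  - intros; unfold delta; ring.
Qed.

Lemma ap_adj (u : A -> R) (y : B -> R) : fsupp u -> fsupp y ->
  dot (ap k u) y = dot u (ap (tker k) y).
Proof.
  intros Hu Hy. unfold dot, ap, tker.
  rewrite (fsum_ext _ (fun b => fsum (fun a => k b a * u a * y b))).
  2:{ intros b. rewrite Rmult_comm, <- fsum_scal by now apply fsupp_mull.
      apply fsum_ext. intros; ring. }
  rewrite fsum_swap.
  - apply fsum_ext. intros a. rewrite <- fsum_scal by now apply fsupp_mull.
    apply fsum_ext. intros; ring.
  - destruct Hu as [L HL], Hy as [M HM]. exists M, L. intros b a E. split.
    + apply HM. intros Z. apply E. rewrite Z; ring.
    + apply HL. intros Z. apply E. rewrite Z; ring.
Qed.

(** Schur's test: Cauchy-Schwarz in each row with weight |k b a| gives the factor [r1], and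
    exchanging the sums gives the column bound [r2]. *)
Lemma schur_test r1 r2 (u : A -> R) : 0 < r1 ->
  (forall b, fsupp (k b)) ->
  (forall b, fsum (fun a => Rabs (k b a)) <= r1) ->
  (forall a, fsum (fun b => Rabs (k b a)) <= r2) ->
  fsupp u -> dot (ap k u) (ap k u) <= r1 * r2 * dot u u.
Proof.
  intros Hr1 rowf H1 H2 Hu.
  assert (absr : forall b, fsupp (fun a => Rabs (k b a))).
  { intros b. apply (fsupp_sub (k b)); auto. intros a ->. apply Rabs_R0. }
  assert (absc : forall a, fsupp (fun b => Rabs (k b a))).
  { intros a. apply (fsupp_sub (fun b => k b a)); auto. intros b ->. apply Rabs_R0. }
  assert (CS : forall b, ap k u b * ap k u b <= r1 * fsum (fun a => Rabs (k b a) * (u a * u a))).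
  (* The sum [E] is that of |k b a| (x - sgn(k b a) u a)^2. The value of [x] minimises r1 x^2 - 2 B0
     x + Q, and nonnegativity there is the row estimate. *)
  { intros b. set (B0 := ap k u b). set (Q := fsum _). set (x := B0 / r1).
    assert (E : 0 <= fsum (fun a => (x * x) * Rabs (k b a) + ((-2 * x) * (k b a * u a)
                       + Rabs (k b a) * (u a * u a)))).
    { apply fsum_ge0. intros a. pose proof (Rle_0_sqr (x - u a)). pose proof (Rle_0_sqr (x + u a)).
      unfold Rsqr in *. unfold Rabs. destruct (Rcase_abs (k b a)); nra. }
    rewrite fsum_plus, fsum_plus, !fsum_scal in E; try fs.
    fold Q in E. change (fsum (fun a => k b a * u a)) with B0 in E.
    specialize (H1 b). set (P := fsum (fun a => Rabs (k b a))) in *.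
    assert (E2 : 0 <= x * x * r1 + (-2 * x * B0 + Q)).
    { assert (0 <= x * x) by nra. nra. }
    unfold x in E2.
    replace (B0 / r1 * (B0 / r1) * r1 + (-2 * (B0 / r1) * B0 + Q)) with (Q - B0 * B0 / r1) in E2
      by (field; lra).
    apply (Rmult_le_reg_r (/ r1)); [now apply Rinv_0_lt_compat|].
    replace (r1 * Q * / r1) with Q by (field; lra). unfold Rdiv in E2. lra. }
  assert (Fcs : fsupp (fun b => fsum (fun a => Rabs (k b a) * (u a * u a)))).
  { change (fsupp (ap (fun b a => Rabs (k b a)) (fun a => u a * u a))).
    destruct Hu as [L HL].
    assert (exists M, forall a b, In a L -> k b a <> 0 -> In b M) as [M HM]
      by apply (finite_union (fun a b => k b a <> 0)), colf.
    exists M. intros b E. apply NNPP. intros Hn. apply E. unfold ap.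
    rewrite (fsum_ext _ (fun _ => 0)); [apply fsum_0|]. intros a.
    destruct (Req_dec (u a) 0) as [->|E']; [ring|].
    destruct (Req_dec (k b a) 0) as [->|E'']; [rewrite Rabs_R0; ring|]. exfalso; eauto. }
  unfold dot at 1.
  etransitivity; [apply fsum_le; [apply fsupp_mulr, ap_fsupp; auto| |exact CS]; now apply fsupp_mull|].
  rewrite fsum_scal by auto. rewrite Rmult_assoc. apply Rmult_le_compat_l; [lra|].
  rewrite fsum_swap.
  - unfold dot. rewrite <- fsum_scal by now apply fsupp_mulr.
    apply fsum_le.
    + apply (fsupp_sub u); auto. intros a ->.
      rewrite (fsum_ext _ (fun _ => 0)) by (intros; ring). apply fsum_0.
    + apply fsupp_mull. now apply fsupp_mulr.
    + intros a. rewrite (fsum_ext _ (fun b => (u a * u a) * Rabs (k b a))) by (intros; ring).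
      rewrite fsum_scal by auto. specialize (H2 a). nra.
  - destruct Hu as [L HL].
    assert (exists M, forall a b, In a L -> k b a <> 0 -> In b M) as [M HM]
      by apply (finite_union (fun a b => k b a <> 0)), colf.
    exists M, L. intros b a E.
    assert (u a <> 0) by (intros Z; apply E; rewrite Z; ring).
    split; [|auto]. apply (HM a); auto. intros Z; apply E; rewrite Z, Rabs_R0; ring.
Qed.

End Kernels.

Section Damp.
Context {A B : Type} (a : B -> A -> R) (c : R).

(** The operator 1 - A^T A / c, with coefficients spelled out so that the linearity lemmas apply
    literally. When c bounds the squared norm of A it is a positive contraction, whose powers
    approach the projection onto the kernel of A. *)
Definition damp (u : A -> R) : A -> R := fun s => 1 * u s + (- / c) * ap (tker a) (ap a u) s.

Fixpoint iterf {X} (n : nat) (f : X -> X) (x : X) : X :=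
  match n with O => x | S m => f (iterf m f x) end.

Hypothesis rowf : forall b, fsupp (a b).
Hypothesis colf : forall s, fsupp (fun b => a b s).

Lemma damp_fsupp u : fsupp u -> fsupp (damp u).
Proof.
  intros Hu. apply fsupp_lin; auto. apply ap_fsupp; [apply rowf|]. now apply ap_fsupp.
Qed.

Lemma iter_fsupp n u : fsupp u -> fsupp (iterf n damp u).
Proof. intros; induction n; simpl; auto using damp_fsupp. Qed.

Lemma damp_sym u v : fsupp u -> fsupp v -> dot (damp u) v = dot u (damp v).
Proof.
  intros Hu Hv.
  assert (Fa : forall w, fsupp w -> fsupp (ap a w)) by (intros; now apply ap_fsupp).
  assert (Ft : forall w, fsupp w -> fsupp (ap (tker a) w)) by (intros; now apply ap_fsupp).
  unfold damp. rewrite (dot_comm u), !dot_lin; auto. rewrite (dot_comm v u).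
  rewrite (ap_adj (tker a) _ v) by auto.
  rewrite (ap_adj (tker a) _ u) by auto.
  change (tker (tker a)) with a. now rewrite (dot_comm (ap a u)).
Qed.

Lemma iter_sym n u v : fsupp u -> fsupp v -> dot (iterf n damp u) v = dot u (iterf n damp v).
Proof.
  intros Hu. revert v. induction n as [|n IH]; simpl; intros v Hv; auto.
  rewrite damp_sym, IH; auto using damp_fsupp, iter_fsupp.
  f_equal. clear -v. induction n as [|n IH]; simpl; [reflexivity|]. now rewrite IH.
Qed.

Lemma iter_add {X} n m (f : X -> X) x : iterf (n + m) f x = iterf n f (iterf m f x).
Proof. induction n; simpl; congruence. Qed.

End Damp.

Lemma damp_intertwine {A B} (a : B -> A -> R) c n u :
  (forall b, fsupp (a b)) -> (forall s, fsupp (fun b => a b s)) -> fsupp u ->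
  ap a (iterf n (damp a c) u) = iterf n (damp (tker a) c) (ap a u).
Proof.
  intros rowf colf Hu. induction n as [|n IH]; simpl; [reflexivity|].
  rewrite <- IH. apply functional_extensionality. intros b. unfold damp at 1.
  assert (Fu := iter_fsupp a c rowf colf n u Hu).
  rewrite ap_lin; auto. apply ap_fsupp; [apply rowf|]. now apply ap_fsupp.
Qed.

Section Trace.
Context {G : group} {S T : gset G} (a : T -> S -> R) (c : R).
Hypothesis rowf : forall b, fsupp (a b).
Hypothesis colf : forall s, fsupp (fun b => a b s).
Hypothesis ainv : forall h t s, a (ga h t) (ga h s) = a t s.

Lemma ap_translate {U V : gset G} (k : V -> U -> R) (u : U -> R) h :
  (forall h t s, k (ga h t) (ga h s) = k t s) -> (forall t, fsupp (k t)) -> forall t,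
  ap k (fun s => u (ga h s)) t = ap k u (ga h t).
Proof.
  intros Hk rf t. unfold ap.
  rewrite <- (fsum_reindex (fun s : U => ga h s) (fun s => ga (ginv G h) s)
     (fun s => k (ga h t) s * u s)).
  - apply fsum_ext. intros s. now rewrite Hk.
  - intros; apply gaV.
  - intros; apply gaVr.
  - now apply fsupp_mulr.
Qed.

Lemma damp_translate u h :
  damp a c (fun s => u (ga h s)) = fun s => damp a c u (ga h s).
Proof.
  apply functional_extensionality. intros s. unfold damp. f_equal. f_equal.
  rewrite <- (ap_translate (tker a)); auto.
  - f_equal. apply functional_extensionality. intros t. now rewrite ap_translate.
  - intros; apply ainv.
Qed.

Lemma iter_translate n u h :
  iterf n (damp a c) (fun s => u (ga h s)) = fun s => iterf n (damp a c) u (ga h s).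
Proof. induction n as [|n IH]; simpl; [reflexivity|]. now rewrite IH, damp_translate. Qed.

Lemma delta_translate {U : gset G} (s : U) h :
  (fun x => delta (ga h s) (ga h x)) = delta s.
Proof.
  apply functional_extensionality. intros x. apply indic_iff. split; [|congruence].
  intros E. apply (f_equal (ga (ginv G h))) in E. now rewrite !gaV in E.
Qed.

Variables (DS : S -> Prop) (rS : S -> R) (DT : T -> Prop) (rT : T -> R).
Hypothesis WS : weight DS rS.
Hypothesis WT : weight DT rT.
Hypothesis asupp : forall t s, a t s <> 0 -> DT t /\ DS s.
Hypothesis c_pos : 0 < c.

(** The analogue of the von Neumann trace: diagonal entries at orbit representatives, counted with
    the weight of the orbit. *)
Definition traceS n := fsum (fun s => rS s * iterf n (damp a c) (delta s) s).
Definition traceT n := fsum (fun t => rT t * iterf n (damp (tker a) c) (delta t) t).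

(** Both sides are the (t, s) entry of A N^n = M^n A, where N is [damp a c] and M is
    [damp (tker a) c], read along a column and, by symmetry of M, along a row. *)
Lemma swap_entry n t s :
  ap a (iterf n (damp a c) (delta s)) t
  = ap (tker a) (iterf n (damp (tker a) c) (delta t)) s.
Proof.
  assert (Fa : fsupp (ap a (delta s))) by (apply ap_fsupp; auto using fsupp_dl).
  rewrite damp_intertwine by auto using fsupp_dl.
  rewrite <- (dot_delta (iterf n (damp (tker a) c) (ap a (delta s))) t).
  rewrite <- iter_sym, dot_comm, ap_adj, dot_delta; auto using fsupp_dl, iter_fsupp.
Qed.

(** At n = 0 the traces are the total weights. Each further power lowers them by the traces of A A^T
    M^n / c and of A^T A N^n / c, which agree by the trace property, that is by [mass_transport]. *)
Lemma trace_eq n : fsum rT - traceT n = fsum rS - traceS n.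
Proof.
  assert (FS := w_fin _ _ WS). assert (FT := w_fin _ _ WT).
  induction n as [|n IH].
  - unfold traceS, traceT; simpl.
    rewrite (fsum_ext (fun t => rT t * _) rT), (fsum_ext (fun t => rS t * _) rS); [lra| |];
      intros; unfold delta; rewrite indic_true; auto; lra.
  - cut (traceT n - traceT (Datatypes.S n) = traceS n - traceS (Datatypes.S n)); [lra|].
    unfold traceT, traceS. rewrite <- !fsum_minus by now apply fsupp_mulr. simpl.
    rewrite (fsum_ext _ (fun t => rT t *
      fsum (fun s => a t s * (/ c * ap (tker a) (iterf n (damp (tker a) c) (delta t)) s)))).
    2:{ intros t. unfold damp at 2. change (tker (tker a)) with a. unfold ap at 1.
        rewrite (fsum_ext (fun s => a t s * (/ c * _)) (fun s => / c * (a t s *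
          ap (tker a) (iterf n (damp (tker a) c) (delta t)) s))) by (intros; ring).
        rewrite fsum_scal by now apply fsupp_mulr. ring. }
    symmetry.
    rewrite (fsum_ext _ (fun s => rS s *
      fsum (fun t => a t s * (/ c * ap (tker a) (iterf n (damp (tker a) c) (delta t)) s)))).
    2:{ intros s.
        rewrite (fsum_ext (fun t => a t s * (/ c * _)) (fun t => / c * (tker a s t *
          ap a (iterf n (damp a c) (delta s)) t))).
        - rewrite fsum_scal by (apply fsupp_mulr; apply colf). unfold damp at 2. unfold ap at 1. ring.
        - intros t. change (tker a s t) with (a t s). rewrite swap_entry. ring. }
    symmetry. eapply (mass_transport DT rT DS rS); eauto.
    + intros h t s. rewrite ainv. do 2 f_equal.
      rewrite <- (ap_translate (tker a)); auto; [|intros; apply ainv].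
      f_equal. rewrite <- (delta_translate t h).
      pose proof (iter_translate) as _.
      clear -ainv rowf colf. induction n as [|n IH]; simpl; [reflexivity|].
      rewrite <- IH. apply functional_extensionality. intros x. unfold damp. f_equal. f_equal.
      change (tker (tker a)) with a.
      rewrite <- (ap_translate a); auto. f_equal. apply functional_extensionality. intros z.
      rewrite ap_translate; auto. intros; apply ainv.
    + intros t s E. apply (asupp t s). intros Z; apply E; rewrite Z; ring.
    + intros t. apply fsupp_mulr; auto.
    + intros s. apply fsupp_mulr; auto.
Qed.

End Trace.

Lemma choice_on_support {A B} (r : A -> R) (P : A -> B -> Prop) (b0 : B) :
  (forall s, r s <> 0 -> exists x, P s x) -> exists X : A -> B, forall s, r s <> 0 -> P s (X s).
Proof.
  intros H. exists (fun s => epsilon (inhabits b0) (P s)).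
  intros s E. now apply epsilon_spec, H.
Qed.

Lemma fsum_weight_le {A} (r f g : A -> R) : fsupp r -> (forall s, 0 <= r s) ->
  (forall s, r s <> 0 -> f s <= g s) ->
  fsum (fun s => r s * f s) <= fsum (fun s => r s * g s).
Proof.
  intros Fr Hr H. apply fsum_le; try fs.
  intros s. destruct (Req_dec (r s) 0) as [->|E]; [lra|]. specialize (H s E). specialize (Hr s). nra.
Qed.

(* If R[S] is an equivariant retract of R[T], up to a non-equivariant correction factoring
   through the adjoint, then S has at most the measure of T.  With N = 1 - A*A/c, M = 1 - AA*/c the
   difference of the measures is tr M^k - tr N^k, where tr M^2k >= 0 and tr N^2k has liminf 0. *)
Theorem weight_comparison {G : group} {S T : gset G} (a : T -> S -> R) (sg : S -> T -> R)
    DS rS DT rT :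
  weight DS rS -> weight DT rT -> cofinite DS -> cofinite DT ->
  (forall t, fsupp (a t)) -> (forall s, fsupp (fun t => a t s)) ->
  (forall h t s, a (ga h t) (ga h s) = a t s) ->
  (forall t s, a t s <> 0 -> DT t /\ DS s) ->
  (forall s, fsupp (sg s)) -> (forall t, fsupp (fun s => sg s t)) ->
  (forall h s t, sg (ga h s) (ga h t) = sg s t) ->
  (forall s, rS s <> 0 -> exists x, fsupp x /\
     forall y, delta s y = ap (tker a) x y + ap sg (ap a (delta s)) y) ->
  fsum rS <= fsum rT.
Proof.
  intros WS WT CS CT rowf colf ainv asupp srow scol sinv Hdec.
  assert (abs0 : forall x, Rabs x <> 0 -> x <> 0) by (intros x E ->; apply E, Rabs_R0).
  assert (zero : forall {A} (f : A -> R), fsum f <> 0 -> exists a, f a <> 0).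
  { intros A f E. apply NNPP. intros Hn. apply E. rewrite (fsum_ext _ (fun _ => 0)).
    - apply fsum_0. - intros b. apply NNPP. intros Ha. eauto. }
  destruct (invar_bounded DT (fun t => fsum (fun s => Rabs (a t s)))) as (r1 & P1 & B1); auto.
  { intros h t. rewrite <- (fsum_reindex (fun s : S => ga h s) (fun s => ga (ginv G h) s)).
    - apply fsum_ext. intros s. now rewrite ainv.
    - intros; apply gaV.
    - intros; apply gaVr.
    - apply (fsupp_sub (a (ga h t))); auto. intros s ->. apply Rabs_R0. }
  { intros t E. apply zero in E. destruct E as [s E]. now apply abs0, asupp in E. }
  destruct (invar_bounded DS (fun s => fsum (fun t => Rabs (a t s)))) as (r2 & P2 & B2); auto.
  { intros h s. rewrite <- (fsum_reindex (fun t : T => ga h t) (fun t => ga (ginv G h) t)).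
    - apply fsum_ext. intros t. now rewrite ainv.
    - intros; apply gaV.
    - intros; apply gaVr.
    - apply (fsupp_sub (fun t => a t (ga h s))); auto. intros t ->. apply Rabs_R0. }
  { intros s E. apply zero in E. destruct E as [t E]. now apply abs0, asupp in E. }
  (* By Schur's test this bounds the squared norm of A^T, so that [N] is a contraction. *)
  set (c := r2 * r1). assert (Pc : 0 < c) by (unfold c; nra).
  assert (Bd : forall y, fsupp y -> dot (ap (tker a) y) (ap (tker a) y) <= c * dot y y).
  { intros y Hy. apply schur_test; auto.
    - intros s. specialize (B2 s). unfold tker.
      match type of B2 with Rabs ?z <= _ => pose proof (Rle_abs z) end. lra.
    - intros t. specialize (B1 t). unfold tker.
      match type of B1 with Rabs ?z <= _ => pose proof (Rle_abs z) end. lra. }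
  set (N := damp a c). set (e := fun u => dot (ap a u) (ap a u)).
  assert (FN : forall n u, fsupp u -> fsupp (iterf n N u)) by (intros; now apply iter_fsupp).
  (* |N u|^2 = |u|^2 - 2 e(u)/c + |A^T A u|^2/c^2, and [Bd] bounds the last term by e(u)/c. *)
  assert (Drop : forall u, fsupp u -> dot (N u) (N u) <= dot u u - / c * e u).
  { intros u Hu.
    assert (Fa : fsupp (ap a u)) by now apply ap_fsupp.
    assert (Ft : fsupp (ap (tker a) (ap a u))) by (apply ap_fsupp; auto; apply rowf).
    unfold N, damp at 1. rewrite dot_lin by auto.
    rewrite (dot_comm u), (dot_comm (ap _ _)). unfold damp. rewrite !dot_lin by auto.
    rewrite (dot_comm u (ap _ _)).
    replace (dot (ap (tker a) (ap a u)) u) with (e u).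
    2:{ unfold e. rewrite ap_adj; auto. apply dot_comm. }
    specialize (Bd _ Fa). fold (e u) in Bd.
    set (q := dot (ap (tker a) (ap a u)) (ap (tker a) (ap a u))) in *.
    assert (/ c * q <= e u).
    { apply (Rmult_le_reg_l c); auto. rewrite <- Rmult_assoc, Rinv_r; lra. }
    pose proof (Rinv_0_lt_compat _ Pc). nra. }
  assert (Epos : forall u, 0 <= e u) by (intros; apply dot_pos).
  assert (ic := Rinv_0_lt_compat _ Pc).
  assert (Drop2 : forall u, fsupp u -> dot (N (N u)) (N (N u)) <= dot u u - / c * e u).
  { intros u Hu. specialize (Drop u Hu) as E1. specialize (Drop (N u) (FN 1%nat u Hu)) as E2.
    specialize (Epos (N u)). nra. }
  apply NNPP. intros Hlt. apply Rnot_le_lt in Hlt.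
  set (d := fsum rS - fsum rT). assert (Pd : 0 < d) by (unfold d; lra).
  (* An even power of M is the square of a symmetric operator, so its diagonal is nonnegative, and
     [trace_eq] then keeps the trace of N^2j above [d]. *)
  assert (TN : forall j, d <= traceS a c rS (j + j)).
  { intros j. pose proof (trace_eq a c rowf colf ainv DS rS DT rT WS WT asupp (j + j)) as E.
    assert (0 <= traceT a c rT (j + j)).
    { unfold traceT. apply fsum_ge0. intros t. apply Rmult_le_pos; [apply WT|].
      assert (Fm : fsupp (iterf j (damp (tker a) c) (delta t)))
        by (apply (iter_fsupp (tker a) c colf rowf); apply fsupp_dl).
      rewrite iter_add, <- (dot_delta (iterf j _ (iterf j _ _))), <- (iter_sym (tker a) c colf rowf);
        auto using fsupp_dl. apply dot_pos. }
    unfold d. lra. }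
  destruct (choice_on_support rS (fun s x => fsupp x /\
     forall y, delta s y = ap (tker a) x y + ap sg (ap a (delta s)) y) (fun _ => 0)) as [X HX]; auto.
  set (st := fun t : T => fun s => sg s t).
  assert (Fst : forall t, fsupp (st t)) by auto.
  assert (FrS := w_fin _ _ WS). assert (FrT := w_fin _ _ WT).
  (* Substituting the decomposition of [delta s] into the diagonal entry puts A in front of a damped
     vector in both terms. The correction [X] is not equivariant and stays on the representatives in
     S; the equivariant term is moved to T by mass transport, [st t] being the column of [sg] at
     t. *)
  assert (TE : forall n, traceS a c rS n =
     fsum (fun s => rS s * dot (ap a (iterf n N (delta s))) (X s)) +
     fsum (fun t => rT t * dot (ap a (iterf n N (st t))) (delta t))).
  { intros n. unfold traceS. fold N.
    rewrite (fsum_ext _ (fun s => rS s * dot (ap a (iterf n N (delta s))) (X s)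
        + rS s * fsum (fun t => a t s * dot (iterf n N (delta s)) (st t)))).
    - rewrite fsum_plus by fs. f_equal.
      etransitivity.
      { apply (mass_transport DS rS DT rT (fun s t => a t s * dot (iterf n N (delta s)) (st t)));
          auto.
        - intros h s t. rewrite ainv. f_equal.
          unfold dot.
          rewrite <- (fsum_reindex (fun s : S => ga h s) (fun s => ga (ginv G h) s)
             (fun x => iterf n N (delta (ga h s)) x * st (ga h t) x)).
          + apply fsum_ext. intros x. f_equal.
            * rewrite <- (delta_translate s h). unfold N.
              now rewrite (iter_translate a c rowf colf ainv n (delta (ga h s)) h).
            * apply sinv.
          + intros; apply gaV.
          + intros; apply gaVr.
          + apply fsupp_mull; auto.
        - intros s t E. destruct (asupp t s); auto. intros Z; apply E; rewrite Z; ring.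
        - intros s. fs.
        - intros t. fs. }
      apply fsum_ext. intros t. f_equal. rewrite dot_comm, dot_delta.
      unfold ap. apply fsum_ext. intros s. f_equal.
      unfold N. rewrite iter_sym; auto using fsupp_dl. now rewrite dot_delta.
    - intros s. rewrite <- Rmult_plus_distr_l. destruct (Req_dec (rS s) 0) as [->|E]; [ring|].
      f_equal. destruct (HX s E) as [FX HXs].
      assert (Fn : fsupp (iterf n N (delta s))) by auto using fsupp_dl.
      assert (Fad : fsupp (ap a (delta s))) by (apply ap_fsupp; auto using fsupp_dl).
      rewrite <- (dot_delta (iterf n N (delta s))) at 1.
      rewrite (ap_adj a) by auto.
      replace (fsum (fun t => a t s * dot (iterf n N (delta s)) (st t)))
        with (dot (iterf n N (delta s)) (ap sg (ap a (delta s)))).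
      + rewrite dot_comm. unfold dot. rewrite <- fsum_plus by fs. apply fsum_ext.
        intros y. rewrite HXs. ring.
      + rewrite dot_comm, ap_adj by auto. unfold dot. apply fsum_ext. intros t.
        rewrite ap_delta. f_equal. unfold ap, tker, st. apply fsum_ext. intros; ring. }
  (* [E n] is the energy of the damped vectors, and [Z] collects the norms of the fixed vectors
     paired with them in [TE]; [TB] is the weighted arithmetic-geometric mean inequality between the
     two. *)
  set (E := fun n => fsum (fun s => rS s * e (iterf n N (delta s)))
                   + fsum (fun t => rT t * e (iterf n N (st t)))).
  set (Z := fsum (fun s => rS s * dot (X s) (X s)) + fsum (fun t => rT t * dot (delta t) (delta t))).
  assert (PZ : 0 <= Z).
  { unfold Z. pose proof (fun A (r f : A -> R) (H : forall s, 0 <= r s * f s) => fsum_ge0 _ H) as Q.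
    apply Rplus_le_le_0_compat; apply Q; intros; apply Rmult_le_pos; try apply dot_pos;
      [apply WS|apply WT]. }
  assert (TB : forall n l, 0 < l -> traceS a c rS n <= l * E n + Z / l).
  { intros n l Hl. rewrite TE. unfold E, Z.
    assert (B : forall A (r : A -> R) (p q : A -> T -> R), fsupp r -> (forall s, 0 <= r s) ->
       (forall s, r s <> 0 -> fsupp (p s)) -> (forall s, r s <> 0 -> fsupp (q s)) ->
       fsum (fun s => r s * dot (p s) (q s)) <=
       l * fsum (fun s => r s * dot (p s) (p s)) + / l * fsum (fun s => r s * dot (q s) (q s))).
    { intros A r p q Fr Pr Fp Fq. rewrite <- !fsum_scal, <- fsum_plus by fs.
      etransitivity.
      - apply (fsum_weight_le r _ (fun s => l * dot (p s) (p s) + dot (q s) (q s) / l)); auto.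
        intros s Hs. apply dot_amgm; auto.
      - right. apply fsum_ext. intros s. unfold Rdiv. ring. }
    pose proof (B S rS (fun s => ap a (iterf n N (delta s))) X FrS (w_pos _ _ WS)) as B1'.
    pose proof (B T rT (fun t => ap a (iterf n N (st t))) delta FrT (w_pos _ _ WT)) as B2'.
    unfold e, Rdiv.
    assert (fsum (fun s => rS s * dot (ap a (iterf n N (delta s))) (X s)) <=
       l * fsum (fun s => rS s * dot (ap a (iterf n N (delta s))) (ap a (iterf n N (delta s))))
       + / l * fsum (fun s => rS s * dot (X s) (X s))).
    { apply B1'; intros s Hs; [|now apply HX]. apply ap_fsupp; auto using fsupp_dl. }
    assert (fsum (fun t => rT t * dot (ap a (iterf n N (st t))) (delta t)) <=
       l * fsum (fun t => rT t * dot (ap a (iterf n N (st t))) (ap a (iterf n N (st t))))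
       + / l * fsum (fun t => rT t * dot (delta t) (delta t))).
    { apply B2'; intros t Ht; [|apply fsupp_dl]. apply ap_fsupp; auto. }
    lra. }
  (* Chosen so that Z/l is at most d/2 and the energy must supply the other half of [d]; the summand
     1 keeps [l] positive when Z = 0. *)
  set (l := 2 * (Z + 1) / d). assert (Pl : 0 < l).
  { unfold l. apply Rmult_lt_0_compat; [lra|now apply Rinv_0_lt_compat]. }
  assert (Elow : forall j, d / (2 * l) <= E (j + j)%nat).
  { intros j. specialize (TN j). specialize (TB (j + j)%nat l Pl).
    assert (Z / l <= d / 2).
    { unfold l. replace (Z / (2 * (Z + 1) / d)) with (d / 2 * (Z / (Z + 1))) by (field; lra).
      assert (Z / (Z + 1) <= 1).
      { apply (Rmult_le_reg_r (Z + 1)); [lra|]. unfold Rdiv. rewrite Rmult_assoc, Rinv_l; lra. }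
      nra. }
    apply (Rmult_le_reg_l l); auto. replace (l * (d / (2 * l))) with (d / 2) by (field; lra). lra. }
  (* The total squared norm after 2j dampings. Two further dampings cost at least E(2j)/c, hence a
     fixed positive amount, which drives [Q] below 0. They come in pairs because [TN] concerns even
     powers. *)
  set (Q := fun j => fsum (fun s => rS s * dot (iterf (j + j) N (delta s)) (iterf (j + j) N (delta s)))
        + fsum (fun t => rT t * dot (iterf (j + j) N (st t)) (iterf (j + j) N (st t)))).
  assert (Qpos : forall j, 0 <= Q j).
  { intros j. unfold Q.
    apply Rplus_le_le_0_compat; apply fsum_ge0; intros; apply Rmult_le_pos; try apply dot_pos;
      [apply WS|apply WT]. }
  assert (Qstep : forall j, Q (Datatypes.S j) <= Q j - / c * E (j + j)%nat).
  { intros j. unfold Q, E.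
    assert (B : forall A (r : A -> R) (u : A -> S -> R), fsupp r -> (forall s, 0 <= r s) ->
       (forall s, fsupp (u s)) ->
       fsum (fun s => r s * dot (N (N (u s))) (N (N (u s)))) <=
       fsum (fun s => r s * dot (u s) (u s)) - / c * fsum (fun s => r s * e (u s))).
    { intros A r u Fr Pr Fu. rewrite <- fsum_scal, <- fsum_minus by fs.
      etransitivity.
      - apply (fsum_weight_le r _ (fun s => dot (u s) (u s) - / c * e (u s))); auto.
      - right. apply fsum_ext. intros; ring. }
    replace (Datatypes.S j + Datatypes.S j)%nat with (Datatypes.S (Datatypes.S (j + j))) by lia. simpl.
    pose proof (B S rS (fun s => iterf (j + j) N (delta s)) FrS (w_pos _ _ WS)
       (fun s => FN _ _ (fsupp_dl s))) as B1'.
    pose proof (B T rT (fun t => iterf (j + j) N (st t)) FrT (w_pos _ _ WT)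
       (fun t => FN _ _ (Fst t))) as B2'.
    cbv beta in B1', B2'. lra. }
  assert (Qlin : forall j, Q j <= Q O - INR j * (/ c * (d / (2 * l)))).
  { induction j as [|j IH]; [simpl; lra|]. rewrite S_INR. specialize (Qstep j). specialize (Elow j).
    assert (/ c * (d / (2 * l)) <= / c * E (j + j)%nat) by (apply Rmult_le_compat_l; lra). lra. }
  set (w := / c * (d / (2 * l))) in *.
  assert (Pw : 0 < w).
  { unfold w. apply Rmult_lt_0_compat; auto. apply Rmult_lt_0_compat; auto.
    apply Rinv_0_lt_compat. lra. }
  destruct (INR_unbounded (Q O / w)) as [j Hj].
  specialize (Qlin j). specialize (Qpos j).
  assert (Q O < INR j * w).
  { replace (Q O) with (Q O / w * w) by (field; lra). now apply Rmult_lt_compat_r. }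
  lra.
Qed.

Arguments dsrc {X} d.
Arguments dtgt {X} d.
Arguments dinv {X} d.
Arguments path_ok {X} u p v.
Arguments pinv {X} p.
Arguments rot {X} k l.
Arguments path_in {X} S u p v.
Arguments elem_htpy {X} S u v p q.
Arguments homotopic {X} S u v p q.

(** * Paths and homotopies *)

Section Paths.
Context {X : complex}.
Implicit Types (S : subcx X) (u v w : vtx X) (p q : list (dart X)) (d : dart X).

Lemma dinvK d : dinv (dinv d) = d.
Proof. destruct d as [e b]; unfold dinv; simpl. now rewrite Bool.negb_involutive. Qed.

Lemma dsrc_dinv d : dsrc (dinv d) = dtgt d.
Proof. destruct d as [e []]; reflexivity. Qed.

Lemma dtgt_dinv d : dtgt (dinv d) = dsrc d.
Proof. destruct d as [e []]; reflexivity. Qed.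

Lemma dinv_neq d : dinv d <> d.
Proof. destruct d as [e []]; unfold dinv; simpl; congruence. Qed.

Lemma path_ok_cons u d p v : path_ok u (d :: p) v <-> dsrc d = u /\ path_ok (dtgt d) p v.
Proof. reflexivity. Qed.

Lemma path_ok_nil u v : path_ok u (@nil (dart X)) v <-> u = v.
Proof. reflexivity. Qed.

Lemma path_ok_app u p q v : path_ok u (p ++ q) v <-> exists w, path_ok u p w /\ path_ok w q v.
Proof.
  revert u. induction p as [|d p IH]; intros u; simpl app.
  - split; [intros H; exists u; split; [reflexivity|auto]|]. intros (w & <- & H); auto.
  - rewrite path_ok_cons, IH. setoid_rewrite path_ok_cons. firstorder.
Qed.

Lemma path_ok_fun u p v v' : path_ok u p v -> path_ok u p v' -> v = v'.
Proof.
  revert u. induction p as [|d p IH]; intros u.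
  - intros <- <-; reflexivity.
  - rewrite !path_ok_cons. intros [_ H] [_ H']. eauto.
Qed.

Lemma pinv_app p q : pinv (p ++ q) = pinv q ++ pinv p.
Proof. unfold pinv. now rewrite map_app, rev_app_distr. Qed.

Lemma pinv_cons d p : pinv (d :: p) = pinv p ++ [dinv d].
Proof. reflexivity. Qed.

Lemma pinvK p : pinv (pinv p) = p.
Proof.
  induction p as [|d p IH]; [reflexivity|]. rewrite pinv_cons, pinv_app, IH. unfold pinv; simpl.
  now rewrite dinvK.
Qed.

Lemma pinv_length p : length (pinv p) = length p.
Proof. unfold pinv. now rewrite length_rev, length_map. Qed.

Lemma in_pinv d p : In d (pinv p) <-> In (dinv d) p.
Proof.
  unfold pinv. rewrite <- in_rev, in_map_iff. split.
  - intros (x & <- & H). now rewrite dinvK.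
  - intros H. exists (dinv d). split; auto using dinvK.
Qed.

Lemma path_ok_pinv u p v : path_ok u p v -> path_ok v (pinv p) u.
Proof.
  revert u. induction p as [|d p IH]; intros u.
  - intros <-. reflexivity.
  - rewrite path_ok_cons. intros [<- H]. rewrite pinv_cons, path_ok_app. exists (dtgt d).
    split; auto. rewrite path_ok_cons, path_ok_nil, dsrc_dinv, dtgt_dinv; auto.
Qed.

Lemma path_in_end S u p v : is_subcomplex X S -> path_in S u p v -> sV S v.
Proof.
  intros [HE _]. revert u. induction p as [|d p IH]; intros u (Hu & Hp & Hin).
  - now rewrite path_ok_nil in Hp; subst.
  - rewrite path_ok_cons in Hp. destruct Hp as [<- Hp].
    apply (IH (dtgt d)). split; [|split]; auto.
    + destruct (HE (fst d)) as [H1 H2]; [apply Hin; simpl; auto|].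
      unfold dtgt, dtgt'. destruct d as [e []]; simpl in *; auto.
    + intros; apply Hin; simpl; auto.
Qed.

Lemma path_in_app S u p q v : is_subcomplex X S ->
  path_in S u (p ++ q) v <-> exists w, path_in S u p w /\ path_in S w q v.
Proof.
  intros HS. split.
  - intros (Hu & Hp & Hin). apply path_ok_app in Hp. destruct Hp as (w & Hp & Hq).
    assert (path_in S u p w) by (split; [|split]; auto; intros; apply Hin, in_or_app; auto).
    exists w. split; auto. split; [|split]; auto.
    + eapply path_in_end; eauto.
    + intros; apply Hin, in_or_app; auto.
  - intros (w & (Hu & Hp & Hin) & (Hw & Hq & Hin')). split; [|split]; auto.
    + apply path_ok_app; eauto.
    + intros d Hd. apply in_app_or in Hd. destruct Hd; auto.
Qed.

Lemma path_in_pinv S u p v : is_subcomplex X S -> path_in S u p v -> path_in S v (pinv p) u.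
Proof.
  intros HS H. assert (Hv := path_in_end _ _ _ _ HS H). destruct H as (Hu & Hp & Hin).
  split; [|split]; auto using path_ok_pinv.
  intros d Hd. apply in_pinv in Hd. apply Hin in Hd. exact Hd.
Qed.

Lemma path_in_nil S u : sV S u -> path_in S u [] u.
Proof. intros; split; [|split]; auto; [reflexivity|]. simpl; tauto. Qed.

Lemma path_in_mono S S' u p v : subcx_le X S S' -> path_in S u p v -> path_in S' u p v.
Proof. intros (HV & HE & _) (Hu & Hp & Hin). split; [|split]; auto. Qed.

Lemma homotopic_mono S S' u v p q : subcx_le X S S' -> homotopic S u v p q -> homotopic S' u v p q.
Proof.
  intros HS. assert (HS' := HS). destruct HS as (HV & HE & HF). induction 1.
  - apply rst_step. destruct H as (Hp & Hq & H).
    split; [|split]; eauto using path_in_mono.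
    destruct H as [H|(a & b & f & k & r & Hf & H)]; [left; auto|right].
    exists a, b, f, k, r. split; auto.
  - apply rst_refl.
  - now apply rst_sym.
  - eapply rst_trans; eauto.
Qed.

Lemma homotopic_ends S u v p q : homotopic S u v p q -> path_in S u p v <-> path_in S u q v.
Proof.
  induction 1; try tauto. destruct H as (Hp & Hq & _). tauto.
Qed.

Lemma homotopic_whisker S u' u v v' a b p q : is_subcomplex X S ->
  path_in S u' a u -> path_in S v b v' ->
  homotopic S u v p q -> homotopic S u' v' (a ++ p ++ b) (a ++ q ++ b).
Proof.
  intros HS Ha Hb. induction 1.
  - apply rst_step. destruct H as (Hp & Hq & H).
    assert (W : forall z, path_in S u z v -> path_in S u' (a ++ z ++ b) v').
    { intros z Hz. apply path_in_app; auto. exists u; split; auto. apply path_in_app; eauto. }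
    split; [|split]; auto.
    destruct H as [(a0 & b0 & d & -> & ->)|(a0 & b0 & f & k & r & Hf & Hk & Hr & -> & ->)].
    + left. exists (a ++ a0), (b0 ++ b), d. rewrite <- !app_assoc. simpl. auto.
    + right. exists (a ++ a0), (b0 ++ b), f, k, r. rewrite <- !app_assoc. auto.
  - apply rst_refl.
  - now apply rst_sym.
  - eapply rst_trans; eauto.
Qed.

Lemma homotopic_app_l S u' u v a p q : is_subcomplex X S ->
  path_in S u' a u -> sV S v -> homotopic S u v p q -> homotopic S u' v (a ++ p) (a ++ q).
Proof.
  intros HS Ha Hv H. pose proof (homotopic_whisker S u' u v v a [] p q HS Ha (path_in_nil S v Hv) H) as E.
  now rewrite !app_nil_r in E.
Qed.

Lemma homotopic_app_r S u v v' b p q : is_subcomplex X S ->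
  sV S u -> path_in S v b v' -> homotopic S u v p q -> homotopic S u v' (p ++ b) (q ++ b).
Proof.
  intros HS Hu Hb H. exact (homotopic_whisker S u u v v' [] b p q HS (path_in_nil S u Hu) Hb H).
Qed.

Lemma homotopic_cancel S u v p : is_subcomplex X S -> path_in S u p v ->
  homotopic S u u (p ++ pinv p) [].
Proof.
  intros HS. revert u. induction p as [|d p IH]; intros u Hp; [apply rst_refl|].
  rewrite pinv_cons, app_assoc, <- app_comm_cons.
  change (d :: (p ++ pinv p) ++ [dinv d]) with ([d] ++ (p ++ pinv p) ++ [dinv d]).
  change (d :: p) with ([d] ++ p) in Hp. apply path_in_app in Hp; auto.
  destruct Hp as (w & Hd & Hp).
  assert (Hd' := path_in_pinv _ _ _ _ HS Hd).
  eapply rst_trans; [apply (homotopic_whisker S u w w u [d] [dinv d]); auto|].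
  apply rst_sym, rst_step. split; [|split].
  - apply path_in_nil. apply Hd.
  - apply path_in_app; auto. exists w. split; auto.
  - left. exists [], [], d. auto.
Qed.

Lemma homotopic_cancel' S u v p : is_subcomplex X S -> path_in S u p v ->
  homotopic S v v (pinv p ++ p) [].
Proof.
  intros HS Hp. rewrite <- (pinvK p) at 2. eapply homotopic_cancel; eauto using path_in_pinv.
Qed.

Lemma homotopic_rotate S u v p q : is_subcomplex X S ->
  path_in S u p v -> path_in S v q u ->
  homotopic S u u (p ++ q) [] -> homotopic S v v (q ++ p) [].
Proof.
  intros HS Hp Hq H.
  assert (Hp' := path_in_pinv _ _ _ _ HS Hp). assert (Hv := proj1 Hq).
  apply (rst_trans _ _ _ (pinv p ++ (p ++ q) ++ p)).
  - apply rst_sym. rewrite <- app_assoc, (app_assoc (pinv p)).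
    change (q ++ p) with ([] ++ q ++ p) at 2.
    eapply homotopic_app_r; [auto|auto| |eapply homotopic_cancel'; eauto].
    apply path_in_app; eauto.
  - eapply rst_trans; [eapply homotopic_whisker; eauto|].
    simpl. eapply homotopic_cancel'; eauto.
Qed.

Lemma homotopic_loop S u v p q : is_subcomplex X S ->
  path_in S u p v -> path_in S u q v ->
  homotopic S u u (p ++ pinv q) [] -> homotopic S u v p q.
Proof.
  intros HS Hp Hq H. assert (Hq' := path_in_pinv _ _ _ _ HS Hq).
  assert (Hu := proj1 Hp). assert (Hv := proj1 Hq').
  apply (rst_trans _ _ _ ((p ++ pinv q) ++ q)).
  - rewrite <- app_assoc. apply rst_sym. eapply rst_trans.
    + eapply homotopic_app_l; eauto. eapply homotopic_cancel'; eauto.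
    + rewrite app_nil_r. apply rst_refl.
  - eapply rst_trans; [eapply homotopic_app_r; eauto|]. apply rst_refl.
Qed.

Lemma fbnd_loop f : exists v, path_ok v (fbnd X f) v.
Proof. destruct (fbnd_closed X f) as [_ [v H]]. exists v; exact H. Qed.

Lemma fbnd_path_in S f v : is_subcomplex X S -> sF S f -> path_ok v (fbnd X f) v ->
  path_in S v (fbnd X f) v.
Proof.
  intros [HE HF] Hf Hp. destruct (fbnd_closed X f) as [Hne _].
  destruct (fbnd X f) as [|d l] eqn:E; [congruence|].
  assert (He : sE S (fst d)) by (apply (HF f Hf d); rewrite E; simpl; auto).
  destruct (HE _ He) as [H1 H2]. split; [|split]; auto.
  - rewrite path_ok_cons in Hp. destruct Hp as [<- _].
    unfold dsrc, dsrc'. destruct (snd d); auto.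
  - rewrite <- E. intros d' Hd'. eapply HF; eauto.
Qed.

Lemma rot_0 (l : list (dart X)) : rot 0 l = l.
Proof. unfold rot; simpl. apply app_nil_r. Qed.

Lemma homotopic_fbnd S f v : is_subcomplex X S -> sF S f -> path_ok v (fbnd X f) v ->
  homotopic S v v (fbnd X f) [].
Proof.
  intros HS Hf Hp. assert (H := fbnd_path_in _ _ _ HS Hf Hp).
  apply rst_sym, rst_step. split; [|split]; auto; [apply path_in_nil, H|].
  right. exists [], [], f, 0%nat, (fbnd X f). split; auto. split.
  - destruct (fbnd_closed X f) as [Hne _]. destruct (fbnd X f); [congruence|simpl; lia].
  - split; [left; symmetry; apply rot_0|]. split; [reflexivity|]. simpl. now rewrite app_nil_r.
Qed.

End Paths.

(** * Carrying homotopies along maps that send darts to paths *)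

Section Transport.
Context {X X' : complex} (S : subcx X) (S' : subcx X') (r : vtx X -> vtx X')
  (Phi : dart X -> list (dart X')).
Hypothesis HS : is_subcomplex X S.
Hypothesis HS' : is_subcomplex X' S'.
Hypothesis Hr : forall v, sV S v -> sV S' (r v).
Hypothesis HPhi : forall d, sE S (fst d) -> path_in S' (r (dsrc d)) (Phi d) (r (dtgt d)).
Hypothesis Hinv : forall d, sE S (fst d) ->
  homotopic S' (r (dsrc d)) (r (dsrc d)) (Phi d ++ Phi (dinv d)) [].
Hypothesis Hface : forall f v, sF S f -> path_ok v (fbnd X f) v ->
  homotopic S' (r v) (r v) (flat_map Phi (fbnd X f)) [].

Lemma transport_path u p v : path_in S u p v -> path_in S' (r u) (flat_map Phi p) (r v).
Proof.
  revert u. induction p as [|d p IH]; intros u (Hu & Hp & Hin); simpl.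
  - rewrite path_ok_nil in Hp. subst. apply path_in_nil; auto.
  - rewrite path_ok_cons in Hp. destruct Hp as [<- Hp].
    assert (Hd : sE S (fst d)) by (apply Hin; simpl; auto).
    apply path_in_app; auto. exists (r (dtgt d)). split; auto.
    apply IH. split; [|split]; auto; [|intros; apply Hin; simpl; auto].
    apply (path_in_end S (dsrc d) [d]); auto. split; [|split]; auto.
    + rewrite path_ok_cons, path_ok_nil; auto.
    + intros d' [<-|[]]; auto.
Qed.

Lemma transport_cancel u p v : path_in S u p v ->
  homotopic S' (r u) (r u) (flat_map Phi p ++ flat_map Phi (pinv p)) [].
Proof.
  revert u. induction p as [|d p IH]; intros u Hp; [apply rst_refl|].
  change (d :: p) with ([d] ++ p) in Hp. apply path_in_app in Hp; auto.
  destruct Hp as (w & Hd & Hp).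
  destruct Hd as (Hu & Hd & Hin). rewrite path_ok_cons, path_ok_nil in Hd. destruct Hd as [<- <-].
  assert (Ed : sE S (fst d)) by (apply Hin; simpl; auto).
  rewrite pinv_cons, flat_map_app. simpl. rewrite app_nil_r, <- app_assoc, (app_assoc (flat_map Phi p)).
  eapply rst_trans; [|apply Hinv; auto].
  eapply (homotopic_whisker S' (r (dsrc d)) (r (dtgt d)) (r (dtgt d)) (r (dsrc d)) (Phi d)
    (Phi (dinv d)) _ []); auto.
  rewrite <- (dsrc_dinv d), <- (dtgt_dinv d). apply HPhi; auto.
Qed.

(** Used for retractions onto subcomplexes and for the projection of immersed complexes. It is
    enough to contract the images of backtracks and of boundary paths read from their base
    points. *)
Lemma transport_homotopy u v p q :
  homotopic S u v p q -> homotopic S' (r u) (r v) (flat_map Phi p) (flat_map Phi q).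
Proof.
  induction 1.
  2: apply rst_refl. 2: now apply rst_sym. 2: eapply rst_trans; eauto.
  destruct H as (Hp & Hq & H).
  destruct H as [(a & b & d & -> & ->)|(a & b & f & k & l & Hf & Hk & Hl & -> & ->)].
  - change (a ++ d :: dinv d :: b) with (a ++ [d] ++ [dinv d] ++ b) in Hq.
    apply path_in_app in Hq; auto. destruct Hq as (w & Ha & Hq).
    apply path_in_app in Hq; auto. destruct Hq as (w1 & Hd & Hq).
    apply path_in_app in Hq; auto. destruct Hq as (w2 & Hd' & Hb).
    destruct Hd as (Hw & Hd & Hin). rewrite path_ok_cons, path_ok_nil in Hd. destruct Hd as [<- <-].
    destruct Hd' as (Hw1 & Hd' & Hin'). rewrite path_ok_cons, path_ok_nil in Hd'.
    destruct Hd' as [_ <-].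
    rewrite !flat_map_app. simpl. rewrite (app_assoc (Phi d)).
    apply rst_sym. change (flat_map Phi b) with ([] ++ flat_map Phi b) at 2.
    rewrite dtgt_dinv in Hb.
    eapply (homotopic_whisker S' _ (r (dsrc d)) (r (dsrc d))); auto using transport_path.
    apply Hinv. apply Hin; simpl; auto.
  - apply path_in_app in Hq; auto. destruct Hq as (w & Ha & Hq).
    apply path_in_app in Hq; auto. destruct Hq as (w1 & Hc & Hb).
    (* The inserted word is a rotation of a closed path or of its inverse, hence itself closed. *)
    assert (w1 = w).
    { apply path_in_app in Hp; auto. destruct Hp as (w' & Ha' & Hb').
      destruct (fbnd_loop f) as [v0 Hv0].
      assert (Hcl : forall l0 : list (dart X), path_ok v0 l0 v0 -> path_ok w (rot k l0) w1 -> w1 = w).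
      { intros l0 Hl0 Hrot. rewrite <- (firstn_skipn k l0) in Hl0.
        apply path_ok_app in Hl0. destruct Hl0 as (z & H1 & H2).
        unfold rot in Hrot. apply path_ok_app in Hrot. destruct Hrot as (z' & H3 & H4).
        destruct (skipn k l0) as [|x t] eqn:Es.
        - rewrite path_ok_nil in H2, H3. subst. destruct (firstn k l0) as [|x t].
          + symmetry. exact H4.
          + rewrite path_ok_cons in H1, H4. destruct H1 as [H1 H1'], H4 as [H4 H4'].
            rewrite <- H4, H1. eauto using path_ok_fun.
        - rewrite path_ok_cons in H2, H3. destruct H2 as [H2 H2'], H3 as [H3 H3'].
          assert (z' = v0) by eauto using path_ok_fun. subst z'.
          rewrite <- H3, H2. eauto using path_ok_fun. }
      destruct Hl as [-> | ->]; [apply (Hcl _ Hv0); apply Hc|].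
      apply (Hcl (pinv (fbnd X f))); [now apply path_ok_pinv|apply Hc]. }
    subst w1. rewrite !flat_map_app. apply rst_sym.
    change (flat_map Phi b) with ([] ++ flat_map Phi b) at 2.
    eapply (homotopic_whisker S' _ (r w) (r w)); auto using transport_path.
    (* A rotation is conjugate to the word read from its base point, so only the boundary and its
       inverse have to be contracted. *)
    assert (K : forall l0, (forall v0, path_in S v0 l0 v0 -> homotopic S' (r v0) (r v0) (flat_map Phi l0) []) ->
       forall v0, path_ok v0 l0 v0 -> l = rot k l0 ->  homotopic S' (r w) (r w) (flat_map Phi l) []).
    { intros l0 Hl0 v0 Hok ->. unfold rot in *.
      assert (Hin : forall x, In x l0 -> sE S (fst x)).
      { intros x Hx. apply Hc. rewrite <- (firstn_skipn k l0) in Hx.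
        apply in_app_or in Hx. apply in_or_app; tauto. }
      apply path_in_app in Hc; auto. destruct Hc as (z & H2 & H1).
      assert (H12 : path_in S z (firstn k l0 ++ skipn k l0) z) by (apply path_in_app; eauto).
      rewrite flat_map_app. apply (homotopic_rotate S' (r z) (r w)); auto using transport_path.
      rewrite <- flat_map_app, firstn_skipn. apply Hl0. now rewrite <- (firstn_skipn k l0). }
    destruct (fbnd_loop f) as [v0 Hv0].
    destruct Hl as [Hl|Hl].
    + apply (K (fbnd X f) (fun v0 H => Hface f v0 Hf (proj1 (proj2 H))) v0 Hv0 Hl).
    + apply (K (pinv (fbnd X f)) ) with v0; auto using path_ok_pinv.
      intros v1 Hv1. assert (Hv1' := path_in_pinv _ _ _ _ HS Hv1). rewrite pinvK in Hv1'.
      pose proof (transport_cancel _ _ _ Hv1') as E.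
      eapply rst_trans; [|exact E]. apply rst_sym.
      pose proof (Hface f v1 Hf (proj1 (proj2 Hv1'))) as E2.
      eapply rst_trans; [eapply homotopic_app_r; [auto| |apply transport_path, Hv1|exact E2]|].
      * apply Hr, Hv1.
      * apply rst_refl.
Qed.

End Transport.

(** * Cellular chains *)

Section Chains.
Context {X : complex}.

(** The cellular 1-chain of a path. *)
Fixpoint ch (p : list (dart X)) (e : edg X) : R :=
  match p with
  | [] => 0
  | d :: q => indic (e = fst d) * (if snd d then 1 else -1) + ch q e
  end.

Lemma ch_app p q e : ch (p ++ q) e = ch p e + ch q e.
Proof. induction p as [|d p IH]; simpl; [lra|]. rewrite IH; lra. Qed.

Lemma ch_pinv p e : ch (pinv p) e = - ch p e.
Proof.
  induction p as [|d p IH]; [simpl; lra|]. rewrite pinv_cons, ch_app, IH. simpl.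
  destruct (snd d); simpl; lra.
Qed.

Lemma ch_rot k p e : ch (rot k p) e = ch p e.
Proof. unfold rot. rewrite ch_app, Rplus_comm, <- ch_app, firstn_skipn. reflexivity. Qed.

Lemma ch_nz p e : ch p e <> 0 -> exists d, In d p /\ fst d = e.
Proof.
  induction p as [|d p IH]; simpl; intros H; [lra|].
  destruct (classic (e = fst d)) as [->|E]; [eauto|].
  rewrite indic_false in H by auto. destruct IH as (d' & H1 & H2); [lra|eauto].
Qed.

Lemma ch_fsupp p : fsupp (ch p).
Proof.
  exists (map fst p). intros e E. apply ch_nz in E. destruct E as (d & Hd & <-). now apply in_map.
Qed.

Lemma ch_avoid p e : (forall d, In d p -> fst d <> e) -> ch p e = 0.
Proof.
  intros H. apply NNPP. intros E. apply ch_nz in E. destruct E as (d & Hd & E). now apply (H d).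
Qed.

Lemma ch_homotopic (S : subcx X) u v p q : homotopic S u v p q ->
  exists c : fc X -> R, fsupp c /\ (forall f, c f <> 0 -> sF S f) /\
    forall e, ch p e - ch q e = fsum (fun f => c f * ch (fbnd X f) e).
Proof.
  induction 1 as [p q H| p |p q H (c & F & Hc & E) |p q r H1 (c & F & Hc & E) H2 (c' & F' & Hc' & E')].
  - destruct H as (Hp & Hq & [(a & b & d & -> & ->)|(a & b & f & k & l & Hf & Hk & Hl & -> & ->)]).
    + exists (fun _ => 0). split; [apply fsupp_0|]. split; [tauto|]. intros e.
      rewrite (fsum_ext _ (fun _ => 0)), fsum_0 by (intros; ring).
      rewrite !ch_app. simpl. destruct (snd d); simpl; lra.
    (* The inserted word appears in [q], so [ch p - ch q] is minus its chain: coefficient -1 for a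
       rotated boundary, 1 for a rotated inverse. *)
    + exists (fun g => (if dec (l = rot k (fbnd X f)) then -1 else 1) * indic (g = f)).
      split; [apply fsupp_mull, fsupp_delta|]. split.
      * intros g Hg. unfold indic in Hg. destruct (dec (g = f)) as [->|]; [auto|lra].
      * intros e.
        rewrite (fsum_ext _ (fun g => indic (g = f) *
          ((if dec (l = rot k (fbnd X f)) then -1 else 1) * ch (fbnd X g) e))) by (intros; ring).
        rewrite fsum_delta, !ch_app.
        destruct (dec _) as [->|E]; [rewrite ch_rot; lra|].
        destruct Hl as [->| ->]; [tauto|]. rewrite ch_rot, ch_pinv; lra.
  - exists (fun _ => 0). split; [apply fsupp_0|]. split; [tauto|]. intros e.
    rewrite (fsum_ext _ (fun _ => 0)), fsum_0 by (intros; ring). lra.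
  - exists (fun f => (-1) * c f). split; [fs|]. split; [intros f Hf; apply Hc; intros Q; apply Hf; rewrite Q; ring|].
    intros e. rewrite (fsum_ext _ (fun f => (-1) * (c f * ch (fbnd X f) e))) by (intros; ring).
    rewrite fsum_scal, <- E by fs. lra.
  - exists (fun f => c f + c' f). split; [fs|]. split.
    + intros f Hf. destruct (Req_dec (c f) 0) as [Q|]; [|auto]. apply Hc'. intros Q'; apply Hf; rewrite Q, Q'; ring.
    + intros e. rewrite (fsum_ext _ (fun f => c f * ch (fbnd X f) e + c' f * ch (fbnd X f) e))
        by (intros; ring).
      rewrite fsum_plus, <- E, <- E' by fs. lra.
Qed.

End Chains.

(** * Group actions on complexes and chains *)

Section Actions.
Context {G : group} {X : complex} (A : action G X).

Definition gV : gset G := GSet G (vtx X) (av A) (av1 G X A) (avM G X A).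
Definition gE : gset G := GSet G (edg X) (ae A) (ae1 G X A) (aeM G X A).
Definition gF : gset G := GSet G (fc X) (af A) (af1 G X A) (afM G X A).

Definition dmap (h : G) (d : dart X) : dart X := (ae A h (fst d), snd d).
Definition pmap (h : G) (p : list (dart X)) : list (dart X) := map (dmap h) p.

Lemma dmap1 d : dmap (gone G) d = d.
Proof. destruct d; unfold dmap; simpl. now rewrite ae1. Qed.

Lemma dmapM g h d : dmap (gmul G g h) d = dmap g (dmap h d).
Proof. unfold dmap; simpl. now rewrite aeM. Qed.

Definition gD : gset G := GSet G (dart X) dmap dmap1 dmapM.

Lemma pmap1 p : pmap (gone G) p = p.
Proof. induction p as [|d p IH]; simpl; [reflexivity|]. now rewrite dmap1, IH. Qed.

Lemma pmapM g h p : pmap (gmul G g h) p = pmap g (pmap h p).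
Proof. unfold pmap. rewrite map_map. apply map_ext. intros; apply dmapM. Qed.

Lemma pmap_app h p q : pmap h (p ++ q) = pmap h p ++ pmap h q.
Proof. apply map_app. Qed.

Lemma dsrc_dmap h d : dsrc (dmap h d) = av A h (dsrc d).
Proof. destruct d as [e []]; unfold dmap, dsrc, dsrc'; simpl; [apply ae_src|apply ae_tgt]. Qed.

Lemma dtgt_dmap h d : dtgt (dmap h d) = av A h (dtgt d).
Proof. destruct d as [e []]; unfold dmap, dtgt, dtgt'; simpl; [apply ae_tgt|apply ae_src]. Qed.

Lemma fbnd_af h f : fbnd X (af A h f) = pmap h (fbnd X f).
Proof. apply af_bnd. Qed.

Lemma path_ok_pmap h u p v : path_ok u p v -> path_ok (av A h u) (pmap h p) (av A h v).
Proof.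
  revert u. induction p as [|d p IH]; intros u; simpl pmap.
  - rewrite !path_ok_nil. congruence.
  - rewrite !path_ok_cons, dsrc_dmap, dtgt_dmap. intros [<- H]; auto.
Qed.

(** From here on the whole acting group is meant; the subgroup is made a group of its own before the
    results are applied to it. *)
Definition inv_sub (S : subcx X) := invariant G X A (fun _ => True) S.

Lemma path_in_pmap S h u p v : inv_sub S -> path_in S u p v ->
  path_in S (av A h u) (pmap h p) (av A h v).
Proof.
  intros (HV & HE & HF) (Hu & Hp & Hin). split; [|split]; auto using path_ok_pmap.
  intros d Hd. apply in_map_iff in Hd. destruct Hd as (d' & <- & Hd'). apply HE; auto.
Qed.

Lemma avV h (x : vtx X) : av A (ginv G h) (av A h x) = x.
Proof. exact (@gaV G gV h x). Qed.
Lemma aeV h (x : edg X) : ae A (ginv G h) (ae A h x) = x.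
Proof. exact (@gaV G gE h x). Qed.
Lemma afV h (x : fc X) : af A (ginv G h) (af A h x) = x.
Proof. exact (@gaV G gF h x). Qed.

Lemma ae_inj h e e' : ae A h e = ae A h e' -> e = e'.
Proof. intros E. rewrite <- (aeV h e), <- (aeV h e'). congruence. Qed.
Lemma av_inj h e e' : av A h e = av A h e' -> e = e'.
Proof. intros E. rewrite <- (avV h e), <- (avV h e'). congruence. Qed.

Lemma ch_pmap h p e : ch (pmap h p) (ae A h e) = ch p e.
Proof.
  induction p as [|d p IH]; simpl; [reflexivity|]. rewrite IH. do 2 f_equal.
  apply indic_iff. split; [apply ae_inj|congruence].
Qed.

Definition stab_bound K := stab_le gV K /\ stab_le gE K /\ stab_le gF K.

Definition cofin_sub (S : subcx X) :=
  @cofinite G gV (sV S) /\ @cofinite G gE (sE S) /\ @cofinite G gF (sF S).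

End Actions.

Definition gsum {G : group} (S T : gset G) : gset G.
Proof.
  refine (GSet G (S + T) (fun h x => match x with inl s => inl (ga h s) | inr t => inr (ga h t) end) _ _).
  - intros [s|t]; now rewrite ga1.
  - intros g h [s|t]; now rewrite gaM.
Defined.

Definition scase {A B} (f : A -> R) (g : B -> R) (x : A + B) : R :=
  match x with inl a => f a | inr b => g b end.

Lemma weight_gsum {G : group} {S T : gset G} DS rS DT rT :
  @weight G S DS rS -> @weight G T DT rT ->
  @weight G (gsum S T) (fun x => match x with inl s => DS s | inr t => DT t end) (scase rS rT).
Proof.
  intros WS WT. constructor.
  - intros [s|t]; simpl; [apply WS|apply WT].
  - intros [s|t]; simpl; [apply WS|apply WT].
  - intros [s|t]; simpl; [apply WS|apply WT].
  - apply fsupp_sum; [apply WS|apply WT].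
  - intros [s|t]; simpl; [apply WS|apply WT].
  - intros [s|t]; simpl; [apply WS|apply WT].
Qed.

(** * The relative Euler characteristic *)

(* The homotopical form of pi_1(Y) -> pi_1(S) being onto. *)
Definition rel_trivial {X : complex} (Y S : subcx X) : Prop :=
  forall u v p, sV Y u -> sV Y v -> path_in S u p v ->
  exists q, path_in Y u q v /\ homotopic S u v p q.

(** The homotopical form of H_0(S, Y) = 0. *)
Definition reach {X : complex} (Y S : subcx X) : Prop :=
  forall v, sV S v -> exists y p, sV Y y /\ path_in S y p v.

Section Euler.
Context {G : group} {X : complex} (A : action G X) (K : nat) (Y Z : subcx X).
Hypothesis HK : stab_bound A K.
Hypothesis HY : is_subcomplex X Y.
Hypothesis HZ : is_subcomplex X Z.
Hypothesis HYZ : subcx_le X Y Z.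
Hypothesis IY : inv_sub A Y.
Hypothesis IZ : inv_sub A Z.
Hypothesis CZ : cofin_sub A Z.
Hypothesis RZ : reach Y Z.
Hypothesis PZ : rel_trivial Y Z.

Definition dV v := sV Z v /\ ~ sV Y v.
Definition dE e := sE Z e /\ ~ sE Y e.
Definition dF f := sF Z f /\ ~ sF Y f.

Lemma dV_inv : @invar G (gV A) dV.
Proof.
  intros h v [H1 H2]. split; [now apply IZ|]. intros H. apply H2.
  apply (proj1 IY (ginv G h)) in H; auto. simpl in H. now rewrite avV in H.
Qed.

Lemma dE_inv : @invar G (gE A) dE.
Proof.
  intros h v [H1 H2]. split; [now apply IZ|]. intros H. apply H2.
  apply (proj1 (proj2 IY) (ginv G h)) in H; auto. simpl in H. now rewrite aeV in H.
Qed.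

Lemma dF_inv : @invar G (gF A) dF.
Proof.
  intros h v [H1 H2]. split; [now apply IZ|]. intros H. apply H2.
  apply (proj2 (proj2 IY) (ginv G h)) in H; auto. simpl in H. now rewrite afV in H.
Qed.

Lemma dV_cof : @cofinite G (gV A) dV.
Proof. apply (@cofinite_sub G (gV A) (sV Z)); [apply CZ|]. unfold dV; tauto. Qed.
Lemma dE_cof : @cofinite G (gE A) dE.
Proof. apply (@cofinite_sub G (gE A) (sE Z)); [apply CZ|]. unfold dE; tauto. Qed.
Lemma dF_cof : @cofinite G (gF A) dF.
Proof. apply (@cofinite_sub G (gF A) (sF Z)); [apply CZ|]. unfold dF; tauto. Qed.

Lemma edges_at v : exists L, forall e, sE Z e -> esrc X e = v \/ etgt X e = v -> In e L.
Proof.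
  apply (@column_finite G (gE A) (gV A) K (fun e v => esrc X e = v \/ etgt X e = v) (sE Z)).
  - apply HK.
  - apply CZ.
  - intros h s t. simpl. rewrite ae_src, ae_tgt. intros [<-|<-]; auto.
  - intros s. exists [esrc X s; etgt X s]. simpl. intros t [<-|<-]; auto.
Qed.

Lemma faces_at e : exists L, forall f, sF Z f -> (exists d, In d (fbnd X f) /\ fst d = e) -> In f L.
Proof.
  apply (@column_finite G (gF A) (gE A) K (fun f e => exists d, In d (fbnd X f) /\ fst d = e) (sF Z)).
  - apply HK.
  - apply CZ.
  - intros h s t (d & Hd & <-). simpl. exists (dmap A h d). split; auto.
    rewrite fbnd_af. now apply in_map.
  - intros s. exists (map fst (fbnd X s)). intros t (d & Hd & <-). now apply in_map.
Qed.

Variables (rV : vtx X -> R) (rE : edg X -> R) (rF : fc X -> R).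
Hypothesis WV : @weight G (gV A) dV rV.
Hypothesis WE : @weight G (gE A) dE rE.
Hypothesis WF : @weight G (gF A) dF rF.

Let T := gsum (gV A) (gF A).

(* The operator (d_1, transpose of d_2) : C_1 -> C_0 + C_2 of the relative chain complex. *)
Definition bmat (t : T) (e : gE A) : R :=
  match t with
  | inl v => indic (dV v /\ dE e) * (indic (etgt X e = v) - indic (esrc X e = v))
  | inr f => indic (dF f /\ dE e) * ch (fbnd X f) e
  end.

(** Chosen without regard to the action; the averaging in [cone] restores equivariance. *)
Definition gpath (v : vtx X) : list (dart X) :=
  epsilon (inhabits []) (fun p => exists y, sV Y y /\ path_in Z y p v).

Lemma gpath_spec v : sV Z v -> exists y, sV Y y /\ path_in Z y (gpath v) v.
Proof.
  intros Hv. apply (epsilon_spec (inhabits []) (fun p => exists y, sV Y y /\ path_in Z y p v)).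
  destruct (RZ v Hv) as (y & p & H). eauto.
Qed.

(* A contraction C_0 -> C_1, made equivariant by averaging the paths gpath with the weight rV. *)
Definition cone (e : gE A) (t : T) : R :=
  match t with
  | inl v => indic (dE e /\ dV v) * fsum (fun h : G => rV (av A h v) * ch (gpath (av A h v)) (ae A h e))
  | inr _ => 0
  end.

(** Boundaries in the relative complex of (Z, Y): equality is asked only on edges outside Y. *)
Definition bounding (z : edg X -> R) : Prop :=
  exists c : fc X -> R, fsupp c /\ (forall f, c f <> 0 -> dF f) /\
    forall e, dE e -> z e = fsum (fun f => c f * ch (fbnd X f) e).

Lemma bounding_ext z z' : (forall e, dE e -> z e = z' e) -> bounding z -> bounding z'.
Proof.
  intros H (c & F & Hc & E). exists c. split; [|split]; auto. intros e He. rewrite <- H, E; auto.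
Qed.

Lemma bounding_sum {B} (L : list B) (w : B -> R) (z : B -> edg X -> R) :
  (forall b, In b L -> w b <> 0 -> bounding (z b)) ->
  bounding (fun e => sum_R (map (fun b => w b * z b e) L)).
Proof.
  induction L as [|b L IH]; intros H.
  - exists (fun _ => 0). split; [apply fsupp_0|]. split; [tauto|]. intros e He. simpl.
    rewrite (fsum_ext _ (fun _ => 0)), fsum_0 by (intros; ring). reflexivity.
  - destruct IH as (c & F & Hc & E); [intros; apply H; simpl; auto|].
    destruct (Req_dec (w b) 0) as [Z0|NZ].
    + exists c. split; [|split]; auto. intros e He. simpl. rewrite <- E, Z0 by auto. lra.
    + destruct (H b) as (c' & F' & Hc' & E'); [simpl; auto|auto|].
      exists (fun f => w b * c' f + c f). split; [fs|]. split.
      * intros f Hf. destruct (Req_dec (c f) 0) as [Q|Q]; [|auto].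
        apply Hc'. intros Q'. apply Hf. rewrite Q, Q'; ring.
      * intros e He. simpl. rewrite E, E' by auto.
        rewrite (fsum_ext (fun f => (w b * c' f + c f) * _)
           (fun f => w b * (c' f * ch (fbnd X f) e) + c f * ch (fbnd X f) e)) by (intros; ring).
        rewrite fsum_plus, fsum_scal by fs. reflexivity.
Qed.

(** Exactness in degree 1. The path is homotopic in Z to a path of Y, and the homotopy is a 2-chain
    whose part in Y is invisible on edges outside Y. *)
Lemma bounding_path u v p : sV Y u -> sV Y v -> path_in Z u p v -> bounding (ch p).
Proof.
  intros Hu Hv Hp. destruct (PZ u v p Hu Hv Hp) as (q & Hq & H).
  destruct (ch_homotopic _ _ _ _ _ H) as (c & F & Hc & E).
  exists (fun f => indic (dF f) * c f). split; [fs|]. split.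
  - intros f Hf. apply NNPP. intros Hn. apply Hf. rewrite indic_false by auto. ring.
  - intros e He. specialize (E e). replace (ch q e) with 0 in E.
    + rewrite Rminus_0_r in E. rewrite E. apply fsum_ext. intros f.
      destruct (classic (dF f)) as [Hf|Hf]; [rewrite indic_true by auto; ring|].
      rewrite indic_false by auto. destruct (Req_dec (c f) 0) as [->|Hcf]; [ring|].
      rewrite ch_avoid; [ring|]. intros d Hd Ed. apply He. rewrite <- Ed.
      apply (proj2 HY f); auto. apply NNPP. intros Hn. apply Hf. split; auto.
    + symmetry. apply ch_avoid. intros d Hd Ed. apply He. rewrite <- Ed. now apply Hq.
Qed.

(** [cone] at [u] is an average, of total weight 1, of translated paths from Y to [u]. Bounding
    chains are closed under such averages, and [z0] is averaged to itself; leaving it free allows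
    the two ends of an edge to be treated in turn. For [u] in Y the cone vanishes and the empty path
    serves. *)
Lemma cone_affine u sg z0 : sV Z u ->
  (forall y g, sV Y y -> path_in Z y g u -> bounding (fun e => sg * ch g e + z0 e)) ->
  bounding (fun e => sg * cone e (inl u) + z0 e).
Proof.
  intros Hu H. destruct (classic (sV Y u)) as [Yu|Yu].
  - eapply bounding_ext; [|apply (H u []); auto; now apply path_in_nil].
    intros e He. simpl. rewrite indic_false; [ring|]. unfold dV; tauto.
  - assert (Du : dV u) by (split; auto).
    destruct (fsupp_nodup _ (w_fin_orb _ _ WV u)) as (L & N & HL).
    assert (S1 := w_sum _ _ WV u Du). rewrite (fsum_eq _ L) in S1 by auto. simpl in S1, HL.
    eapply bounding_ext;
      [|apply (bounding_sum L (fun h => rV (av A h u))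
           (fun h e => sg * ch (gpath (av A h u)) (ae A h e) + z0 e))].
    + intros e He. simpl. rewrite indic_true by auto.
      rewrite (fsum_eq _ L); auto.
      * rewrite (sumR_ext _ (fun h => sg * (rV (av A h u) * ch (gpath (av A h u)) (ae A h e))
           + z0 e * rV (av A h u))) by (intros; ring).
        rewrite sumR_plus, !sumR_scal, S1. ring.
      * intros h E. apply HL. intros Q. apply E. simpl. rewrite Q; ring.
    + intros h Hh Hnz. destruct (gpath_spec (av A h u)) as (y & Hy & Hp); [now apply IZ|].
      eapply bounding_ext; [|apply (H (av A (ginv G h) y) (pmap A (ginv G h) (gpath (av A h u))))].
      * intros e He. cbv beta. rewrite <- (ch_pmap A h (pmap A (ginv G h) _) e). rewrite <- pmapM, gmulVr, pmap1. reflexivity.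
      * now apply IY.
      * rewrite <- (avV A h u) at 2. now apply path_in_pmap.
Qed.

Lemma bmat_rows t : fsupp (bmat t).
Proof.
  destruct t as [v|f]; simpl.
  - destruct (edges_at v) as [L HL]. exists L. intros e E. apply HL.
    + apply NNPP. intros Hn. apply E. simpl. rewrite indic_false; [ring|]. unfold dE; tauto.
    + apply NNPP. intros Hn. apply E. simpl. rewrite (indic_false (_ = v)), (indic_false (_ = v)); tauto || ring.
  - apply fsupp_mull, ch_fsupp.
Qed.

Lemma bmat_cols e : fsupp (fun t => bmat t e).
Proof.
  apply fsupp_sum; simpl.
  - exists [esrc X e; etgt X e]. intros v E. simpl. apply NNPP. intros Hn. apply E.
    rewrite (indic_false (_ = v)), (indic_false (_ = v)); tauto || ring.
  - destruct (faces_at e) as [L HL]. exists L. intros f E. apply HL.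
    + apply NNPP. intros Hn. apply E. simpl. rewrite indic_false; [ring|]. unfold dF; tauto.
    + apply ch_nz. intros Q. apply E. simpl. rewrite Q; ring.
Qed.

Lemma bmat_inv h t e : bmat (@ga G T h t) (@ga G (gE A) h e) = bmat t e.
Proof.
  destruct t as [v|f]; simpl.
  - rewrite ae_src, ae_tgt. f_equal; [|f_equal]; apply indic_iff.
    + pose proof (invar_iff _ dV_inv h v). pose proof (invar_iff _ dE_inv h e). simpl in *; tauto.
    + split; [apply av_inj|congruence].
    + split; [apply av_inj|congruence].
  - rewrite fbnd_af, ch_pmap. f_equal. apply indic_iff.
    pose proof (invar_iff _ dF_inv h f). pose proof (invar_iff _ dE_inv h e). simpl in *; tauto.
Qed.

Lemma cone_nz e v : cone e (inl v) <> 0 ->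
  exists h : G, rV (av A h v) <> 0 /\ exists d, In d (gpath (av A h v)) /\ fst d = ae A h e.
Proof.
  simpl. intros E. apply NNPP. intros Hn. apply E.
  rewrite (fsum_ext _ (fun _ => 0)), fsum_0; [ring|]. intros h.
  destruct (Req_dec (rV (av A h v)) 0) as [->|Q]; [ring|].
  destruct (Req_dec (ch (gpath (av A h v)) (ae A h e)) 0) as [->|Q']; [ring|].
  exfalso. apply Hn. exists h. split; auto. now apply ch_nz.
Qed.

Lemma cone_rows e : fsupp (cone e).
Proof.
  apply fsupp_sum; [|apply fsupp_0].
  destruct (w_fin _ _ WV) as [LV HLV].
  assert (exists LE, forall v d, In v LV -> In d (gpath v) -> In (fst d) LE) as [LE HLE].
  { exists (flat_map (fun v => map fst (gpath v)) LV). intros v d Hv Hd. apply in_flat_map.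
    exists v; split; auto. now apply in_map. }
  destruct (@transporter_finite_list G (gE A) K e LE) as [LH HLH]; [apply HK|].
  exists (flat_map (fun h => map (av A (ginv G h)) LV) LH).
  intros v E. apply cone_nz in E. destruct E as (h & Hh & d & Hd & Ed).
  apply in_flat_map. exists h. split.
  - apply HLH. simpl. rewrite <- Ed. eauto.
  - rewrite <- (avV A h v). apply in_map. auto.
Qed.

Lemma cone_cols t : fsupp (fun e => cone e t).
Proof.
  destruct t as [v|f]; [|apply fsupp_0].
  destruct (w_fin_orb _ _ WV v) as [LH HLH].
  exists (flat_map (fun h => map (fun d => ae A (ginv G h) (fst d)) (gpath (av A h v))) LH).
  intros e E. apply cone_nz in E. destruct E as (h & Hh & d & Hd & Ed).
  apply in_flat_map. exists h. split; [auto|].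
  apply in_map_iff. exists d. split; auto. now rewrite Ed, aeV.
Qed.

Lemma cone_inv h e t : cone (@ga G (gE A) h e) (@ga G T h t) = cone e t.
Proof.
  destruct t as [v|f]; simpl; [|reflexivity]. f_equal.
  - apply indic_iff.
    pose proof (invar_iff _ dV_inv h v). pose proof (invar_iff _ dE_inv h e). simpl in *; tauto.
  - rewrite <- (fsum_reindex (fun k => gmul G k h) (fun k => gmul G k (ginv G h))
         (fun k => rV (av A k v) * ch (gpath (av A k v)) (ae A k e))).
    + apply fsum_ext. intros k. now rewrite avM, aeM.
    + intros k. now rewrite <- gmulA, gmulVr, gmul1r.
    + intros k. now rewrite <- gmulA, gmulV, gmul1r.
    + apply fsupp_mulr. apply (w_fin_orb _ _ WV v).
Qed.

(** A path from Y to the source of an edge e, then e, then a path back from its target to Y, is a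
    relative cycle and bounds some 2-chain c. After averaging, e = d_2 c + cone(d_1 e) in the
    relative chains, which is the decomposition asked for by [weight_comparison]. *)
Theorem relative_euler : fsum rE <= fsum rV + fsum rF.
Proof.
  assert (WT := weight_gsum _ _ _ _ WV WF).
  change (fsum rE <= fsum (fun v => scase rV rF (inl v)) + fsum (fun f => scase rV rF (inr f))).
  rewrite <- (fsum_sum (scase rV rF)) by apply (w_fin _ _ WT).
  eapply (weight_comparison bmat cone); eauto.
  - apply dE_cof.
  - destruct dV_cof as [L HL], dF_cof as [L' HL'].
    exists (map inl L ++ map inr L'). intros [v|f] H.
    + destruct (HL v H) as (h & y & Hy & ->). exists h, (inl y). split; auto.
      apply in_or_app; left. now apply in_map.
    + destruct (HL' f H) as (h & y & Hy & ->). exists h, (inr y). split; auto.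
      apply in_or_app; right. now apply in_map.
  - apply bmat_rows.
  - apply bmat_cols.
  - apply bmat_inv.
  - intros [v|f] e E; simpl in *; apply NNPP; intros Hn; apply E; rewrite indic_false; tauto || ring.
  - apply cone_rows.
  - apply cone_cols.
  - apply cone_inv.
  - intros e He. apply (w_supp _ _ WE) in He.
    assert (Zs : sV Z (esrc X e) /\ sV Z (etgt X e)) by (apply HZ, He).
    (* The chain is e minus the cone of its boundary, an average of chains of paths with both ends
       in Y. *)
    assert (B : bounding (fun y => 1 * cone y (inl (esrc X e)) +
                 (-1 * cone y (inl (etgt X e)) + delta e y))).
    { apply cone_affine; [tauto|]. intros y g Hy Hg.
      eapply bounding_ext; [|apply (cone_affine (etgt X e) (-1) (fun z => ch g z + delta e z))].
      - intros; simpl; ring.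
      - tauto.
      - intros y' g' Hy' Hg'.
        eapply bounding_ext; [|apply (bounding_path y y' (g ++ [(e, true)] ++ pinv g'))]; auto.
        + intros z Hz. rewrite ch_app. simpl. rewrite ch_pinv. unfold delta. ring. 
        + apply path_in_app; auto. exists (esrc X e). split; auto.
          apply path_in_app; auto. exists (etgt X e). split.
          * split; [tauto|]. split; [split; reflexivity|]. intros d [<-|[]]. apply He.
          * now apply path_in_pinv. }
    destruct B as (c & F & Hc & E).
    (* The correction has a component in C_2 only. *)
    exists (scase (fun _ => 0) c). split; [apply fsupp_sum; simpl; [apply fsupp_0|auto]|].
    intros y. rewrite (fsum_ext (fun t => cone y t * ap bmat (delta e) t)
        (fun t => cone y t * bmat t e)) at 1.
    2:{ intros t. now rewrite ap_delta. }
    unfold ap.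
    etransitivity; [|symmetry; apply f_equal2; apply (@fsum_sum (vtx X) (fc X))].
    2:{ apply fsupp_mull, fsupp_sum; simpl; [apply fsupp_0|auto]. }
    2:{ apply (fsupp_mulr (cone y)), cone_rows. }
    simpl. unfold tker, bmat.
    rewrite (fsum_ext (fun b : fc X => 0 * _) (fun _ => 0)), fsum_0 by (intros; ring).
    rewrite (fsum_ext (fun a : vtx X => _ * 0) (fun _ => 0)), fsum_0 by (intros; ring).
    destruct (classic (dE y)) as [Hy|Hy].
    + specialize (E y Hy).
      rewrite (fsum_ext (fun b : fc X => indic (dF b /\ dE y) * _ * _)
         (fun f => c f * ch (fbnd X f) y)).
      2:{ intros f. destruct (Req_dec (c f) 0) as [->|Q]; [ring|].
          rewrite indic_true by auto. ring. }
      rewrite <- E.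
      rewrite (fsum_ext (fun a : vtx X => _ * _)
        (fun v => indic (v = etgt X e) * cone y (inl v) - indic (v = esrc X e) * cone y (inl v))).
      * rewrite fsum_minus, !fsum_delta by (apply fsupp_mulr, fsupp_delta).
        match goal with |- ?d = 0 + (1 * ?p + (-1 * ?q + ?d')) + (?q' - ?p' + 0) =>
          change d' with d; change q' with q; change p' with p end. ring.
      * intros v. simpl. destruct (classic (dV v)) as [Hv|Hv].
        -- rewrite (indic_true (dV v /\ dE e)) by tauto.
           rewrite (indic_iff (etgt X e = v) (v = etgt X e)) by intuition.
           rewrite (indic_iff (esrc X e = v) (v = esrc X e)) by intuition. ring.
        -- rewrite (indic_false (dE y /\ dV v)) by tauto. ring.
    + rewrite (fsum_ext (fun b : fc X => _ * _ * _) (fun _ => 0)), fsum_0.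
      2:{ intros f. rewrite indic_false by tauto. ring. }
      rewrite (fsum_ext (fun b : vtx X => _ * _ ) (fun _ => 0)), fsum_0.
      2:{ intros f. rewrite indic_false by tauto. ring. }
      unfold delta. rewrite indic_false; [ring|]. intros ->. now apply Hy.
Qed.

End Euler.

(** * Links and the Gauss-Bonnet inequality *)

Lemma sumR_split {T} (P : T -> Prop) (f : T -> R) L :
  sum_R (map f L) = sum_R (map f (filterP P L)) + sum_R (map f (filterP (fun x => ~ P x) L)).
Proof.
  unfold filterP; induction L as [|a L IH]; simpl; [lra|].
  destruct (dec (P a)), (dec (~ P a)); try tauto; simpl; lra.
Qed.

Lemma length_split {T} (P : T -> Prop) (L : list T) :
  length L = (length (filterP P L) + length (filterP (fun x => ~ P x) L))%nat.
Proof.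
  unfold filterP; induction L as [|a L IH]; simpl; [lia|].
  destruct (dec (P a)), (dec (~ P a)); try tauto; simpl; lia.
Qed.

Section Corners.
Context {X : complex}.

Lemma nth_error_ex {T} (l : list T) i : (i < length l)%nat -> exists x, nth_error l i = Some x.
Proof.
  intros H. destruct (nth_error l i) eqn:E; eauto. apply nth_error_None in E. lia.
Qed.

Lemma nth_error_lt {T} (l : list T) i x : nth_error l i = Some x -> (i < length l)%nat.
Proof. intros H. apply nth_error_Some. congruence. Qed.

Lemma path_consecutive (u v : vtx X) p i di dj : path_ok u p v ->
  nth_error p i = Some di -> nth_error p (S i) = Some dj -> dtgt di = dsrc dj.
Proof.
  revert u i. induction p as [|d p IH]; intros u i Hp H1 H2; [destruct i; discriminate|].
  rewrite path_ok_cons in Hp. destruct Hp as [_ Hp]. destruct i as [|i]; [|eapply IH; eauto].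
  simpl in H1, H2. injection H1 as <-. destruct p as [|d' p]; [discriminate|].
  injection H2 as <-. rewrite path_ok_cons in Hp. symmetry; tauto.
Qed.

Lemma path_last (u v : vtx X) p di : path_ok u p v ->
  nth_error p (pred (length p)) = Some di -> dtgt di = v.
Proof.
  revert u. induction p as [|d p IH]; intros u Hp H; [discriminate|].
  rewrite path_ok_cons in Hp. destruct Hp as [_ Hp]. destruct p as [|d' p].
  - injection H as <-. exact Hp.
  - apply (IH (dtgt d)); auto.
Qed.

Lemma corner_consecutive f i di dj : nth_error (fbnd X f) i = Some di ->
  nth_error (fbnd X f) (Nat.modulo (S i) (length (fbnd X f))) = Some dj -> dtgt di = dsrc dj.
Proof.
  destruct (fbnd_loop f) as [v Hv]. intros H1 H2. assert (Hi := nth_error_lt _ _ _ H1).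
  destruct (Nat.eq_dec (S i) (length (fbnd X f))) as [E|E].
  - rewrite E, Nat.Div0.mod_same in H2.
    assert (dtgt di = v) by (eapply path_last; [exact Hv|];
      replace (pred (length _)) with i; [exact H1|]; unfold dart in *; lia).
    destruct (fbnd X f) as [|d l]; [discriminate|]. injection H2 as <-.
    rewrite path_ok_cons in Hv. destruct Hv; congruence.
  - rewrite Nat.mod_small in H2 by lia. eapply path_consecutive; eauto.
Qed.

Definition corner_at (v : vtx X) (c : fc X * nat) : Prop :=
  exists d, nth_error (fbnd X (fst c)) (snd c) = Some d /\ dtgt d = v.

Lemma corner_ends_ex f i : (i < length (fbnd X f))%nat -> exists a b, corner_ends X f i a b.
Proof.
  intros H. destruct (nth_error_ex _ _ H) as [di Hi].
  destruct (nth_error_ex (fbnd X f) (Nat.modulo (S i) (length (fbnd X f)))) as [dj Hj].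
  - apply Nat.mod_upper_bound. lia.
  - exists (dinv di), dj, di, dj. auto.
Qed.

Lemma corner_ends_fun f i a b a' b' : corner_ends X f i a b -> corner_ends X f i a' b' ->
  a = a' /\ b = b'.
Proof.
  intros (x & y & H1 & H2 & -> & ->) (x' & y' & H1' & H2' & -> & ->).
  rewrite H1 in H1'. rewrite H2 in H2'. now injection H1' as ->; injection H2' as ->.
Qed.

Lemma corner_at_ends v f i a b : corner_at v (f, i) -> corner_ends X f i a b ->
  dsrc a = v /\ dsrc b = v.
Proof.
  intros (d & Hd & <-) (x & y & H1 & H2 & -> & ->). simpl in Hd. rewrite Hd in H1.
  injection H1 as <-. split.
  - apply (dsrc_dinv d).
  - symmetry. eapply corner_consecutive; eauto.
Qed.

(** [t] is a 2-cell with an index into its boundary path, so a 2-cell running twice over [e] counts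
    twice. *)
Definition traverses (Z : subcx X) (e : edg X) (t : fc X * nat) : Prop :=
  sF Z (fst t) /\ exists d, nth_error (fbnd X (fst t)) (snd t) = Some d /\ fst d = e.

(* No edge of Z outside Y is a free face or isolated in its links. *)
Definition reduced (Y Z : subcx X) : Prop :=
  forall e, sE Z e -> ~ sE Y e ->
  exists t t', t <> t' /\ traverses Z e t /\ traverses Z e t'.

(* The edge of the link corresponding to a traversal, and which end of it is d. *)
Definition incidence (d : dart X) (t : fc X * nat) : (fc X * nat) * bool :=
  if dec (nth_error (fbnd X (fst t)) (snd t) = Some d)
  then ((fst t, match snd t with O => pred (length (fbnd X (fst t))) | S i => i end), false)
  else (t, true).

(** Dart i of a boundary path is the second end of corner i - 1, taken cyclically, and its inverse
    is the first end of corner i; which case occurs depends on the direction in which [t] runs over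
    the edge. *)
Lemma incidence_spec Z d t : traverses Z (fst d) t ->
  corner_end X (fst (incidence d t)) (snd (incidence d t)) d /\
  corner_at (dsrc d) (fst (incidence d t)) /\ fst (fst (incidence d t)) = fst t.
Proof.
  destruct t as [f i]. intros (_ & x & Hx & Ex). unfold incidence. simpl in *.
  assert (Hi := nth_error_lt _ _ _ Hx). set (n := length (fbnd X f)) in *.
  destruct (dec _) as [E|E]; simpl.
  - set (j := match i with O => pred n | S k => k end).
    assert (Hj : (j < n)%nat) by (unfold j; destruct i; lia).
    assert (Hji : Nat.modulo (S j) n = i).
    { unfold j. destruct i.
      - replace (S (pred n)) with n by lia. apply Nat.Div0.mod_same.
      - apply Nat.mod_small. lia. }
    destruct (nth_error_ex (fbnd X f) j Hj) as [dj Hdj].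
    split; [|split; auto].
    + exists (dinv dj), d. split; auto. exists dj, d. cbn [fst snd]. fold n. rewrite Hji. auto.
    + exists dj. split; auto. apply (corner_consecutive f j dj d Hdj). change (nth_error (fbnd X f) (Nat.modulo (S j) n) = Some d). rewrite Hji. auto.
  - assert (Exd : x = dinv d).
    { destruct x as [e b], d as [e' b']. simpl in Ex. subst. unfold dinv; simpl.
      destruct b, b'; try reflexivity; exfalso; auto. }
    subst x. split; [|split; auto].
    + destruct (corner_ends_ex f i Hi) as (a & b & Hab). exists a, b. split; auto.
      destruct Hab as (y & z & H1 & _ & -> & _). rewrite Hx in H1. injection H1 as <-.
      symmetry; apply dinvK.
    + exists (dinv d). split; auto using dtgt_dinv.
Qed.

Lemma incidence_inj Z d t t' : traverses Z (fst d) t -> traverses Z (fst d) t' ->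
  incidence d t = incidence d t' -> t = t'.
Proof.
  destruct t as [f i], t' as [f' i']. intros (_ & x & Hx & _) (_ & x' & Hx' & _).
  unfold incidence; simpl in *. apply nth_error_lt in Hx, Hx'.
  destruct (dec _), (dec _); try congruence.
  intros E; injection E as -> E. f_equal. destruct i, i'; lia.
Qed.

(** The curvature condition speaks of connected subgraphs, while a link in Z may be disconnected.
    One component is split off and the rest is treated by induction: k components give at most k
    alpha - 2 pi (k - 1), which is at most alpha since alpha <= 2 pi. Two incidences at each vertex
    exclude valence one, a loop supplying both. *)
Lemma link_curvature ang alpha (x : vtx X) Lv Lc :
  sectional_curvature_le X ang alpha -> alpha <= 2 * PI ->
  NoDup Lv -> NoDup Lc -> (forall d, In d Lv -> dsrc d = x) ->
  (forall c, In c Lc -> (snd c < length (fbnd X (fst c)))%nat /\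
      exists a b, corner_ends X (fst c) (snd c) a b /\ In a Lv /\ In b Lv) ->
  (forall d, In d Lv -> exists t t', t <> t' /\ In (fst t) Lc /\ corner_end X (fst t) (snd t) d /\
      In (fst t') Lc /\ corner_end X (fst t') (snd t') d) ->
  Lv <> [] ->
  2 * PI - PI * INR (length Lv) + sum_R (map (fun c => PI - ang (fst c) (snd c)) Lc) <= alpha.
Proof.
  intros [Hcurv _] Hal.
  remember (length Lv) as n eqn:En. revert Lv Lc En.
  induction n as [n IH] using lt_wf_ind. intros Lv Lc En NV NC Hsrc Hc Hinc Hne.
  destruct Lv as [|u Lv0] eqn:EL; [congruence|]. rewrite <- EL in *.
  assert (Hu : In u Lv) by (rewrite EL; simpl; auto). clear EL Lv0 Hne.
  set (adj := fun (L : list (fc X * nat)) u' w' => exists c, In c L /\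
         ((corner_end X c true u' /\ corner_end X c false w') \/
          (corner_end X c true w' /\ corner_end X c false u'))).
  set (Rl := clos_refl_trans _ (adj Lc) u).
  (* Testing the first end is enough, as both ends of a corner lie in the same component
     ([Ends]). *)
  set (PC := fun c => exists a, corner_end X c true a /\ Rl a).
  set (V1 := filterP Rl Lv). set (V2 := filterP (fun d => ~ Rl d) Lv).
  set (C1 := filterP PC Lc). set (C2 := filterP (fun c => ~ PC c) Lc).
  assert (CE : forall c s v v', corner_end X c s v -> corner_end X c s v' -> v = v').
  { intros c s v v' (a & b & H & ->) (a' & b' & H' & ->).
    destruct (corner_ends_fun _ _ _ _ _ _ H H') as [-> ->]; reflexivity. }
  assert (Ends : forall c, In c Lc -> forall s v, corner_end X c s v -> (PC c <-> Rl v)).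
  { intros c Hcl s v Hv. destruct (Hc c Hcl) as (_ & a & b & Hab & Ha & Hb).
    assert (Ta : corner_end X c true a) by (exists a, b; auto).
    assert (Tb : corner_end X c false b) by (exists a, b; auto).
    assert (Rab : Rl a <-> Rl b).
    { split; intros H; (eapply rt_trans; [exact H|apply rt_step; exists c; auto]). }
    destruct s; [rewrite (CE _ _ _ _ Hv Ta)|rewrite (CE _ _ _ _ Hv Tb), <- Rab];
      (split; [intros (a' & Ha' & HR); now rewrite (CE _ _ _ _ Ta Ha')|intros HR; exists a; auto]). }
  assert (Good : good_link_subgraph X x V1 C1).
  { refine (conj _ (conj _ (conj _ (conj _ (conj _ (conj _ _)))))).
    - now apply filterP_NoDup.
    - now apply filterP_NoDup.
    - destruct (Hinc u Hu) as (t & _ & _ & Ht & Het & _). intros E0.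
      assert (In (fst t) C1); [|rewrite E0 in H; destruct H].
      apply filterP_In. split; auto. apply (Ends _ Ht _ _ Het). apply rt_refl.
    - intros d Hd. apply filterP_In in Hd. now apply Hsrc.
    - intros c H. apply filterP_In in H. destruct H as [H HP].
      destruct (Hc c H) as (Hlt & a & b & Hab & Ha & Hb).
      split; auto. exists a, b. split; auto. split; apply filterP_In; split; auto.
      + apply (Ends c H true a); auto. exists a, b; auto.
      + apply (Ends c H false b); auto. exists a, b; auto.
    - assert (Conn : forall w, Rl w -> clos_refl_trans _ (adj C1) u w).
      { intros w Hw. apply clos_rt_rtn1 in Hw. induction Hw as [|y z (c & Hcl & Hyz) Hy IHy].
        - apply rt_refl.
        - eapply rt_trans; [exact IHy|]. apply rt_step. exists c. split; auto.
          apply filterP_In. split; auto. apply clos_rtn1_rt in Hy.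
          destruct Hyz as [[H1 H2]|[H1 H2]];
            [apply (Ends c Hcl true y H1)|apply (Ends c Hcl false y H2)]; exact Hy. }
      assert (Sym : forall v w, clos_refl_trans _ (adj C1) v w -> clos_refl_trans _ (adj C1) w v).
      { induction 1; [|apply rt_refl|eapply rt_trans; eauto]. apply rt_step.
        destruct H as (c & H & H'). exists c. tauto. }
      intros v w Hv Hw. apply filterP_In in Hv, Hw.
      eapply rt_trans; [apply Sym, Conn; tauto|apply Conn; tauto].
    - intros v Hv (t0 & _ & Huniq). apply filterP_In in Hv. destruct Hv as [Hv HRv].
      destruct (Hinc v Hv) as (t & t' & Hneq & Ht & Het & Ht' & Het').
      apply Hneq. rewrite (Huniq t), (Huniq t'); auto; split; auto;
        apply filterP_In; split; auto; eapply Ends; eauto. }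
  specialize (Hcurv x V1 C1 Good).
  rewrite En, (sumR_split PC), (length_split Rl Lv). fold C1 C2 V1 V2. rewrite plus_INR.
  destruct V2 as [|w V2'] eqn:E2.
  - assert (EC2 : C2 = []).
    { destruct C2 as [|c C2'] eqn:E; [reflexivity|].
      assert (Hcin : In c C2) by (rewrite E; simpl; auto). apply filterP_In in Hcin.
      destruct Hcin as [Hcl HnP]. destruct (Hc c Hcl) as (_ & a & b & Hab & Ha & Hb).
      assert (In a V2); [|rewrite E2 in H; destruct H].
      apply filterP_In. split; auto. intros HR. apply HnP. exists a. split; auto. exists a, b; auto. }
    rewrite EC2. simpl. lra.
  - rewrite <- E2. assert (Hw : In w V2) by (rewrite E2; simpl; auto).
    assert (E : 2 * PI - PI * INR (length V2) + sum_R (map (fun c => PI - ang (fst c) (snd c)) C2) <= alpha).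
    { refine (IH (length V2) _ V2 C2 eq_refl _ _ _ _ _ _); auto.
      - rewrite En. apply (filterP_length_lt _ _ u); auto. intros H; apply H, rt_refl.
      - now apply filterP_NoDup.
      - now apply filterP_NoDup.
      - intros d Hd. apply filterP_In in Hd. now apply Hsrc.
      - intros c Hcl. apply filterP_In in Hcl. destruct Hcl as [Hcl HP].
        destruct (Hc c Hcl) as (Hlt & a & b & Hab & Ha & Hb). split; auto.
        exists a, b. split; auto. split; apply filterP_In; split; auto.
        + intros HR. apply HP. apply (Ends c Hcl true a); auto. exists a, b; auto.
        + intros HR. apply HP. apply (Ends c Hcl false b); auto. exists a, b; auto.
      - intros d Hd. apply filterP_In in Hd. destruct Hd as [Hd HR].
        destruct (Hinc d Hd) as (t & t' & Hneq & Ht & Het & Ht' & Het').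
        exists t, t'. split; auto.
        assert (In (fst t) C2).
        { apply filterP_In. split; auto. intros HP. apply HR. now apply (Ends _ Ht _ _ Het). }
        assert (In (fst t') C2).
        { apply filterP_In. split; auto. intros HP. apply HR. now apply (Ends _ Ht' _ _ Het'). }
        auto.
      - congruence. }
    (* The two estimates add up to the total plus 2 pi, which leaves 2 alpha - 2 pi <= alpha. *)
    assert (2 * PI - alpha >= 0) by lra. lra.
Qed.

End Corners.

(** * Weighted Gauss-Bonnet and the distance to Y *)

Section Radius.
Context {G : group} {X : complex} (A : action G X) (K : nat) (Y Z : subcx X).
Hypothesis HK : stab_bound A K.
Hypothesis HY : is_subcomplex X Y.
Hypothesis HZ : is_subcomplex X Z.
Hypothesis HYZ : subcx_le X Y Z.
Hypothesis IY : inv_sub A Y.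
Hypothesis IZ : inv_sub A Z.
Hypothesis CZ : cofin_sub A Z.
Hypothesis RZ : reach Y Z.
Hypothesis PZ : rel_trivial Y Z.
Hypothesis redZ : reduced Y Z.

Variables (ang : fc X -> nat -> R) (alpha m : R) (LY : list (vtx X)).
Hypothesis Hang : invariant_angles G X A ang.
Hypothesis Hcurv : sectional_curvature_le X ang alpha.
Hypothesis Halpha : alpha < 0.
Hypothesis m_pos : 0 <= m.
Hypothesis Hm : forall v Lc, sV Y v -> NoDup Lc -> (forall c, In c Lc -> corner_at v c) ->
  sum_R (map (fun c => Rabs (PI - ang (fst c) (snd c))) Lc) <= m.
Hypothesis HLY : forall v, sV Y v -> exists h y, In y LY /\ v = av A h y.

Let pV := dV Y Z.
Let pE := dE Y Z.
Let pF := dF Y Z.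

Definition cact (h : G) (c : fc X * nat) : fc X * nat := (af A h (fst c), snd c).
Lemma cact1 c : cact (gone G) c = c.
Proof. destruct c; unfold cact; simpl. now rewrite af1. Qed.
Lemma cactM g h c : cact (gmul G g h) c = cact g (cact h c).
Proof. unfold cact; simpl. now rewrite afM. Qed.
Definition gC : gset G := GSet G (fc X * nat) cact cact1 cactM.

Lemma corner_at_act h v c : corner_at v c -> corner_at (av A h v) (cact h c).
Proof.
  intros (d & Hd & <-). exists (dmap A h d). split; [|apply dtgt_dmap].
  unfold cact; cbn [fst snd]. rewrite fbnd_af. exact (map_nth_error (dmap A h) _ _ Hd).
Qed.

Lemma corner_at_act_iff h v c : corner_at (av A h v) (cact h c) <-> corner_at v c.
Proof.
  split; [|apply corner_at_act]. intros H. apply (corner_at_act (ginv G h)) in H.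
  rewrite avV in H. pose proof (@gaV G gC h c) as E. simpl in E. now rewrite E in H.
Qed.

Lemma corners_at_finite v : exists L, forall c, sF Z (fst c) -> corner_at v c -> In c L.
Proof.
  destruct (@column_finite G (gF A) (gV A) K (fun f v => exists d, In d (fbnd X f) /\ dtgt d = v)
     (sF Z)) with (t := v) as [L HL].
  - apply HK.
  - apply CZ.
  - intros h f w (d & Hd & <-). exists (dmap A h d). split; [|apply dtgt_dmap].
    simpl. rewrite fbnd_af. now apply in_map.
  - intros f. exists (map dtgt (fbnd X f)). intros w (d & Hd & <-). now apply in_map.
  - exists (flat_map (fun f => map (fun i => (f, i)) (seq 0 (length (fbnd X f)))) L).
    intros [f i] Hf (d & Hd & Ed). apply in_flat_map. exists f. split.
    + apply HL; auto. exists d. split; auto. eapply nth_error_In; eauto.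
    + apply in_map, in_seq. apply nth_error_lt in Hd. simpl in Hd. lia.
Qed.

Variables (rV : vtx X -> R) (rE : edg X -> R) (rF : fc X -> R) (rY : vtx X -> R).
Hypothesis WV : @weight G (gV A) pV rV.
Hypothesis WE : @weight G (gE A) pE rE.
Hypothesis WF : @weight G (gF A) pF rF.
Hypothesis WY : @weight G (gV A) (sV Y) rY.
Hypothesis rY_le : fsum rY <= INR (length LY).

Let kap (c : fc X * nat) : R := PI - ang (fst c) (snd c).

Definition clen (c : fc X * nat) : Prop := (snd c < length (fbnd X (fst c)))%nat.

(** A corner inherits the weight of its 2-cell; indices past the end of the boundary path are not
    corners and get weight 0. *)
Definition rC (c : fc X * nat) : R := indic (clen c) * rF (fst c).

Lemma rC_fsupp (g : fc X * nat -> R) : fsupp (fun c => rC c * g c).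
Proof.
  apply fsupp_mulr. destruct (w_fin _ _ WF) as [L HL].
  exists (flat_map (fun f => map (fun i => (f, i)) (seq 0 (length (fbnd X f)))) L).
  intros [f i] E. unfold rC in E. apply in_flat_map. exists f. split.
  - apply HL. intros Q. apply E. simpl. rewrite Q; ring.
  - apply in_map, in_seq. destruct (classic (clen (f, i))) as [Hc|Hc]; [unfold clen in Hc; simpl in Hc; lia|].
    exfalso. apply E. rewrite indic_false by auto. ring.
Qed.

Lemma WC : @weight G gC (fun c => pF (fst c) /\ clen c) rC.
Proof.
  apply (@weight_pullback G (gF A) gC fst pF rF); auto.
  - intros c [H _]; auto.
  - intros c [_ H]. unfold rC. rewrite indic_true; auto. ring.
  - intros c H. unfold rC. destruct (classic (clen c)) as [Hc|Hc].
    + rewrite indic_true by auto. rewrite Rmult_1_l. apply NNPP. intros E. apply H. split; auto.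
      apply (w_supp _ _ WF). auto.
    + rewrite indic_false by auto. ring.
  - intros h [f i] [H1 H2]. split; [now apply dF_inv|]. unfold clen in *. simpl in *.
    rewrite fbnd_af. unfold pmap. now rewrite length_map.
  - pose proof (rC_fsupp (fun _ => 1)) as F. eapply fsupp_sub; [exact F|]. intros c E; simpl in E; lra.
Qed.

Definition rD (d : dart X) : R := rE (fst d).

Lemma rD_fsupp : fsupp rD.
Proof.
  destruct (w_fin _ _ WE) as [L HL].
  exists (map (fun e => (e, true)) L ++ map (fun e => (e, false)) L).
  intros [e b] E. apply in_or_app. destruct b;
    [left; apply (in_map (fun e => (e, true)))|right; apply (in_map (fun e => (e, false)))];
    apply HL; exact E.
Qed.

Lemma WD : @weight G (gD A) (fun d => pE (fst d)) rD.
Proof.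
  apply (@weight_pullback G (gE A) (gD A) fst pE rE); auto.
  - intros d H. apply NNPP. intros E. apply H. now apply (w_supp _ _ WE).
  - intros h d H. now apply dE_inv.
  - apply rD_fsupp.
Qed.

Lemma rD_sum : fsum rD = 2 * fsum rE.
Proof.
  etransitivity; [apply (@fsum_pair (edg X) bool rD rD_fsupp)|].
  rewrite (fsum_ext _ (fun e => 2 * rE e)).
  - rewrite fsum_scal; auto. apply WE.
  - intros e. unfold rD; simpl. rewrite (fsum_eq _ [true; false]).
    + simpl. ring.
    + repeat constructor; simpl; intuition discriminate.
    + intros [] _; simpl; auto.
Qed.

(** Condition (ii) of the curvature bound: the angles of a 2-cell of length n sum to at most pi (n -
    2), so the defects pi - angle sum to at least 2 pi. *)
Lemma rC_sum : 2 * PI * fsum rF <= fsum (fun c => rC c * kap c).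
Proof.
  rewrite fsum_pair by apply rC_fsupp.
  assert (Hf : forall f, fsum (fun i => rC (f, i) * kap (f, i))
      = rF f * sum_R (map (fun i => kap (f, i)) (seq 0 (length (fbnd X f))))).
  { intros f. rewrite (fsum_eq _ (seq 0 (length (fbnd X f)))).
    - rewrite <- sumR_scal. apply sumR_ext. intros i Hi. apply in_seq in Hi.
      unfold rC. rewrite indic_true; [simpl; ring|]. unfold clen; simpl; lia.
    - apply seq_NoDup.
    - intros i E. apply in_seq. apply NNPP. intros Hn. apply E. unfold rC. rewrite indic_false; [ring|].
      unfold clen; simpl; lia. }
  rewrite (fsum_ext _ _ Hf). rewrite <- fsum_scal by apply WF.
  apply fsum_le.
  - apply fsupp_mull, WF.
  - apply fsupp_mulr, WF.
  - intros f. assert (P := w_pos _ _ WF f). destruct Hcurv as [_ H2]. specialize (H2 f).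
    assert (2 * PI <= sum_R (map (fun i => kap (f, i)) (seq 0 (length (fbnd X f))))).
    { unfold kap. simpl.
      rewrite (sumR_ext _ (fun i => PI + (-1) * ang f i)) by (intros; ring).
      rewrite sumR_plus, sumR_scal, sumR_const, length_seq.
      match type of H2 with ?s - _ <= _ => set (s0 := s) in * end.
      change (map (fun i => ang f i)) with (map (ang f)). fold s0. lra. }
    nra.
Qed.

(** For [v] outside Y the sum of [w1 v] is the number of vertices of its link in Z, and the sum of
    [w2 v] is the total defect of the edges of that link. *)
Definition w1 (v : gV A) (d : gD A) : R := indic (pV v /\ pE (fst d) /\ dsrc d = v).
Definition w2 (v : gV A) (c : gC) : R :=
  indic (pV v /\ pF (fst c) /\ corner_at v c) * kap c.

Lemma corner_at_clen v c : corner_at v c -> clen c.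
Proof. intros (d & Hd & _). eapply nth_error_lt; eauto. Qed.

Lemma kap_act h c : kap (cact h c) = kap c.
Proof. unfold kap, cact; simpl. now rewrite Hang. Qed.

Lemma w1_row v : fsupp (w1 v).
Proof.
  destruct (edges_at A K Z HK CZ v) as [L HL].
  exists (map (fun e => (e, true)) L ++ map (fun e => (e, false)) L).
  intros [e b] E. unfold w1 in E. apply in_or_app.
  assert (pV v /\ pE e /\ dsrc (e, b) = v) as (H1 & H2 & H3).
  { apply NNPP. intros Hn. apply E. now rewrite indic_false. }
  assert (In e L). { apply HL; [apply H2|]. rewrite <- H3. destruct b; auto. }
  destruct b; [left; now apply (in_map (fun e => (e, true)))|right; now apply (in_map (fun e => (e, false)))].
Qed.

Lemma w23_row (Q : Prop) v : fsupp (fun c => indic (Q /\ pF (fst c) /\ corner_at v c) * kap c).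
Proof.
  apply fsupp_mulr. destruct (corners_at_finite v) as [L HL]. exists L. intros c E.
  assert (Q /\ pF (fst c) /\ corner_at v c) as (H1 & H2 & H3).
  { apply NNPP. intros Hn. apply E. now rewrite indic_false. }
  apply HL; auto. apply H2.
Qed.

Lemma w23_col (Q : vtx X -> Prop) c :
  fsupp (fun v => indic (Q v /\ pF (fst c) /\ corner_at v c) * kap c).
Proof.
  apply fsupp_mulr.
  destruct (classic (exists v, corner_at v c)) as [[w Hw]|Hn].
  - exists [w]. intros v E. left. destruct Hw as (d & Hd & <-).
    assert (Q v /\ pF (fst c) /\ corner_at v c) as (_ & _ & d' & Hd' & <-).
    { apply NNPP. intros Hn. apply E. now rewrite indic_false. }
    rewrite Hd in Hd'. congruence.
  - exists []. intros v E. apply E. rewrite indic_false; auto. intros (_ & _ & H). eauto.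
Qed.

(** Every edge has two ends; ends at vertices of Y are left out, whence only an inequality. *)
Lemma gb_darts : fsum (fun v : gV A => rV v * fsum (w1 v)) <= 2 * fsum rE.
Proof.
  rewrite (@mass_transport G (gV A) (gD A) pV rV (fun d => pE (fst d)) rD w1 WV WD).
  - rewrite <- rD_sum. apply fsum_le.
    + apply fsupp_mulr, rD_fsupp.
    + apply rD_fsupp.
    + intros d. assert (0 <= rD d) by apply (w_pos _ _ WD). 
      assert (fsum (fun s => w1 s d) <= 1).
      { rewrite (fsum_single _ (dsrc d)).
        - apply indic_bounds.
        - intros v Hv. unfold w1. rewrite indic_false; auto. intros (_ & _ & E); congruence. }
      nra.
  - intros h v d. apply indic_iff.
    pose proof (invar_iff _ (dV_inv A Y Z IY IZ) h v) as I1.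
    pose proof (invar_iff _ (dE_inv A Y Z IY IZ) h (fst d)) as I2. simpl in *.
    rewrite dsrc_dmap. fold pV in I1. fold pE in I2. rewrite I1, I2. intuition.
    + eapply av_inj; eauto.
    + congruence.
  - intros v d E. assert (pV v /\ pE (fst d) /\ dsrc d = v).
    { apply NNPP. intros Hn. apply E. unfold w1. now rewrite indic_false. }
    tauto.
  - apply w1_row.
  - intros d. exists [dsrc d]. intros v E. left. apply NNPP. intros Hn. apply E. unfold w1.
    rewrite indic_false; auto. tauto.
Qed.

Lemma transport_corners (Q : vtx X -> Prop) (rQ : vtx X -> R) : @weight G (gV A) Q rQ ->
  @invar G (gV A) Q ->
  fsum (fun v => rQ v * fsum (fun c => indic (Q v /\ pF (fst c) /\ corner_at v c) * kap c))
  = fsum (fun c => rC c * fsum (fun v => indic (Q v /\ pF (fst c) /\ corner_at v c) * kap c)).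
Proof.
  intros WQ IQ.
  apply (@mass_transport G (gV A) gC Q rQ (fun c => pF (fst c) /\ clen c) rC
     (fun v c => indic (Q v /\ pF (fst c) /\ corner_at v c) * kap c) WQ WC).
  - intros h v c. simpl. rewrite kap_act. f_equal. apply indic_iff.
    pose proof (invar_iff _ IQ h v) as I1.
    pose proof (invar_iff _ (dF_inv A Y Z IY IZ) h (fst c)) as I2. simpl in *.
    fold pF in I2. rewrite I1, I2, corner_at_act_iff. tauto.
  - intros v c E. assert (Q v /\ pF (fst c) /\ corner_at v c) as (H1 & H2 & H3).
    { apply NNPP. intros Hn. apply E. rewrite indic_false; [ring|auto]. }
    split; auto. split; auto. eapply corner_at_clen; eauto.
  - intros v. apply w23_row.
  - intros c. apply (w23_col Q c).
Qed.

(** The defects of a 2-cell outside Y sum to at least 2 pi. Its corners at vertices of Y are absent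
    from the right-hand side; their mass is at most [m] times the weight of the vertices of Y,
    itself at most |LY|. *)
Lemma gb_corners :
  2 * PI * fsum rF - INR (length LY) * m <= fsum (fun v => rV v * fsum (w2 v)).
Proof.
  unfold w2.
  etransitivity; [|right; symmetry; apply (transport_corners pV rV WV (dV_inv A Y Z IY IZ))].
  assert (IYV : @invar G (gV A) (sV Y)) by (intros h v H; now apply IY).
  assert (B : fsum (fun c => rC c * fsum (fun v => indic (sV Y v /\ pF (fst c) /\ corner_at v c) * kap c))
     <= INR (length LY) * m).
  { rewrite <- (transport_corners (sV Y) rY WY IYV).
    transitivity (fsum rY * m); [|apply Rmult_le_compat_r; auto].
      rewrite Rmult_comm, <- fsum_scal by apply WY. apply fsum_le.
      + apply fsupp_mulr, WY.
      + apply fsupp_mull, WY.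
      + intros v. assert (P := w_pos _ _ WY v).
        destruct (classic (sV Y v)) as [Hv|Hv].
        * rewrite Rmult_comm. apply Rmult_le_compat_r; auto.
          destruct (finite_list (fun c => pF (fst c) /\ corner_at v c)) as (L & N & HL).
          { destruct (corners_at_finite v) as [L HL]. exists L. intros c [H1 H2]. apply HL; auto. apply H1. }
          rewrite (fsum_eq _ L); auto.
          -- etransitivity; [|apply (Hm v L Hv N); intros c Hc; now apply HL].
             apply sumR_le. intros c Hc. apply HL in Hc. rewrite indic_true by tauto.
             rewrite Rmult_1_l. apply Rle_abs.
          -- intros c E. apply HL. apply NNPP. intros Hn. apply E. rewrite indic_false; [ring|tauto].
        * replace (rY v) with 0; [lra|]. symmetry. apply NNPP. intros E. apply Hv.
          now apply (w_supp _ _ WY). }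
  assert (S : fsum (fun c => rC c * fsum (fun v => indic (pV v /\ pF (fst c) /\ corner_at v c) * kap c))
     = fsum (fun c => rC c * kap c) -
       fsum (fun c => rC c * fsum (fun v => indic (sV Y v /\ pF (fst c) /\ corner_at v c) * kap c))).
  { rewrite <- fsum_minus by apply rC_fsupp. apply fsum_ext. intros c.
    destruct (Req_dec (rC c) 0) as [->|Hc]; [ring|].
    apply (w_supp _ _ WC) in Hc. destruct Hc as [Hf Hl].
    destruct (nth_error_ex _ _ Hl) as [d Hd].
    assert (Hat : forall v, corner_at v c <-> v = dtgt d).
    { intros v. split; [|intros ->; exists d; auto]. intros (d' & Hd' & <-). congruence. }
    rewrite !(fsum_single _ (dtgt d)).
    2:{ intros v Hv. rewrite indic_false; [ring|]. rewrite Hat. tauto. }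
    2:{ intros v Hv. rewrite indic_false; [ring|]. rewrite Hat. tauto. }
    assert (ZV : sV Z (dtgt d)).
    { assert (ZE : sE Z (fst d)) by (eapply (proj2 HZ); [apply Hf|]; eapply nth_error_In; eauto).
      destruct (proj1 HZ _ ZE). unfold dtgt, dtgt'. destruct (snd d); auto. }
    destruct (classic (sV Y (dtgt d))) as [Yd|Yd].
    - rewrite (indic_false (pV _ /\ _)), indic_true; [ring| |].
      + rewrite Hat. auto.
      + unfold pV, dV. tauto.
    - rewrite (indic_true (pV _ /\ _)), indic_false; [ring|tauto|].
      rewrite Hat. unfold pV, dV. auto. }
  rewrite S. pose proof rC_sum. lra.
Qed.

(** All cells of Z at a vertex outside Y are outside Y, so [w1] and [w2] see its whole link in Z,
    and [reduced] provides two incidences at each vertex of that link. *)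
Lemma link_at v : pV v -> 2 * PI - PI * fsum (w1 v) + fsum (w2 v) <= alpha.
Proof.
  intros Hv. assert (Yv : ~ sV Y v) by apply Hv.
  destruct (finite_list (fun d : dart X => dsrc d = v /\ sE Z (fst d))) as (Lv & NV & HLv).
  { destruct (edges_at A K Z HK CZ v) as [L HL].
    exists (map (fun e => (e, true)) L ++ map (fun e => (e, false)) L).
    intros [e b] [H1 H2]. apply in_or_app.
    assert (In e L). { apply HL; auto. rewrite <- H1. destruct b; auto. }
    destruct b; [left; now apply (in_map (fun e => (e, true)))|right; now apply (in_map (fun e => (e, false)))]. }
  destruct (finite_list (fun c => sF Z (fst c) /\ corner_at v c)) as (Lc & NC & HLc).
  { destruct (corners_at_finite v) as [L HL]. exists L. intros c [H1 H2]; auto. }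
  assert (EpE : forall d, dsrc d = v -> sE Z (fst d) -> pE (fst d)).
  { intros d Hd HE. split; auto. intros HYE. apply Yv. rewrite <- Hd.
    destruct (proj1 HY _ HYE). unfold dsrc, dsrc'. destruct (snd d); auto. }
  assert (EpF : forall c, corner_at v c -> sF Z (fst c) -> pF (fst c)).
  { intros c (d & Hd & Ed) HF. split; auto. intros HYF. apply Yv. rewrite <- Ed.
    assert (HYE : sE Y (fst d)) by (eapply (proj2 HY); eauto; eapply nth_error_In; eauto).
    destruct (proj1 HY _ HYE). unfold dtgt, dtgt'. destruct (snd d); auto. }
  replace (fsum (w1 v)) with (INR (length Lv)).
  2:{ rewrite (fsum_eq _ Lv NV).
      - rewrite (sumR_ext _ (fun _ => 1)), sumR_const; [ring|].
        intros d Hd. apply HLv in Hd. apply indic_true. destruct Hd. auto.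
      - intros d E. apply HLv. apply NNPP. intros Hn. apply E. apply indic_false.
        intros (_ & H2 & H3). apply Hn. split; auto. apply H2. }
  replace (fsum (w2 v)) with (sum_R (map (fun c => PI - ang (fst c) (snd c)) Lc)).
  2:{ symmetry. etransitivity; [apply (fsum_eq (w2 v) Lc NC)|].
      - intros c E. apply HLc. apply NNPP. intros Hn. apply E. unfold w2. rewrite indic_false; [ring|].
        intros (_ & H2 & H3). apply Hn. split; auto. apply H2.
      - apply sumR_ext. intros c Hc. apply HLc in Hc. destruct Hc. unfold w2.
        rewrite indic_true by auto. apply Rmult_1_l. }
  pose proof PI_RGT_0. apply (link_curvature ang alpha v); auto; try lra.
  - intros d Hd. now apply HLv.
  - intros [f i] Hc. apply HLc in Hc. destruct Hc as [HF Hat]. cbn [fst snd] in *.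
    assert (Hi := corner_at_clen _ _ Hat). split; auto.
    destruct (corner_ends_ex f i Hi) as (a & b & Hab). exists a, b. split; auto.
    destruct (corner_at_ends _ _ _ _ _ Hat Hab) as [Ha Hb].
    destruct Hab as (x & y & Hx & Hy & Ea & Eb).
    split; apply HLv; split; auto.
    + subst a. simpl. eapply (proj2 HZ); eauto. eapply nth_error_In; eauto.
    + subst b. eapply (proj2 HZ); eauto. eapply nth_error_In; eauto.
  - intros d Hd. apply HLv in Hd. destruct Hd as [Hd HE].
    destruct (redZ (fst d)) as (t & t' & Hneq & Ht & Ht'); auto.
    { apply (EpE d Hd HE). }
    exists (incidence d t), (incidence d t').
    destruct (incidence_spec _ _ _ Ht) as (H1 & H2 & H3).
    destruct (incidence_spec _ _ _ Ht') as (H1' & H2' & H3').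
    split; [intros E; apply Hneq; eapply incidence_inj; eauto|].
    rewrite Hd in *. repeat split; auto; apply HLc; split; auto.
    + rewrite H3. apply Ht.
    + rewrite H3'. apply Ht'.
  (* The link is nonempty: a path from Y to [v] has a last dart. *)
  - destruct (RZ v) as (y & p & Hy & Hp); [apply Hv|]. intros E0.
    destruct p as [|d p] using rev_ind.
    + destruct Hp as (_ & Hp & _). apply Yv. rewrite <- Hp. exact Hy.
    + destruct Hp as (_ & Hp & Hin). apply path_ok_app in Hp. destruct Hp as (w & _ & Hd).
      rewrite path_ok_cons, path_ok_nil in Hd. destruct Hd as [_ Hd].
      assert (In (dinv d) Lv); [|rewrite E0 in *; auto].
      apply HLv. split; [now rewrite dsrc_dinv|]. apply (Hin d). apply in_or_app; simpl; auto.
Qed.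

(** Summing [link_at] gives 2 pi V - 2 pi E + 2 pi F - |LY| m <= alpha V, and V - E + F >= 0 by
    [relative_euler]. *)
Lemma measure_bound : - alpha * fsum rV <= INR (length LY) * m.
Proof.
  assert (E := relative_euler A K Y Z HK HY HZ IY IZ CZ RZ PZ rV rE rF WV WE WF).
  assert (D := gb_darts). assert (C := gb_corners).
  assert (FV := w_fin _ _ WV). assert (Ppi := PI_RGT_0).
  assert (L : fsum (fun v => rV v * (2 * PI - PI * fsum (w1 v) + fsum (w2 v))) <= alpha * fsum rV).
  { rewrite <- fsum_scal by auto. apply fsum_le; try fs. intros v.
    destruct (Req_dec (rV v) 0) as [->|Hv]; [lra|].
    assert (P := w_pos _ _ WV v). assert (LA := link_at v (w_supp _ _ WV v Hv)). simpl in *. nra. }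
  rewrite (fsum_ext _ (fun v => 2 * PI * rV v + ((- PI) * (rV v * fsum (w1 v)) + rV v * fsum (w2 v)))) in L
    by (intros; ring).
  rewrite fsum_plus, fsum_plus, !fsum_scal in L; try fs.
  simpl in *. nra.
Qed.

(** A shortest path from Y meets every distance 1, ..., k. Distance to Y is invariant, so these
    vertices lie in distinct orbits, each containing a vertex of weight at least 1/K; thus k <= K
    V. *)
Lemma vertices_near (Rad : nat) :
  (forall v, pV v -> exists h, 1 <= INR K * rV (av A h v)) ->
  INR K * (INR (length LY) * m) <= - alpha * INR Rad ->
  forall v, sV Z v -> exists y p, sV Y y /\ path_in Z y p v /\ (length p <= Rad)%nat.
Proof.
  intros Hlow HRad.
  set (near := fun v k => exists y p, sV Y y /\ path_in Z y p v /\ (length p <= k)%nat).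
  set (dist := fun v k => near v k /\ forall j, (j < k)%nat -> ~ near v j).
  assert (Hdist : forall v, sV Z v -> exists k, dist v k).
  { intros v Hv. destruct (RZ v Hv) as (y & p & Hy & Hp).
    assert (Hn : near v (length p)) by (exists y, p; auto).
    remember (length p) as k. clear -Hn. revert Hn. induction k as [k IH] using lt_wf_ind.
    intros Hn. destruct (classic (exists j, (j < k)%nat /\ near v j)) as [(j & Hj & H)|H]; eauto.
    exists k. split; auto. intros j Hj H'. eauto. }
  assert (nearA : forall h v k, near v k -> near (av A h v) k).
  { intros h v k (y & p & Hy & Hp & Hl). exists (av A h y), (pmap A h p). split; [now apply IY|].
    split; [now apply path_in_pmap|]. unfold pmap. now rewrite length_map. }
  assert (distA : forall h v k, dist v k -> dist (av A h v) k).
  { intros h v k [H1 H2]. split; auto. intros j Hj H. apply (H2 j Hj).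
    rewrite <- (avV A h v). now apply nearA. }
  assert (Hprev : forall v k, dist v (S k) -> exists w, sV Z w /\ dist w k).
  { intros v k [(y & p & Hy & Hp & Hl) Hmin].
    destruct p as [|d p] using rev_ind.
    - exfalso. apply (Hmin 0%nat); [lia|]. exists y, []. auto.
    - clear IHp. rewrite length_app in Hl. simpl in Hl. apply path_in_app in Hp; auto.
      destruct Hp as (w & Hp & Hd). exists w. split; [eapply path_in_end; eauto|].
      split; [exists y, p; split; [auto|split; [auto|lia]]|].
      intros j Hj (y' & p' & Hy' & Hp' & Hl'). apply (Hmin (S j)); [lia|].
      exists y', (p' ++ [d]). split; auto. split; [apply path_in_app; eauto|].
      rewrite length_app. simpl. lia. }
  (* One translate of sufficient weight for each distance from 1 to k; the differing distances
     exclude repetitions. *)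
  assert (Hlist : forall k v, sV Z v -> dist v k -> exists L : list (vtx X), NoDup L /\ length L = k /\
     forall u, In u L -> 1 <= INR K * rV u /\ exists i, (i <= k)%nat /\ dist u i).
  { induction k as [|k IH]; intros v Zv Dv.
    - exists []. repeat split; [constructor|simpl in *; tauto|simpl in *; tauto].
    - destruct (Hprev v k Dv) as (w & Zw & Dw). destruct (IH w Zw Dw) as (L & N & Hl & HL).
      destruct (Hlow v) as (h & Hh).
      { split; auto. intros Yv. apply (proj2 Dv 0%nat); [lia|].
        exists v, []. split; auto. split; [now apply path_in_nil|simpl; lia]. }
      exists (av A h v :: L). split; [|split].
      + constructor; auto. intros Hin. destruct (HL _ Hin) as (_ & i & Hi & [Di _]).
        apply (proj2 (distA h v (S k) Dv) i); [lia|auto].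
      + simpl; lia.
      + intros u [<-|Hu]; [split; auto; exists (S k); split; auto|].
        destruct (HL u Hu) as (H1 & i & Hi & Di). split; auto. exists i. split; [lia|auto]. }
  intros v Zv. destruct (Hdist v Zv) as (k & Dk).
  destruct (Hlist k v Zv Dk) as (L & N & Hl & HL).
  assert (Hk : INR k <= INR K * fsum rV).
  { rewrite <- Hl, <- (Rmult_1_r (INR (length L))), <- (sumR_const 1 L).
    transitivity (sum_R (map (fun u => INR K * rV u) L)).
    - apply sumR_le. intros u Hu. now apply HL.
    - rewrite sumR_scal. apply Rmult_le_compat_l; [apply pos_INR|].
      apply fsum_NoDup_le; auto; apply WV. }
  assert (M := measure_bound).
  assert (k <= Rad)%nat.
  { apply INR_le. apply (Rmult_le_reg_l (- alpha)); [lra|].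
    transitivity (INR K * (- alpha * fsum rV)); [nra|].
    etransitivity; [|exact HRad]. apply Rmult_le_compat_l; [apply pos_INR|]. exact M. }
  destruct Dk as [(y & p & Hy & Hp & Hlen) _]. exists y, p. split; auto. split; auto. lia.
Qed.

End Radius.

(** The weights are chosen inside the proof, so that the radius involves only [K], [LY], [m] and
    [alpha] and no data of Z. *)
Theorem radius_bound {G : group} {X : complex} (A : action G X) (K : nat) (Y Z : subcx X)
    (ang : fc X -> nat -> R) (alpha m : R) (LY : list (vtx X)) (Rad : nat) :
  stab_bound A K -> is_subcomplex X Y -> is_subcomplex X Z -> subcx_le X Y Z ->
  inv_sub A Y -> inv_sub A Z -> cofin_sub A Z -> reach Y Z -> rel_trivial Y Z -> reduced Y Z ->
  invariant_angles G X A ang -> sectional_curvature_le X ang alpha -> alpha < 0 -> 0 <= m ->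
  (forall v Lc, sV Y v -> NoDup Lc -> (forall c, In c Lc -> corner_at v c) ->
    sum_R (map (fun c => Rabs (PI - ang (fst c) (snd c))) Lc) <= m) ->
  (forall v, sV Y v -> exists h y, In y LY /\ v = av A h y) ->
  INR K * (INR (length LY) * m) <= - alpha * INR Rad ->
  forall v, sV Z v -> exists y p, sV Y y /\ path_in Z y p v /\ (length p <= Rad)%nat.
Proof.
  intros HK HY HZ HYZ IY IZ CZ RZ PZ redZ Hang Hcurv Halpha m_pos Hm HLY HRad.
  destruct (dV_cof A Y Z CZ) as [L1 H1]. destruct (dE_cof A Y Z CZ) as [L2 H2].
  destruct (dF_cof A Y Z CZ) as [L3 H3].
  destruct HK as (K1 & K2 & K3).
  destruct (@weight_exists G (gV A) K _ L1 K1 (dV_inv A Y Z IY IZ) H1) as (rV & WV & _ & Hlow).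
  destruct (@weight_exists G (gE A) K _ L2 K2 (dE_inv A Y Z IY IZ) H2) as (rE & WE & _ & _).
  destruct (@weight_exists G (gF A) K _ L3 K3 (dF_inv A Y Z IY IZ) H3) as (rF & WF & _ & _).
  assert (IYV : @invar G (gV A) (sV Y)) by (intros h v H; now apply IY).
  destruct (@weight_exists G (gV A) K _ LY K1 IYV HLY) as (rY & WY & HrY & _).
  eapply (vertices_near A K Y Z) with (rE := rE) (rF := rF) (rY := rY); eauto.
  - split; [|split]; auto.
  - eapply (weight_sum_mono (S := gV A)); eauto.
Qed.

(** * Reduction of relatively trivial pairs *)

Lemma dsrc_or {X : complex} (d : dart X) :
  (dsrc d = esrc X (fst d) /\ dtgt d = etgt X (fst d)) \/
  (dsrc d = etgt X (fst d) /\ dtgt d = esrc X (fst d)).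
Proof. destruct d as [e []]; [left|right]; split; reflexivity. Qed.

Lemma sV_dsrc {X : complex} (S : subcx X) d : is_subcomplex X S -> sE S (fst d) ->
  sV S (dsrc d) /\ sV S (dtgt d).
Proof.
  intros [H _] Hd. destruct (H _ Hd). destruct (dsrc_or d) as [[-> ->]|[-> ->]]; auto.
Qed.

Lemma path_in_single {X : complex} (S : subcx X) d : is_subcomplex X S -> sE S (fst d) ->
  path_in S (dsrc d) [d] (dtgt d).
Proof.
  intros HS Hd. split; [now apply sV_dsrc|]. split; [split; reflexivity|].
  intros d' [<-|[]]; auto.
Qed.

(* Cut Z along edges lying in no 2-cell, and keep the component of Y.  As every path of Z with
   ends in Y deforms into Y, and so crosses a cut edge algebraically zero times, what is cut off
   hangs at single vertices; collapsing it to these vertices is a retraction. *)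
Section Arcs.
Context {X : complex} (Y Z : subcx X) (cut : edg X -> Prop) (y0 : vtx X).
Hypothesis HY : is_subcomplex X Y.
Hypothesis HZ : is_subcomplex X Z.
Hypothesis HYZ : subcx_le X Y Z.
Hypothesis PZ : rel_trivial Y Z.
Hypothesis Hy0 : sV Y y0.
Hypothesis cutY : forall e, sE Y e -> ~ cut e.
Hypothesis cutF : forall f, sF Z f -> forall d, In d (fbnd X f) -> ~ cut (fst d).

Definition trimV v := exists y p, sV Y y /\ path_in Z y p v /\ forall d, In d p -> ~ cut (fst d).
Definition trimE e := sE Z e /\ ~ cut e /\ trimV (esrc X e).
Definition trimF f := sF Z f /\ forall d, In d (fbnd X f) -> trimE (fst d).
Definition trim : subcx X := Subcx X trimV trimE trimF.

Lemma trimV_step d : sE Z (fst d) -> ~ cut (fst d) -> trimV (dsrc d) -> trimV (dtgt d).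
Proof.
  intros Hd Hc (y & p & Hy & Hp & Hin). exists y, (p ++ [d]). split; auto. split.
  - apply path_in_app; auto. exists (dsrc d). split; auto using path_in_single.
  - intros d' Hd'. apply in_app_or in Hd'. destruct Hd' as [?|[<-|[]]]; auto.
Qed.

Lemma trimV_iff d : sE Z (fst d) -> ~ cut (fst d) -> (trimV (dsrc d) <-> trimV (dtgt d)).
Proof.
  intros Hd Hc. split; [now apply trimV_step|]. intros H.
  rewrite <- (dtgt_dinv d). apply trimV_step; auto. now rewrite dsrc_dinv.
Qed.

Lemma trimE_iff d : trimE (fst d) <-> sE Z (fst d) /\ ~ cut (fst d) /\ trimV (dsrc d).
Proof.
  unfold trimE. split; intros (H1 & H2 & H3); repeat split; auto;
    pose proof (trimV_iff d H1 H2); destruct (dsrc_or d) as [[E1 E2]|[E1 E2]];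
    rewrite E1, E2 in *; tauto.
Qed.

Lemma trimV_Z v : trimV v -> sV Z v.
Proof. intros (y & p & _ & Hp & _). eapply path_in_end; eauto. Qed.

Lemma trim_sub : is_subcomplex X trim.
Proof.
  split; simpl.
  - intros e He. pose proof (proj1 (trimE_iff (e, true)) He) as (H1 & H2 & H3).
    pose proof (trimV_step (e, true) H1 H2 H3). auto.
  - intros f [_ H] d Hd. auto.
Qed.

Lemma trim_le : subcx_le X trim Z.
Proof.
  split; [|split]; simpl.
  - apply trimV_Z.
  - intros e H; apply H.
  - intros f H; apply H.
Qed.

Lemma trim_contains (B : subcx X) : is_subcomplex X B -> subcx_le X B Z -> reach Y B ->
  (forall e, sE B e -> ~ cut e) -> subcx_le X B trim.
Proof.
  intros HB HBZ RB HBc.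
  assert (HV : forall v, sV B v -> trimV v).
  { intros v Hv. destruct (RB v Hv) as (y & p & Hy & Hp). exists y, p. split; auto. split.
    - eapply path_in_mono; eauto.
    - intros d Hd. apply HBc. now apply Hp. }
  assert (HE : forall e, sE B e -> trimE e).
  { intros e He. split; [now apply HBZ|]. split; [auto|]. apply HV. now apply HB. }
  split; [|split]; auto. intros f Hf. split; [now apply HBZ|]. intros d Hd. apply HE. eapply HB; eauto.
Qed.

Lemma reach_self (B : subcx X) : reach B B.
Proof. intros v Hv. exists v, []. split; auto. now apply path_in_nil. Qed.

Lemma trim_above : subcx_le X Y trim.
Proof. apply trim_contains; auto using reach_self. Qed.

Lemma trim_reach : reach Y trim.
Proof.
  intros v (y & p & Hy & Hp & Hin). exists y, p. split; auto.
  assert (Hv0 : trimV y) by (exists y, []; split; auto; split; [now apply path_in_nil; apply HYZ|simpl; tauto]).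
  clear Hy. revert y Hp Hin Hv0. induction p as [|d p IH]; intros y Hp Hin Hv0.
  - destruct Hp as (_ & Hp & _). rewrite path_ok_nil in Hp; subst. now apply path_in_nil.
  - destruct Hp as (_ & Hp & HE). rewrite path_ok_cons in Hp. destruct Hp as [<- Hp].
    assert (Ed : trimE (fst d)) by (apply trimE_iff; repeat split; auto; [apply HE|apply Hin]; simpl; auto).
    assert (Vt : trimV (dtgt d)) by (apply (proj2 (sV_dsrc trim d trim_sub Ed))).
    change (d :: p) with ([d] ++ p). apply path_in_app; [apply trim_sub|]. exists (dtgt d). split.
    + apply path_in_single; [apply trim_sub|auto].
    + apply IH; auto.
      * split; [now apply trimV_Z|]. split; auto. intros; apply HE; simpl; auto.
      * intros; apply Hin; simpl; auto.
Qed.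

(** The path deforms into Y, where no edge is cut, and the deformation cannot change the coefficient
    at a cut edge because no 2-cell of Z contains it. *)
Lemma crossing_zero u v p e : cut e -> sV Y u -> sV Y v -> path_in Z u p v -> ch p e = 0.
Proof.
  intros He Hu Hv Hp. destruct (PZ u v p Hu Hv Hp) as (q & Hq & H).
  destruct (ch_homotopic _ _ _ _ _ H) as (c & F & Hc & E). specialize (E e).
  rewrite (fsum_ext _ (fun _ => 0)), fsum_0 in E.
  - rewrite (ch_avoid q) in E; [lra|]. intros d Hd Ed. apply (cutY e); auto. rewrite <- Ed. now apply Hq.
  - intros f. destruct (Req_dec (c f) 0) as [->|Q]; [ring|]. rewrite ch_avoid; [ring|].
    intros d Hd Ed. apply (cutF f (Hc f Q) d Hd). now rewrite Ed.
Qed.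

(** [v] is reached by leaving the trimmed part along [d] and never returning to it. *)
Inductive attached : dart X -> vtx X -> Prop :=
| att_first d : sE Z (fst d) -> trimV (dsrc d) -> ~ trimV (dtgt d) -> attached d (dtgt d)
| att_next d d' : attached d (dsrc d') -> sE Z (fst d') -> ~ trimV (dtgt d') -> attached d (dtgt d').

Lemma attached_cut d v : attached d v ->
  sE Z (fst d) /\ cut (fst d) /\ trimV (dsrc d) /\ ~ trimV (dtgt d) /\ ~ trimV v.
Proof.
  induction 1; [|tauto]. repeat split; auto. apply NNPP. intros Hc.
  apply H1. now apply trimV_step.
Qed.

Lemma attached_path d v : attached d v -> exists q, path_in Z (dsrc d) q v /\
  forall e, trimV (esrc X e) \/ trimV (etgt X e) -> ch q e = ch [d] e.
Proof.
  induction 1 as [d H H0 H1|d d' H IH H0 H1].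
  - exists [d]. split; auto using path_in_single.
  - destruct IH as (q & Hq & Hch). exists (q ++ [d']). split.
    + apply path_in_app; auto. exists (dsrc d'). split; auto using path_in_single.
    + intros e He. rewrite ch_app, Hch by auto. simpl. rewrite (indic_false (e = fst d')); [ring|].
      intros ->. apply attached_cut in H. destruct H as (_ & _ & _ & _ & H).
      destruct (dsrc_or d') as [[E1 E2]|[E1 E2]]; rewrite E1, E2 in *; tauto.
Qed.

(** A path from Y out through [d] to [v] and back through [d'] crosses the edge of [d] algebraically
    zero times, so the way back must use that same edge in the opposite direction. *)
Lemma attached_unique d d' v : attached d v -> attached d' v -> dsrc d = dsrc d'.
Proof.
  intros H H'. destruct (attached_cut _ _ H) as (Zd & Cd & Sd & Td & _).
  destruct (attached_cut _ _ H') as (Zd' & Cd' & Sd' & Td' & _).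
  destruct (attached_path _ _ H) as (q & Hq & Eq).
  destruct (attached_path _ _ H') as (q' & Hq' & Eq').
  assert (Sd0 := Sd). assert (Sd0' := Sd').
  destruct Sd0 as (y & p & Hy & Hp & Hin). destruct Sd0' as (y' & p' & Hy' & Hp' & Hin').
  assert (E : ch (p ++ q ++ pinv q' ++ pinv p') (fst d) = 0).
  { apply (crossing_zero y y'); auto. apply path_in_app; auto. exists (dsrc d). split; auto.
    apply path_in_app; auto. exists v. split; auto.
    apply path_in_app; auto. exists (dsrc d'). split; apply path_in_pinv; auto. }
  assert (Hend : trimV (esrc X (fst d)) \/ trimV (etgt X (fst d))).
  { destruct (dsrc_or d) as [[E1 E2]|[E1 E2]]; rewrite E1 in Sd; auto. }
  rewrite !ch_app, !ch_pinv, Eq, Eq', (ch_avoid p), (ch_avoid p') in E; auto.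
  2:{ intros x Hx Ex. apply (Hin' x Hx). now rewrite Ex. }
  2:{ intros x Hx Ex. apply (Hin x Hx). now rewrite Ex. }
  simpl in E. rewrite indic_true in E by auto.
  destruct (classic (fst d = fst d')) as [Ed|Ed].
  - rewrite indic_true in E by auto. replace d with d'; auto.
    destruct d as [e b], d' as [e' b']. simpl in *. subst e'. f_equal.
    destruct b, b'; auto; lra.
  - rewrite indic_false in E by auto. destruct (snd d); lra.
Qed.

(** The retraction on vertices. A vertex outside [trim] that is attached nowhere lies in a component
    of Z missing [trim] and is sent to [y0]. *)
Definition hang (v : vtx X) : vtx X :=
  if dec (trimV v) then v else
  match dec (exists d, attached d v) with
  | left H => dsrc (proj1_sig (constructive_indefinite_description _ H))
  | right _ => y0
  end.

Lemma hang_trim v : trimV v -> hang v = v.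
Proof. intros H. unfold hang. destruct (dec _); tauto. Qed.

Lemma hang_attached d v : attached d v -> hang v = dsrc d.
Proof.
  intros H. unfold hang. destruct (dec _) as [V|V]; [now apply attached_cut in H|].
  destruct (dec _) as [E|E]; [|exfalso; eauto].
  destruct (constructive_indefinite_description _ E) as [d' Hd']; simpl.
  now apply (attached_unique d' d v).
Qed.

Lemma hang_outside d : sE Z (fst d) -> ~ trimE (fst d) -> hang (dsrc d) = hang (dtgt d).
Proof.
  intros Zd Td.
  assert (C : forall d, sE Z (fst d) -> ~ trimE (fst d) -> trimV (dsrc d) -> hang (dsrc d) = hang (dtgt d)).
  { clear d Zd Td. intros d Zd Td V.
    assert (Cd : cut (fst d)) by (apply NNPP; intros Hc; apply Td, trimE_iff; auto).
    destruct (classic (trimV (dtgt d))) as [V'|V'].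
    (* A cut edge with both ends in [trim] would be crossed exactly once by a path with ends in
       Y. *)
    - exfalso. destruct V as (y & p & Hy & Hp & Hin), V' as (y' & p' & Hy' & Hp' & Hin').
      assert (E : ch (p ++ [d] ++ pinv p') (fst d) = 0).
      { apply (crossing_zero y y'); auto. apply path_in_app; auto. exists (dsrc d). split; auto.
        apply path_in_app; auto. exists (dtgt d). split; [now apply path_in_single|].
        now apply path_in_pinv. }
      rewrite ch_app in E. simpl in E. rewrite ch_pinv, (ch_avoid p), (ch_avoid p'), indic_true in E; auto.
      + destruct (snd d); lra.
      + intros x Hx Ex. apply (Hin' x Hx). now rewrite Ex.
      + intros x Hx Ex. apply (Hin x Hx). now rewrite Ex.
    - rewrite hang_trim by auto. symmetry. apply hang_attached. now constructor. }
  destruct (classic (trimV (dsrc d))) as [V|V]; [now apply C|].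
  destruct (classic (trimV (dtgt d))) as [V'|V'].
  - symmetry. pose proof (C (dinv d)) as E. rewrite dsrc_dinv, dtgt_dinv in E. auto.
  - destruct (classic (exists d0, attached d0 (dsrc d))) as [[d0 H]|Hn].
    + rewrite (hang_attached d0), (hang_attached d0); auto. now constructor.
    + destruct (classic (exists d0, attached d0 (dtgt d))) as [[d0 H]|Hn'].
      * exfalso. apply Hn. exists d0. rewrite <- (dtgt_dinv d). constructor.
        -- now rewrite dsrc_dinv.
        -- auto.
        -- now rewrite dtgt_dinv.
      * unfold hang. destruct (dec _); [tauto|]. destruct (dec (trimV (dtgt d))); [tauto|].
        destruct (dec _); [tauto|]. destruct (dec _); tauto.
Qed.

Definition trim_dart (d : dart X) : list (dart X) := if dec (trimE (fst d)) then [d] else [].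

Lemma trim_face_all f : sF Z f ->
  (forall d, In d (fbnd X f) -> trimE (fst d)) \/ (forall d, In d (fbnd X f) -> ~ trimE (fst d)).
Proof.
  intros Hf. destruct (fbnd_loop f) as [v Hv].
  assert (L : forall p u w, path_ok u p w -> (forall d, In d p -> sE Z (fst d) /\ ~ cut (fst d)) ->
     (trimV u -> forall d, In d p -> trimE (fst d)) /\ ((exists d, In d p /\ trimE (fst d)) -> trimV u)).
  { induction p as [|d p IH]; intros u w Hp Hin; [split; [simpl; tauto|intros (d & [] & _)]|].
    rewrite path_ok_cons in Hp. destruct Hp as [<- Hp].
    destruct (IH _ _ Hp) as [I1 I2]; [intros; apply Hin; simpl; auto|].
    destruct (Hin d) as [Zd Cd]; [simpl; auto|].
    pose proof (trimV_iff d Zd Cd). pose proof (trimE_iff d). split.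
    - intros V d' [<-|Hd']; [tauto|]. apply I1; auto. tauto.
    - intros (d' & [<-|Hd'] & Ed'); [tauto|]. apply H. apply I2. eauto. }
  destruct (L _ _ _ Hv) as [L1 L2].
  { intros d Hd. split; [eapply (proj2 HZ); eauto|eauto]. }
  destruct (classic (trimV v)) as [V|V]; [auto|]. right. intros d Hd E. apply V, L2. eauto.
Qed.

(** The retraction that collapses every dart outside [trim] carries a homotopy of Z into [trim] and
    fixes its two paths. By [trim_face_all] the boundary of a 2-cell is either kept whole or
    collapsed. *)
Lemma trim_homotopy u v p q : path_in trim u p v -> path_in trim u q v ->
  homotopic Z u v p q -> homotopic trim u v p q.
Proof.
  intros Hp Hq H.
  assert (Ht : is_subcomplex X trim) by apply trim_sub.
  assert (Fix : forall u v p, path_in trim u p v -> flat_map trim_dart p = p).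
  { clear. intros u v p (_ & _ & H). induction p as [|d p IH]; simpl; [reflexivity|].
    rewrite IH by (intros; apply H; simpl; auto). unfold trim_dart.
    destruct (dec _) as [E|E]; [reflexivity|]. exfalso. apply E, (H d). simpl; auto. }
  assert (E : homotopic trim (hang u) (hang v) (flat_map trim_dart p) (flat_map trim_dart q)).
  { apply (transport_homotopy Z trim hang trim_dart HZ Ht); auto.
    - intros w Hw. simpl. unfold hang. destruct (dec _); auto.
      destruct (dec _) as [E|E].
      + destruct (constructive_indefinite_description _ E) as [d Hd]; simpl.
        now apply attached_cut in Hd.
      + now apply trim_above.
    - intros d Hd. unfold trim_dart. destruct (dec _) as [E|E].
      + destruct (sV_dsrc trim d Ht E). rewrite !hang_trim by auto. now apply path_in_single.
      + rewrite hang_outside by auto. apply path_in_nil. simpl. unfold hang.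
        destruct (dec _); auto. destruct (dec _) as [E'|E'].
        * destruct (constructive_indefinite_description _ E') as [d' Hd']; simpl.
          now apply attached_cut in Hd'.
        * now apply trim_above.
    - intros d Hd. unfold trim_dart. simpl. destruct (dec _) as [E|E]; [|apply rst_refl].
      destruct (sV_dsrc trim d Ht E). rewrite hang_trim by auto.
      apply (homotopic_cancel trim (dsrc d) (dtgt d) [d]); auto. now apply path_in_single.
    - intros f w Hf Hw. destruct (trim_face_all f Hf) as [Hall|Hnone].
      + assert (Hf' : sF trim f) by (split; auto).
        assert (Hb := fbnd_path_in trim f w Ht Hf' Hw).
        rewrite (Fix w w) by auto. rewrite hang_trim by apply Hb. now apply homotopic_fbnd.
      + replace (flat_map trim_dart (fbnd X f)) with (@nil (dart X)); [apply rst_refl|].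
        symmetry. clear Hw Hf. induction (fbnd X f) as [|d l IH]; simpl; [reflexivity|].
        rewrite IH by (intros; apply Hnone; simpl; auto). unfold trim_dart.
        destruct (dec _) as [E|E]; [|reflexivity]. exfalso. apply (Hnone d); simpl; auto. }
  rewrite (Fix _ _ _ Hp), (Fix _ _ _ Hq), !hang_trim in E; auto.
  - apply (path_in_end _ _ _ _ Ht Hp).
  - apply Hp.
Qed.

End Arcs.

(** * Collapsing free faces *)

Section Collapse.
Context {X : complex} (Z : subcx X) (cut : edg X -> Prop).
Hypothesis HZ : is_subcomplex X Z.
Hypothesis cut_trav : forall e, cut e -> sE Z e -> exists t, traverses Z e t.
Hypothesis cut_uniq : forall e t t', cut e -> traverses Z e t -> traverses Z e t' -> t = t'.
Hypothesis cut_face : forall e e' f i i', cut e -> cut e' ->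
  traverses Z e (f, i) -> traverses Z e' (f, i') -> i = i'.

Definition collapse : subcx X := Subcx X (sV Z) (fun e => sE Z e /\ ~ cut e)
  (fun f => sF Z f /\ forall d, In d (fbnd X f) -> ~ cut (fst d)).

Lemma collapse_sub : is_subcomplex X collapse.
Proof.
  split; simpl.
  - intros e [He _]. now apply HZ.
  - intros f [Hf Hc] d Hd. split; auto. eapply HZ; eauto.
Qed.

Lemma collapse_le : subcx_le X collapse Z.
Proof. repeat split; simpl; tauto. Qed.

(** The rest of the boundary of a 2-cell through [d], read from the source of [d] to its target; the
    two cases are the two directions of traversal. *)
Definition detour (d : dart X) (c : list (dart X)) : Prop :=
  exists f l1 l2, sF Z f /\
    ((fbnd X f = l1 ++ d :: l2 /\ c = pinv (l2 ++ l1)) \/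
     (fbnd X f = l1 ++ dinv d :: l2 /\ c = l2 ++ l1)).

Lemma split_traverses f l1 d l2 : sF Z f -> fbnd X f = l1 ++ d :: l2 ->
  traverses Z (fst d) (f, length l1).
Proof.
  intros Hf E. split; auto. exists d. cbn [fst snd]. split; auto. rewrite E.
  rewrite nth_error_app2, Nat.sub_diag by lia. reflexivity.
Qed.

Lemma split_unique (l1 l2 l1' l2' : list (dart X)) d d' :
  l1 ++ d :: l2 = l1' ++ d' :: l2' -> length l1 = length l1' -> l1 = l1' /\ d = d' /\ l2 = l2'.
Proof.
  revert l1'. induction l1 as [|x l1 IH]; intros [|x' l1']; simpl; intros E H; try lia.
  - injection E as -> ->. auto.
  - injection E as -> E. injection H as H. destruct (IH _ E H) as (-> & -> & ->); auto.
Qed.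

Lemma detour_unique d c c' : cut (fst d) -> detour d c -> detour d c' -> c = c'.
Proof.
  intros Hc (f & l1 & l2 & Hf & H) (f' & l1' & l2' & Hf' & H').
  assert (U : forall x x', fbnd X f = l1 ++ x :: l2 -> fbnd X f' = l1' ++ x' :: l2' ->
    fst x = fst d -> fst x' = fst d -> x = x' /\ l1 = l1' /\ l2 = l2').
  { intros x x' E E' Ex Ex'.
    pose proof (split_traverses _ _ _ _ Hf E) as T. pose proof (split_traverses _ _ _ _ Hf' E') as T'.
    rewrite Ex in T. rewrite Ex' in T'. pose proof (cut_uniq _ _ _ Hc T T') as Q.
    injection Q as <- Q. rewrite E in E'. destruct (split_unique _ _ _ _ _ _ E' Q) as (-> & -> & ->).
    auto. }
  destruct H as [[E ->]|[E ->]], H' as [[E' ->]|[E' ->]];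
    destruct (U _ _ E E' eq_refl eq_refl) as (Q & -> & ->); auto.
  - exfalso. symmetry in Q. now apply dinv_neq in Q.
  - exfalso. now apply dinv_neq in Q.
Qed.

Lemma detour_exists d : sE Z (fst d) -> cut (fst d) -> exists c, detour d c.
Proof.
  intros Hd Hc. destruct (cut_trav _ Hc Hd) as ((f & i) & Hf & x & Hx & Ex). cbn [fst snd] in *.
  destruct (nth_error_split _ _ Hx) as (l1 & l2 & E & _).
  assert (x = d \/ x = dinv d) as [->| ->].
  { destruct x as [e b], d as [e' b']. simpl in Ex. subst. unfold dinv; simpl.
    destruct b, b'; auto. }
  - exists (pinv (l2 ++ l1)), f, l1, l2. auto.
  - exists (l2 ++ l1), f, l1, l2. auto.
Qed.

Lemma detour_inv d c : detour d c -> detour (dinv d) (pinv c).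
Proof.
  intros (f & l1 & l2 & Hf & [[E ->]|[E ->]]); exists f, l1, l2; split; auto.
  - right. now rewrite dinvK, pinvK.
Qed.

(** All cut edges disappear simultaneously, so a detour has to avoid every one of them; [cut_face]
    allows a boundary path to run over cut edges only once. *)
Lemma detour_path d c : cut (fst d) -> detour d c -> path_in collapse (dsrc d) c (dtgt d).
Proof.
  assert (M : forall d f l1 l2, cut (fst d) -> sF Z f -> fbnd X f = l1 ++ d :: l2 ->
    path_in collapse (dtgt d) (l2 ++ l1) (dsrc d)).
  { clear d c. intros d f l1 l2 Hc Hf E. destruct (fbnd_loop f) as [v Hv].
    rewrite E in Hv. apply path_ok_app in Hv. destruct Hv as (w & H1 & H2).
    rewrite path_ok_cons in H2. destruct H2 as [<- H2].
    assert (Zd : sE Z (fst d)) by (eapply (proj2 HZ f Hf); rewrite E; apply in_or_app; simpl; auto).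
    split; [apply (sV_dsrc Z d HZ Zd)|]. split; [apply path_ok_app; eauto|].
    intros x Hx. assert (Hx' : In x (fbnd X f)).
    { rewrite E. apply in_app_or in Hx. apply in_or_app; simpl; tauto. }
    split; [eapply (proj2 HZ); eauto|]. intros Hcx.
    assert (T := split_traverses _ _ _ _ Hf E).
    apply in_app_or in Hx. destruct Hx as [Hx|Hx]; apply in_split in Hx; destruct Hx as (a & b & Eab).
    - assert (E2 : fbnd X f = (l1 ++ d :: a) ++ x :: b) by (rewrite E, Eab, <- app_assoc; reflexivity).
      assert (T2 := split_traverses _ _ _ _ Hf E2).
      pose proof (cut_face _ _ _ _ _ Hc Hcx T T2) as Q. rewrite length_app in Q. simpl in Q. lia.
    - assert (E2 : fbnd X f = a ++ x :: (b ++ d :: l2)) by (rewrite E, Eab, <- app_assoc; reflexivity).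
      assert (T2 := split_traverses _ _ _ _ Hf E2).
      pose proof (cut_face _ _ _ _ _ Hc Hcx T T2) as Q. rewrite Eab, length_app in Q. simpl in Q. lia. }
  intros Hc (f & l1 & l2 & Hf & [[E ->]|[E ->]]).
  - apply path_in_pinv; [apply collapse_sub|]. eapply M; eauto.
  - rewrite <- (dtgt_dinv d), <- (dsrc_dinv d). eapply M; eauto.
Qed.

Definition detour_dart (d : dart X) : list (dart X) :=
  if dec (cut (fst d)) then epsilon (inhabits []) (detour d) else [d].

Lemma detour_dart_spec d : sE Z (fst d) -> cut (fst d) -> detour d (detour_dart d).
Proof.
  intros H Hc. unfold detour_dart. destruct (dec _); [|tauto]. apply epsilon_spec.
  now apply detour_exists.
Qed.

Lemma detour_dart_path d : sE Z (fst d) -> path_in collapse (dsrc d) (detour_dart d) (dtgt d).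
Proof.
  intros Hd. destruct (classic (cut (fst d))) as [Hc|Hc].
  - apply detour_path; auto. now apply detour_dart_spec.
  - unfold detour_dart. destruct (dec _); [tauto|]. apply path_in_single; [apply collapse_sub|].
    split; auto.
Qed.

Lemma detour_fix l : (forall d, In d l -> ~ cut (fst d)) -> flat_map detour_dart l = l.
Proof.
  induction l as [|d l IH]; intros H; simpl; [reflexivity|].
  rewrite IH by (intros; apply H; simpl; auto). unfold detour_dart.
  destruct (dec _) as [E|E]; [|reflexivity]. exfalso. apply (H d); simpl; auto.
Qed.

(** Replacing cut darts by detours carries homotopies of Z into [collapse] and fixes paths that
    avoid the cut edges. The boundary of a removed 2-cell turns into a backtracking word. *)
Lemma collapse_homotopy u v p q : path_in collapse u p v -> path_in collapse u q v ->
  homotopic Z u v p q -> homotopic collapse u v p q.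
Proof.
  intros Hp Hq H. assert (HC := collapse_sub).
  assert (Fix : forall u v p, path_in collapse u p v -> flat_map detour_dart p = p).
  { intros ? ? p1 Hp1. apply detour_fix. intros d Hd. now apply Hp1. }
  rewrite <- (Fix _ _ _ Hp), <- (Fix _ _ _ Hq).
  apply (transport_homotopy Z collapse (fun v => v) detour_dart HZ HC); auto.
  - apply detour_dart_path.
  - intros d Hd. destruct (classic (cut (fst d))) as [Hc|Hc].
    + rewrite (detour_unique (dinv d) (detour_dart (dinv d)) (pinv (detour_dart d))); auto.
      * eapply homotopic_cancel; auto. now apply detour_dart_path.
      * now apply detour_dart_spec.
      * apply detour_inv. now apply detour_dart_spec.
    + unfold detour_dart. simpl. destruct (dec _); [tauto|].
      eapply (homotopic_cancel collapse _ _ [d]); auto. apply path_in_single; auto. split; auto.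
  - intros f w Hf Hw. destruct (classic (exists d, In d (fbnd X f) /\ cut (fst d))) as [(d & Hd & Hc)|Hn].
    + assert (exists l1 l2 : list (dart X), fbnd X f = l1 ++ d :: l2) as (l1 & l2 & E)
        by now apply in_split. clear Hd.
      assert (Hd : detour d (pinv (l2 ++ l1))) by (exists f, l1, l2; auto).
      assert (Zd : sE Z (fst d)) by (eapply (proj2 HZ f Hf); rewrite E; apply in_or_app; simpl; auto).
      assert (Hd2 := detour_path d _ Hc Hd). apply path_in_pinv in Hd2; auto. rewrite pinvK in Hd2.
      (* A boundary [l1 ++ d :: l2] becomes [l1], then the inverse of [l2 ++ l1], then [l2], which
         cancels freely. *)
      match goal with |- homotopic _ _ _ ?x _ => replace x with (l1 ++ pinv (l2 ++ l1) ++ l2) end.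
      2:{ rewrite E, flat_map_app. simpl. symmetry.
          apply f_equal2; [|apply f_equal2].
          - apply detour_fix. intros x Hx. apply Hd2, in_or_app; auto.
          - apply (detour_unique d); auto using detour_dart_spec.
          - apply detour_fix. intros x Hx. apply Hd2, in_or_app; auto. }
      rewrite pinv_app.
      rewrite E in Hw. apply path_ok_app in Hw. destruct Hw as (z & H1 & H2).
      rewrite path_ok_cons in H2. destruct H2 as [<- H2].
      apply path_in_app in Hd2; auto. destruct Hd2 as (z & H3 & H4).
      assert (z = w) by (eapply path_ok_fun; [apply H3|exact H2]). subst z.
      rewrite <- app_assoc, app_assoc.
      eapply rst_trans; [eapply homotopic_app_r; [auto|apply H4| |eapply homotopic_cancel; eauto]|].
      * apply path_in_app; auto. exists (dtgt d). split; [|exact H3]. now apply path_in_pinv.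
      * simpl. eapply homotopic_cancel'; eauto.
    + assert (Hf' : sF collapse f) by (split; auto; intros d Hd Hc; eauto).
      rewrite detour_fix; [|intros d Hd; now apply Hf']. now apply homotopic_fbnd.
Qed.

End Collapse.

Section Reduction.
Context {G : group} {X : complex} (A : action G X) (Y : subcx X) (y0 : vtx X).
Hypothesis HY : is_subcomplex X Y.
Hypothesis Hy0 : sV Y y0.
Hypothesis IY : inv_sub A Y.

Record admissible (Z : subcx X) : Prop := Admissible {
  adm_sub : is_subcomplex X Z;
  adm_above : subcx_le X Y Z;
  adm_inv : inv_sub A Z;
  adm_cof : cofin_sub A Z;
  adm_reach : reach Y Z;
  adm_triv : rel_trivial Y Z
}.

(** Injectivity of the inclusion of Z' in Z on fundamental groupoids. *)
Definition keeps_homotopy (Z Z' : subcx X) : Prop := forall u v p q,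
  path_in Z' u p v -> path_in Z' u q v -> homotopic Z u v p q -> homotopic Z' u v p q.

Lemma rel_trivial_keep Z Z' : subcx_le X Z' Z -> subcx_le X Y Z' -> keeps_homotopy Z Z' ->
  rel_trivial Y Z -> rel_trivial Y Z'.
Proof.
  intros H1 H2 HK PZ u v p Hu Hv Hp.
  destruct (PZ u v p Hu Hv) as (q & Hq & H); [eapply path_in_mono; eauto|].
  exists q. split; auto. apply HK; auto. eapply path_in_mono; eauto.
Qed.

Lemma cofin_sub_le Z Z' : subcx_le X Z' Z -> cofin_sub A Z -> cofin_sub A Z'.
Proof.
  intros (H1 & H2 & H3) (C1 & C2 & C3). split; [|split].
  - apply (@cofinite_sub G (gV A) (sV Z)); auto.
  - apply (@cofinite_sub G (gE A) (sE Z)); auto.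
  - apply (@cofinite_sub G (gF A) (sF Z)); auto.
Qed.

Lemma subcx_le_trans (B C D : subcx X) : subcx_le X B C -> subcx_le X C D -> subcx_le X B D.
Proof. intros (H1 & H2 & H3) (H1' & H2' & H3'). split; [|split]; auto. Qed.

Lemma subcx_le_refl (B : subcx X) : subcx_le X B B.
Proof. split; [|split]; auto. Qed.

Lemma traverses_act Z h e t : inv_sub A Z -> traverses Z e t ->
  traverses Z (ae A h e) (cact A h t).
Proof.
  intros (_ & _ & IF) (Hf & d & Hd & <-). split; [now apply IF|].
  exists (dmap A h d). split; [|reflexivity]. unfold cact; cbn [fst snd]. rewrite fbnd_af.
  exact (map_nth_error (dmap A h) _ _ Hd).
Qed.

(** Induction on the number of representatives of edge orbits; each step removes the orbit of an
    edge outside Y with at most one traversal, which is a free face (collapse) or lies in no 2-cell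
    (trim). Reduced subcomplexes [B] contain no such edge and therefore survive; this clause is what
    makes merging possible. *)
Theorem reduction n : forall Z Le, admissible Z ->
  (forall e, sE Z e -> exists h y, In y Le /\ e = ae A h y) -> (length Le <= n)%nat ->
  exists Z', admissible Z' /\ subcx_le X Z' Z /\ reduced Y Z' /\
    (forall B, is_subcomplex X B -> subcx_le X B Z -> reach Y B -> reduced Y B -> subcx_le X B Z') /\
    keeps_homotopy Z Z'.
Proof.
  induction n as [n IH] using lt_wf_ind. intros Z Le HA HLe Hn.
  destruct (classic (reduced Y Z)) as [Hred|Hred].
  { exists Z. split; auto. split; [apply subcx_le_refl|]. split; auto. split; auto.
    intros u v p q _ _ H; exact H. }
  assert (exists e0, sE Z e0 /\ ~ sE Y e0 /\
     forall t t', traverses Z e0 t -> traverses Z e0 t' -> t = t') as (e0 & Ze0 & Ye0 & Uq).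
  { apply NNPP. intros Hno. apply Hred. intros e He HYe. apply NNPP. intros Hno2.
    apply Hno. exists e. split; auto. split; auto. intros t t' Ht Ht'.
    apply NNPP. intros Hneq. apply Hno2. exists t, t'. auto. }
  destruct HA as [HZ HYZ IZ CZ RZ PZ].
  set (cut := fun e => exists h, e = ae A h e0).
  assert (cut_inv : forall h e, cut e -> cut (ae A h e)).
  { intros h e [k ->]. exists (gmul G h k). now rewrite aeM. }
  assert (cut_inv' : forall h e, cut (ae A h e) -> cut e).
  { intros h e Hc. apply (cut_inv (ginv G h)) in Hc. now rewrite aeV in Hc. }
  assert (cutY : forall e, sE Y e -> ~ cut e).
  { intros e He [h ->]. apply Ye0. rewrite <- (aeV A h e0). now apply IY. }
  assert (cut_trv : forall h t, traverses Z (ae A h e0) t -> traverses Z e0 (cact A (ginv G h) t)).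
  { intros h t Ht. rewrite <- (aeV A h e0). now apply traverses_act. }
  assert (cut_uniq : forall e t t', cut e -> traverses Z e t -> traverses Z e t' -> t = t').
  { intros e t t' [h ->] Ht Ht'. apply cut_trv in Ht, Ht'. pose proof (Uq _ _ Ht Ht') as E.
    apply (f_equal (cact A h)) in E.
    pose proof (@gaVr G (gC A) h t) as E1. pose proof (@gaVr G (gC A) h t') as E2. simpl in E1, E2.
    congruence. }
  assert (Bcut : forall B, subcx_le X B Z -> reduced Y B -> forall e, sE B e -> ~ cut e).
  { intros B HB RB e He Hc. destruct (RB e He) as (t & t' & Hneq & Ht & Ht').
    - intros HYe. now apply (cutY e).
    - apply Hneq. apply (cut_uniq e); auto.
      + destruct Ht as [Hf Hd]. split; auto. now apply HB.
      + destruct Ht' as [Hf Hd]. split; auto. now apply HB. }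
  assert (Step : forall Z1, is_subcomplex X Z1 -> subcx_le X Y Z1 -> subcx_le X Z1 Z -> inv_sub A Z1 ->
     reach Y Z1 -> keeps_homotopy Z Z1 -> (forall e, sE Z1 e -> ~ cut e) ->
     (forall B, is_subcomplex X B -> subcx_le X B Z -> reach Y B -> reduced Y B -> subcx_le X B Z1) ->
     exists Z', admissible Z' /\ subcx_le X Z' Z /\ reduced Y Z' /\
      (forall B, is_subcomplex X B -> subcx_le X B Z -> reach Y B -> reduced Y B -> subcx_le X B Z') /\
      keeps_homotopy Z Z').
  { intros Z1 S1 A1 L1 I1 R1 K1 C1 B1.
    destruct (HLe e0 Ze0) as (h0 & y & Hy & Ey).
    destruct (IH (length (filterP (fun e => ~ cut e) Le))) with (Z := Z1)
      (Le := filterP (fun e => ~ cut e) Le) as (Z' & HA' & L' & R' & B' & K').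
    - eapply Nat.lt_le_trans; [|exact Hn]. apply (filterP_length_lt _ _ y); auto.
      intros H. apply H. apply (cut_inv' h0). rewrite <- Ey. exists (gone G). now rewrite ae1.
    - constructor; auto.
      + eapply cofin_sub_le; eauto.
      + eapply rel_trivial_keep; eauto.
    - intros e He. destruct (HLe e) as (h & y' & Hy' & ->); [now apply L1|].
      exists h, y'. split; auto. apply filterP_In. split; auto. intros Hc.
      apply (C1 _ He). now apply cut_inv.
    - auto.
    - exists Z'. split; auto. split; [eapply subcx_le_trans; eauto|]. split; auto. split.
      + intros B HB HBZ RB redB. apply B'; auto.
      + intros u v p q Hp Hq H. apply K'; auto. apply K1; auto; eapply path_in_mono; eauto. }
  destruct (classic (exists t0, traverses Z e0 t0)) as [[t0 Ht0]|Hnt].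
  - assert (cut_trav : forall e, cut e -> sE Z e -> exists t, traverses Z e t).
    { intros e [h ->] _. exists (cact A h t0). now apply traverses_act. }
    (* The action carries boundary paths to boundary paths index by index, so the index of the
       single traversal is constant along the orbit. *)
    assert (cut_face : forall e e' f i i', cut e -> cut e' ->
       traverses Z e (f, i) -> traverses Z e' (f, i') -> i = i').
    { intros e e' f i i' [h ->] [h' ->] Ht Ht'. apply cut_trv in Ht, Ht'.
      pose proof (Uq _ _ Ht Ht') as E. unfold cact in E. simpl in E. congruence. }
    assert (L1 : subcx_le X (collapse Z cut) Z) by apply collapse_le.
    apply (Step (collapse Z cut)); auto.
    + now apply collapse_sub.
    + destruct HYZ as (H1 & H2 & H3). split; [exact H1|split]; simpl.
      * intros e He. split; auto.
      * intros f Hf. split; auto. intros d Hd. apply cutY. eapply HY; eauto.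
    + destruct IZ as (I1 & I2 & I3). split; [exact I1|split]; simpl.
      * intros h e _ [He Hc]. split; [now apply I2|]. intros Hc'. exact (Hc (cut_inv' h _ Hc')).
      * intros h f _ [Hf Hc]. split; [now apply I3|]. intros d Hd. rewrite fbnd_af in Hd.
        apply in_map_iff in Hd. destruct Hd as (d' & <- & Hd'). intros Hc'.
        apply (Hc d' Hd'). exact (cut_inv' h _ Hc').
    + intros v Hv. destruct (RZ v Hv) as (y & p & Hy & Hp). exists y, (flat_map (detour_dart Z cut) p).
      split; auto. apply (transport_path Z (collapse Z cut) (fun v => v) (detour_dart Z cut)); auto.
      * now apply collapse_sub.
      * intros d Hd. now apply detour_dart_path.
    + intros u v p q Hp Hq H. now apply collapse_homotopy.
    + simpl. tauto.
    + intros B HB HBZ RB redB. assert (Bc := Bcut B HBZ redB). destruct HBZ as (H1 & H2 & H3).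
      split; [exact H1|split]; simpl; [intros e He; split; auto|].
      intros f Hf. split; auto. intros d Hd. apply Bc. eapply HB; eauto.
  - assert (cutF : forall f, sF Z f -> forall d, In d (fbnd X f) -> ~ cut (fst d)).
    { intros f Hf d Hd [h E]. apply In_nth_error in Hd. destruct Hd as [i Hi].
      apply Hnt. exists (cact A (ginv G h) (f, i)). apply cut_trv. split; auto.
      exists d. split; auto. }
    apply (Step (trim Y Z cut)).
    + now apply trim_sub.
    + now apply trim_above.
    + now apply trim_le.
    + assert (IV : forall h x, trimV Y Z cut x -> trimV Y Z cut (av A h x)).
      { intros h x (y & p & Hy & Hp & Hin). exists (av A h y), (pmap A h p). split; [now apply IY|].
        split; [now apply path_in_pmap|]. intros d Hd. apply in_map_iff in Hd.
        destruct Hd as (d' & <- & Hd'). intros Hc. apply (Hin d' Hd'). exact (cut_inv' h _ Hc). }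
      assert (IE : forall h e, trimE Y Z cut e -> trimE Y Z cut (ae A h e)).
      { intros h e (H1 & H2 & H3). split; [now apply IZ|]. split.
        - intros Hc. apply H2. exact (cut_inv' h _ Hc).
        - rewrite ae_src. auto. }
      split; [intros h x _; apply IV|split; [intros h e _; apply IE|]].
      intros h f _ [Hf Hd]. split; [now apply IZ|]. intros d Hd'. rewrite fbnd_af in Hd'.
      apply in_map_iff in Hd'. destruct Hd' as (d' & <- & Hd'). apply IE. auto.
    + now apply trim_reach.
    + intros u v p q Hp Hq H. now apply (trim_homotopy Y Z cut y0).
    + simpl. intros e (_ & H & _). exact H.
    + intros B HB HBZ RB redB. apply trim_contains; auto. now apply Bcut.
Qed.

End Reduction.

(** * Immersed complexes over X generated by Y and finitely many pointed 2-cells *)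

Lemma app_eq_prefix {T} (l1 l2 l1' l2' : list T) :
  l1 ++ l2 = l1' ++ l2' -> length l1 = length l1' -> l1 = l1'.
Proof.
  revert l1'. induction l1 as [|x l1 IH]; intros [|x' l1']; simpl; intros E H; try lia; auto.
  injection E as -> E. f_equal. auto.
Qed.

Section Words.
Context {G : group} {X : complex} (A : action G X) (Y : subcx X).
Hypothesis HY : is_subcomplex X Y.
Hypothesis IY : inv_sub A Y.

(* A word (y, p) is a path p of X starting at the vertex y of Y. *)
Definition word := (vtx X * list (dart X))%type.
(* A 2-cell together with a path leading to the base point of its boundary. *)
Definition pface := (vtx X * list (dart X) * fc X)%type.

Definition ends (w : word) (v : vtx X) : Prop := sV Y (fst w) /\ path_ok (fst w) (snd w) v.
Definition wapp (w : word) (p : list (dart X)) : word := (fst w, snd w ++ p).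
Definition wact (h : G) (w : word) : word := (av A h (fst w), pmap A h (snd w)).

(** A listed 2-cell acts only behind its own path [g] or a translate of it, so [L] contributes
    finitely many orbits of 2-cells. Absorbing a path of Y moves the starting vertex, which makes
    words starting at different vertices of Y comparable. *)
Inductive wstep (L : list pface) : word -> word -> Prop :=
| ws_cancel y a d b : path_ok y a (dsrc d) -> wstep L (y, a ++ d :: dinv d :: b) (y, a ++ b)
| ws_base y q y' p : path_in Y y q y' -> wstep L (y, q ++ p) (y', p)
| ws_face h y g f b v : In (y, g, f) L -> path_ok y g v -> path_ok v (fbnd X f) v ->
    wstep L (av A h y, pmap A h (g ++ fbnd X f) ++ b) (av A h y, pmap A h g ++ b).

Definition weq (L : list pface) : relation word := clos_refl_sym_trans _ (wstep L).

Lemma wapp_nil w : wapp w [] = w.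
Proof. destruct w; unfold wapp; simpl. now rewrite app_nil_r. Qed.

Lemma wapp_app w p q : wapp (wapp w p) q = wapp w (p ++ q).
Proof. unfold wapp; simpl. now rewrite app_assoc. Qed.

Lemma wact_wapp h w p : wact h (wapp w p) = wapp (wact h w) (pmap A h p).
Proof. unfold wact, wapp; simpl. now rewrite pmap_app. Qed.

Lemma ends_fun w v v' : ends w v -> ends w v' -> v = v'.
Proof. intros [_ H] [_ H']. eauto using path_ok_fun. Qed.

Lemma ends_wapp w p v v' : ends w v -> (ends (wapp w p) v' <-> path_ok v p v').
Proof.
  intros [H1 H2]. unfold ends, wapp; simpl. rewrite path_ok_app. split.
  - intros (_ & z & H3 & H4). now rewrite (path_ok_fun _ _ _ _ H2 H3).
  - eauto.
Qed.

Lemma ends_wact h w v : ends w v -> ends (wact h w) (av A h v).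
Proof. intros [H1 H2]. split; simpl; [now apply IY|now apply path_ok_pmap]. Qed.

Lemma wstep_ends L w w' v : wstep L w w' -> (ends w v <-> ends w' v).
Proof.
  intros [y a d b H|y q y' p H|h y g f b x _ H1 H2]; unfold ends; simpl.
  - rewrite !path_ok_app. split; intros (Hy & z & Hz & Hb); split; auto; exists z; split; auto.
    + rewrite !path_ok_cons, dtgt_dinv in Hb. destruct Hb as (<- & _ & Hb). auto.
    + assert (z = dsrc d) by eauto using path_ok_fun. subst z.
      rewrite !path_ok_cons, dtgt_dinv, dsrc_dinv. auto.
  - rewrite path_ok_app. assert (Hy' := path_in_end _ _ _ _ HY H). destruct H as (Hy & Hq & _). split.
    + intros (_ & z & Hz & Hp). split; auto. now rewrite (path_ok_fun _ _ _ _ Hq Hz).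
    + intros (_ & Hp). eauto.
  - rewrite pmap_app, <- app_assoc, !path_ok_app.
    apply (path_ok_pmap A h) in H1. apply (path_ok_pmap A h) in H2. split.
    + intros (Hy & z & Hz & Hb). split; auto. exists z. split; auto.
      apply path_ok_app in Hb. destruct Hb as (z' & H3 & H4).
      assert (z = av A h x) by eauto using path_ok_fun. subst z.
      now rewrite (path_ok_fun _ _ _ _ H2 H3).
    + intros (Hy & z & Hz & Hb). split; auto. exists z. split; auto.
      assert (z = av A h x) by eauto using path_ok_fun. subst z. apply path_ok_app. eauto.
Qed.

Lemma weq_ends L w w' v : weq L w w' -> (ends w v <-> ends w' v).
Proof. induction 1; try tauto. now apply wstep_ends with L. Qed.

Lemma weq_wapp L w w' p : weq L w w' -> weq L (wapp w p) (wapp w' p).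
Proof.
  induction 1; [|apply rst_refl|now apply rst_sym|eapply rst_trans; eauto].
  apply rst_step. destruct H as [y a d b H|y q y' q' H|h y g f b x H H1 H2]; unfold wapp; simpl.
  - rewrite <- !app_assoc. simpl. now apply ws_cancel.
  - rewrite <- app_assoc. now apply ws_base.
  - rewrite <- !app_assoc. eapply ws_face; eauto.
Qed.

Lemma weq_wact L h w w' : weq L w w' -> weq L (wact h w) (wact h w').
Proof.
  induction 1; [|apply rst_refl|now apply rst_sym|eapply rst_trans; eauto].
  apply rst_step. destruct H as [y a d b H|y q y' q' H|k y g f b x H H1 H2]; unfold wact; simpl.
  - rewrite !pmap_app. simpl. apply ws_cancel. rewrite dsrc_dmap. now apply path_ok_pmap.
  - rewrite !pmap_app. apply ws_base. now apply path_in_pmap.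
  - rewrite (pmap_app _ _ (pmap A k (g ++ fbnd X f))), (pmap_app _ _ (pmap A k g)).
    rewrite <- !pmapM, <- avM. eapply ws_face; eauto.
Qed.

Lemma weq_mono L L' w w' : incl L L' -> weq L w w' -> weq L' w w'.
Proof.
  intros HL. induction 1; [|apply rst_refl|now apply rst_sym|eapply rst_trans; eauto].
  apply rst_step. destruct H; [now apply ws_cancel|now apply ws_base|eapply ws_face; eauto].
Qed.

Lemma weq_cancel L w d v : ends w v -> dsrc d = v -> weq L (wapp w [d; dinv d]) w.
Proof.
  intros [H1 H2] <-. apply rst_step. destruct w as [y p]; unfold wapp; simpl in *.
  pose proof (ws_cancel L y p d [] H2) as E. now rewrite app_nil_r in E.
Qed.

(** Classes are kept as predicates, so that extensionality turns equivalence of words into equality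
    of vertices. *)
Definition uV L : Type := {c : word -> Prop | exists w v, ends w v /\ c = weq L w}.

Definition repr {L} (v : uV L) (w : word) : Prop := proj1_sig v w.

Lemma repr_ex {L} (v : uV L) : exists w, repr v w.
Proof. destruct v as (c & w & x & H & ->). exists w. apply rst_refl. Qed.

Lemma repr_weq {L} (v : uV L) w w' : repr v w -> (repr v w' <-> weq L w w').
Proof.
  destruct v as (c & w0 & x & H & ->). unfold repr; simpl. intros H1. split; intros H2.
  - eapply rst_trans; [apply rst_sym; eauto|auto].
  - eapply rst_trans; eauto.
Qed.

Lemma repr_ends {L} (v : uV L) w : repr v w -> exists x, ends w x.
Proof.
  destruct v as (c & w0 & x & H & ->). unfold repr; simpl. intros H1. exists x.
  now apply (weq_ends L w0 w).
Qed.

Lemma repr_inj {L} (v v' : uV L) w : repr v w -> repr v' w -> v = v'.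
Proof.
  intros H H'. apply eq_sig_hprop; [intros; apply proof_irrelevance|].
  apply functional_extensionality. intros w'. apply propositional_extensionality.
  change (repr v w' <-> repr v' w'). rewrite (repr_weq v w), (repr_weq v' w) by auto. tauto.
Qed.

Lemma repr_mk L w x : ends w x -> exists v : uV L, repr v w.
Proof.
  intros H. exists (exist _ (weq L w) (ex_intro _ w (ex_intro _ x (conj H eq_refl)))). apply rst_refl.
Qed.

(** All words of a class end at one vertex, which [epsilon] recovers; the default is the start of
    some representative. *)
Definition upr {L} (v : uV L) : vtx X :=
  epsilon (inhabits (fst (proj1_sig (constructive_indefinite_description _ (repr_ex v)))))
    (fun x => exists w, repr v w /\ ends w x).

Lemma upr_ends {L} (v : uV L) w : repr v w -> ends w (upr v).
Proof.
  intros Hw. unfold upr.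
  match goal with |- ends w (epsilon ?i ?P) =>
    assert (H : P (epsilon i P)) by
      (apply epsilon_spec; destruct (repr_ends v w Hw) as [x Hx]; exists x, w; auto) end.
  destruct H as (w' & Hw' & H). apply (repr_weq v w w' Hw) in Hw'. now apply (weq_ends L w w' _ Hw').
Qed.

Lemma upr_eq {L} (v : uV L) w x : repr v w -> ends w x -> upr v = x.
Proof. intros H1 H2. eapply ends_fun; eauto using upr_ends. Qed.

(** Determined by the source class and the edge below, so folding of outgoing edges is built into
    the encoding; [udart_unique] extends it to reversed ones. *)
Definition uE L : Type := {ve : uV L * edg X | upr (fst ve) = esrc X (snd ve)}.
Definition usrc {L} (e : uE L) : uV L := fst (proj1_sig e).
Definition ue {L} (e : uE L) : edg X := snd (proj1_sig e).

Lemma uext_ex {L} (v : uV L) p : (exists x, path_ok (upr v) p x) ->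
  exists v' : uV L, forall w, repr v w -> repr v' (wapp w p).
Proof.
  intros [x Hp]. destruct (repr_ex v) as [w Hw]. assert (E := upr_ends v w Hw).
  destruct (repr_mk L (wapp w p) x) as [v' Hv']; [now apply (ends_wapp w p (upr v))|].
  exists v'. intros w' Hw'. apply (repr_weq v' (wapp w p)); auto. apply weq_wapp.
  now apply (repr_weq v w w').
Qed.

Lemma utgt_ex {L} (e : uE L) :
  exists v' : uV L, forall w, repr (usrc e) w -> repr v' (wapp w [(ue e, true)]).
Proof.
  apply uext_ex. destruct e as [[v e] H]; unfold usrc, ue; simpl in *.
  exists (etgt X e). split; [symmetry; exact H|reflexivity].
Qed.

Definition utgt {L} (e : uE L) : uV L := proj1_sig (constructive_indefinite_description _ (utgt_ex e)).

Lemma utgt_spec {L} (e : uE L) w : repr (usrc e) w -> repr (utgt e) (wapp w [(ue e, true)]).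
Proof. unfold utgt. destruct (constructive_indefinite_description _ _); auto. Qed.

Lemma upr_usrc {L} (e : uE L) : upr (usrc e) = esrc X (ue e).
Proof. destruct e as [[v e] H]; exact H. Qed.

Lemma upr_utgt {L} (e : uE L) : upr (utgt e) = etgt X (ue e).
Proof.
  destruct (repr_ex (usrc e)) as [w Hw]. apply (upr_eq _ _ _ (utgt_spec e w Hw)).
  apply (ends_wapp w _ (upr (usrc e))); [now apply upr_ends|]. rewrite upr_usrc. split; reflexivity.
Qed.

Lemma uE_ext {L} (e e' : uE L) : usrc e = usrc e' -> ue e = ue e' -> e = e'.
Proof.
  intros H1 H2. apply eq_sig_hprop; [intros; apply proof_irrelevance|].
  destruct e as [[v e] H], e' as [[v' e'] H']; unfold usrc, ue in *; simpl in *. congruence.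
Qed.

Notation udart L := (uE L * bool)%type.
Definition upd {L} (d : udart L) : dart X := (ue (fst d), snd d).
Definition uds {L} : udart L -> uV L := dsrc' (uV L) (uE L) usrc utgt.
Definition udt {L} : udart L -> uV L := dtgt' (uV L) (uE L) usrc utgt.
Definition upath {L} := path_ok' (uV L) (uE L) usrc utgt.

Lemma upr_uds {L} (d : udart L) : upr (uds d) = dsrc (upd d).
Proof. destruct d as [e []]; [apply upr_usrc|apply upr_utgt]. Qed.

Lemma upr_udt {L} (d : udart L) : upr (udt d) = dtgt (upd d).
Proof. destruct d as [e []]; [apply upr_utgt|apply upr_usrc]. Qed.

Lemma udart_repr {L} (d : udart L) w : repr (uds d) w -> repr (udt d) (wapp w [upd d]).
Proof.
  destruct d as [e []]; [apply utgt_spec|]. unfold uds, udt, dsrc', dtgt', upd; simpl. intros Hw.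
  destruct (repr_ex (usrc e)) as [w0 Hw0]. assert (H := utgt_spec e w0 Hw0).
  apply (repr_weq _ _ _ H) in Hw. apply (repr_weq _ _ _ Hw0).
  apply (weq_wapp L _ _ [(ue e, false)]) in Hw. rewrite wapp_app in Hw.
  eapply rst_trans; [|exact Hw]. apply rst_sym.
  apply (weq_cancel L w0 (ue e, true) (upr (usrc e))); [now apply upr_ends|].
  symmetry; apply upr_usrc.
Qed.

(** With [udart_unique] this makes U -> X a covering on 1-skeleta, so paths lift uniquely from every
    vertex. Hence U need not be cocompact and is cut down to balls later. *)
Lemma udart_lift {L} (v : uV L) d : dsrc d = upr v -> exists d' : udart L, upd d' = d /\ uds d' = v.
Proof.
  destruct d as [e []]; intros H.
  - exists (exist _ (v, e) (eq_sym H), true). split; reflexivity.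
  - destruct (uext_ex v [(e, false)]) as [v' Hv'].
    { exists (esrc X e). split; [exact H|reflexivity]. }
    destruct (repr_ex v) as [w Hw]. assert (Ew := upr_ends v w Hw).
    assert (E : upr v' = esrc X e).
    { apply (upr_eq _ _ _ (Hv' w Hw)). apply (ends_wapp w _ (upr v)); auto. split; [exact H|reflexivity]. }
    set (e' := exist (fun ve => upr (fst ve) = esrc X (snd ve)) (v', e) E : uE L).
    exists (e', false). split; [reflexivity|]. unfold uds, dsrc'; simpl.
    apply (repr_inj _ _ w); auto. pose proof (utgt_spec e' _ (Hv' w Hw)) as Q. rewrite wapp_app in Q.
    apply (repr_weq _ _ _ Q). apply (weq_cancel L w (e, false) (upr v)); auto.
Qed.

Lemma udart_unique {L} (d d' : udart L) : uds d = uds d' -> upd d = upd d' -> d = d'.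
Proof.
  destruct d as [e b], d' as [e' b']. unfold upd; simpl. intros H E. injection E as E <-.
  f_equal. destruct b; [now apply uE_ext|]. apply uE_ext; auto.
  destruct (repr_ex (uds (e, false))) as [w Hw].
  apply (repr_inj _ _ (wapp w [(ue e, false)])); [now apply (udart_repr (e, false))|].
  rewrite H in Hw. rewrite E. now apply (udart_repr (e', false)).
Qed.

Lemma upath_repr {L} u (p : list (udart L)) v w : upath u p v -> repr u w -> repr v (wapp w (map upd p)).
Proof.
  revert u w. induction p as [|d p IH]; intros u w Hp Hw; simpl.
  - rewrite wapp_nil. simpl in Hp. now subst.
  - destruct Hp as [<- Hp]. change (upd d :: map upd p) with ([upd d] ++ map upd p).
    rewrite <- wapp_app. apply (IH (udt d)); auto. now apply udart_repr.
Qed.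

Lemma upath_upr {L} u (p : list (udart L)) v : upath u p v -> path_ok (upr u) (map upd p) (upr v).
Proof.
  revert u. induction p as [|d p IH]; intros u Hp; simpl map.
  - simpl in Hp. now subst.
  - destruct Hp as [<- Hp]. rewrite path_ok_cons. split; [symmetry; apply (upr_uds d)|].
    rewrite <- upr_udt. now apply IH.
Qed.

Lemma upath_lift {L} (u : uV L) p x : path_ok (upr u) p x -> exists p' v, upath u p' v /\ map upd p' = p.
Proof.
  revert u. induction p as [|d p IH]; intros u Hp.
  - exists [], u. split; reflexivity.
  - rewrite path_ok_cons in Hp. destruct Hp as [Hd Hp].
    destruct (udart_lift u d Hd) as (d' & E & Es).
    destruct (IH (udt d')) as (p' & v & Hp' & Ep); [now rewrite upr_udt, E|].
    exists (d' :: p'), v. split; [split; auto|]. simpl. congruence.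
Qed.

Lemma upath_unique {L} (u : uV L) p p' v v' : upath u p v -> upath u p' v' ->
  map upd p = map upd p' -> p = p' /\ v = v'.
Proof.
  revert u p'. induction p as [|d p IH]; intros u [|d' p'] H H' E; try discriminate.
  - simpl in H, H'. subst. auto.
  - simpl in E. injection E as E1 E2 E3. destruct H as [Hs H], H' as [Hs' H'].
    assert (d = d').
    { apply udart_unique; [transitivity u; [exact Hs|symmetry; exact Hs']|]. unfold upd. now rewrite E1, E2. }
    subst d'. destruct (IH _ _ H H' E3) as [-> ->]. auto.
Qed.

(** Every 2-cell of X whose boundary lifts to a closed path, listed in [L] or not; [Zplus] selects
    those of Y and of the list. *)
Definition uF L : Type :=
  {vf : uV L * fc X | path_ok (upr (fst vf)) (fbnd X (snd vf)) (upr (fst vf)) /\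
     forall w, repr (fst vf) w -> repr (fst vf) (wapp w (fbnd X (snd vf)))}.
Definition ubase {L} (f : uF L) : uV L := fst (proj1_sig f).
Definition uf {L} (f : uF L) : fc X := snd (proj1_sig f).

Lemma uF_ext {L} (f f' : uF L) : ubase f = ubase f' -> uf f = uf f' -> f = f'.
Proof.
  intros H1 H2. apply eq_sig_hprop; [intros; apply proof_irrelevance|].
  destruct f as [[v f] H], f' as [[v' f'] H']; unfold ubase, uf in *; simpl in *. congruence.
Qed.

Lemma ubnd_ex {L} (f : uF L) : exists p, upath (ubase f) p (ubase f) /\ map upd p = fbnd X (uf f).
Proof.
  destruct f as [[v f] [H1 H2]]; unfold ubase, uf; simpl in *.
  destruct (upath_lift v _ _ H1) as (p & v' & Hp & E). exists p. split; auto.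
  destruct (repr_ex v) as [w Hw]. replace v with v' at 2; auto.
  apply (repr_inj _ _ (wapp w (fbnd X f))); auto. rewrite <- E. now apply (upath_repr v).
Qed.

Definition ubnd {L} (f : uF L) : list (udart L) :=
  proj1_sig (constructive_indefinite_description _ (ubnd_ex f)).

Lemma ubnd_spec {L} (f : uF L) :
  upath (ubase f) (ubnd f) (ubase f) /\ map upd (ubnd f) = fbnd X (uf f).
Proof. unfold ubnd. destruct (constructive_indefinite_description _ _); auto. Qed.

Lemma ubnd_closed {L} (f : uF L) : ubnd f <> [] /\ exists v, upath v (ubnd f) v.
Proof.
  destruct (ubnd_spec f) as [H E]. split; [|eauto]. intros E0. rewrite E0 in E.
  destruct (fbnd_closed X (uf f)) as [Hne _]. apply Hne. now rewrite <- E.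
Qed.

Definition U L : complex := Complex (uV L) (uE L) (uF L) usrc utgt ubnd ubnd_closed.

Lemma mkface {L} (v : uV L) f : path_ok (upr v) (fbnd X f) (upr v) ->
  (forall w, repr v w -> repr v (wapp w (fbnd X f))) -> exists f' : uF L, ubase f' = v /\ uf f' = f.
Proof. intros H1 H2. exists (exist _ (v, f) (conj H1 H2)). split; reflexivity. Qed.

Lemma U_base_path {L} (f : fc (U L)) :
  @path_ok (U L) (ubase f) (fbnd (U L) f) (ubase f) /\ map upd (fbnd (U L) f) = fbnd X (uf f).
Proof. apply ubnd_spec. Qed.

Lemma U_bnd_base {L} (f : fc (U L)) v : @path_ok (U L) v (fbnd (U L) f) v -> v = ubase f.
Proof.
  intros H. destruct (ubnd_spec f) as [H1 _]. destruct (ubnd_closed f) as [Hne _].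
  unfold fbnd in H; simpl in H. destruct (ubnd f) as [|d l]; [congruence|].
  destruct H as [<- _], H1 as [<- _]. reflexivity.
Qed.

Lemma map_upd_pinv {L} (p : list (udart L)) : map upd (@pinv (U L) p) = pinv (map upd p).
Proof. unfold pinv. rewrite map_rev, !map_map. reflexivity. Qed.

Lemma upath_back {L} (u u' v : uV L) p p' : upath u p v -> upath u' p' v ->
  map upd p = map upd p' -> u = u'.
Proof.
  intros H H' E.
  assert (R : forall u p, upath u p v -> forall w, repr v w -> repr u (wapp w (pinv (map upd p)))).
  { clear - HY IY. intros u p H w Hw.
    assert (H2 := @path_ok_pinv (U L) u p v H).
    rewrite <- map_upd_pinv. exact (upath_repr v _ u w H2 Hw). }
  destruct (repr_ex v) as [w Hw]. apply (repr_inj _ _ (wapp w (pinv (map upd p)))).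
  - now apply R.
  - rewrite E. now apply R.
Qed.

(** The boundary path up to the corner lifts uniquely backwards, so both cells have the same base.
    This is why links of U embed in links of X. *)
Lemma U_corner_inj {L} (f f' : fc (U L)) i d d' :
  nth_error (fbnd (U L) f) i = Some d -> nth_error (fbnd (U L) f') i = Some d' ->
  @dtgt (U L) d = @dtgt (U L) d' -> uf f = uf f' -> f = f'.
Proof.
  intros Hd Hd' Ht Ef. apply uF_ext; auto.
  destruct (U_base_path f) as [H E], (U_base_path f') as [H' E'].
  apply nth_error_split in Hd, Hd'. destruct Hd as (a & b & Ed & La), Hd' as (a' & b' & Ed' & La').
  rewrite Ed in H. rewrite Ed' in H'.
  change (a ++ d :: b) with (a ++ [d] ++ b) in *. change (a' ++ d' :: b') with (a' ++ [d'] ++ b') in *.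
  rewrite app_assoc in H, H', Ed, Ed'.
  apply (@path_ok_app (U L)) in H, H'. destruct H as (z & H & _), H' as (z' & H' & _).
  assert (z = z').
  { apply (@path_ok_app (U L)) in H, H'. destruct H as (? & _ & H), H' as (? & _ & H').
    destruct H as [_ <-], H' as [_ <-]. exact Ht. }
  subst z'. apply (upath_back _ _ z _ _ H H').
  rewrite Ed in E. rewrite Ed' in E'. rewrite <- Ef, <- E in E'. symmetry in E'.
  change (map (@upd L) ((a ++ [d]) ++ b) = map upd ((a' ++ [d']) ++ b')) in E'.
  rewrite !(map_app _ (_ ++ _)) in E'. eapply app_eq_prefix; [exact E'|].
  rewrite !length_map, !length_app. exact (f_equal2 Nat.add (eq_trans La (eq_sym La')) eq_refl).
Qed.

Section Maps.
Context {L L' : list pface} (h : G) (HL : incl L L').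

(** Translation by [h] and enlargement of the list are treated as one map: L = L' yields the action
    on U, and h = 1 the comparison maps between lists. *)
Lemma umapV_ex (v : uV L) : exists v' : uV L', forall w, repr v w -> repr v' (wact h w).
Proof.
  destruct (repr_ex v) as [w Hw]. assert (E := upr_ends v w Hw). apply (ends_wact h) in E.
  destruct (repr_mk L' _ _ E) as [v' Hv']. exists v'. intros w' Hw'.
  apply (repr_weq v' _ _ Hv'). apply weq_wact, (weq_mono L L'); auto. now apply (repr_weq v w w').
Qed.

Definition umapV (v : uV L) : uV L' := proj1_sig (constructive_indefinite_description _ (umapV_ex v)).

Lemma umapV_spec v w : repr v w -> repr (umapV v) (wact h w).
Proof. unfold umapV. destruct (constructive_indefinite_description _ _); auto. Qed.

Lemma upr_umapV v : upr (umapV v) = av A h (upr v).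
Proof.
  destruct (repr_ex v) as [w Hw]. apply (upr_eq _ _ _ (umapV_spec v w Hw)).
  now apply ends_wact, upr_ends.
Qed.

Lemma umapE_ok (e : uE L) : upr (umapV (usrc e)) = esrc X (ae A h (ue e)).
Proof. rewrite upr_umapV, upr_usrc. symmetry. apply ae_src. Qed.

Definition umapE (e : uE L) : uE L' :=
  exist (fun ve => upr (fst ve) = esrc X (snd ve)) (umapV (usrc e), ae A h (ue e)) (umapE_ok e).

Lemma utgt_umapE e : utgt (umapE e) = umapV (utgt e).
Proof.
  destruct (repr_ex (usrc e)) as [w Hw]. apply (repr_inj _ _ (wapp (wact h w) [(ae A h (ue e), true)])).
  - apply (utgt_spec (umapE e)). now apply umapV_spec.
  - pose proof (umapV_spec (utgt e) _ (utgt_spec e w Hw)) as Q. rewrite wact_wapp in Q. exact Q.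
Qed.

Definition umapD (d : udart L) : udart L' := (umapE (fst d), snd d).

Lemma uds_umapD d : uds (umapD d) = umapV (uds d).
Proof. destruct d as [e []]; [reflexivity|apply utgt_umapE]. Qed.

Lemma udt_umapD d : udt (umapD d) = umapV (udt d).
Proof. destruct d as [e []]; [apply utgt_umapE|reflexivity]. Qed.

Lemma upd_umapD d : upd (umapD d) = dmap A h (upd d).
Proof. reflexivity. Qed.

Lemma map_upd_umapD p : map upd (map umapD p) = pmap A h (map upd p).
Proof. unfold pmap. rewrite !map_map. reflexivity. Qed.

Lemma upath_umapD u p v : upath u p v -> upath (umapV u) (map umapD p) (umapV v).
Proof.
  revert u. induction p as [|d p IH]; intros u Hp.
  - simpl in *. congruence.
  - destruct Hp as [<- Hp]. split; [apply uds_umapD|].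
    change (upath (udt (umapD d)) (map umapD p) (umapV v)). rewrite udt_umapD. now apply IH.
Qed.

Lemma umapF_ok (f : uF L) :
  path_ok (upr (umapV (ubase f))) (fbnd X (af A h (uf f))) (upr (umapV (ubase f))) /\
  forall w, repr (umapV (ubase f)) w -> repr (umapV (ubase f)) (wapp w (fbnd X (af A h (uf f)))).
Proof.
  destruct f as [[v f] [H1 H2]]; unfold ubase, uf; simpl in *. rewrite fbnd_af, upr_umapV. split.
  - now apply path_ok_pmap.
  - intros w Hw. destruct (repr_ex v) as [w0 Hw0]. assert (Hm := umapV_spec v w0 Hw0).
    apply (repr_weq _ _ _ Hm). apply (repr_weq _ _ _ Hm) in Hw.
    eapply rst_trans; [|apply weq_wapp; exact Hw].
    apply (repr_weq _ _ _ Hm). rewrite <- wact_wapp. now apply umapV_spec, H2.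
Qed.

Definition umapF (f : uF L) : uF L' :=
  exist (fun vf => path_ok (upr (fst vf)) (fbnd X (snd vf)) (upr (fst vf)) /\
     forall w, repr (fst vf) w -> repr (fst vf) (wapp w (fbnd X (snd vf))))
   (umapV (ubase f), af A h (uf f)) (umapF_ok f).

Lemma ubnd_umapF f : ubnd (umapF f) = map umapD (ubnd f).
Proof.
  destruct (ubnd_spec f) as [H E], (ubnd_spec (umapF f)) as [H' E'].
  eapply upath_unique; [exact H'|apply upath_umapD; exact H|].
  rewrite map_upd_umapD, E, E'. unfold uf; simpl. apply fbnd_af.
Qed.

End Maps.

Lemma wact1 w : wact (gone G) w = w.
Proof. destruct w. unfold wact; simpl. now rewrite av1, pmap1. Qed.

Lemma wactM g h w : wact (gmul G g h) w = wact g (wact h w).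
Proof. unfold wact; simpl. now rewrite avM, pmapM. Qed.

Section UAction.
Context (L : list pface).
Let I := incl_refl L.

Lemma uav1 (v : uV L) : umapV (gone G) I v = v.
Proof.
  destruct (repr_ex v) as [w Hw]. apply (repr_inj _ _ w); auto.
  rewrite <- (wact1 w). now apply umapV_spec.
Qed.

Lemma uavM g h (v : uV L) : umapV (gmul G g h) I v = umapV g I (umapV h I v).
Proof.
  destruct (repr_ex v) as [w Hw]. apply (repr_inj _ _ (wact (gmul G g h) w)).
  - now apply umapV_spec.
  - rewrite wactM. now apply umapV_spec, umapV_spec.
Qed.

Lemma uae1 (e : uE L) : umapE (gone G) I e = e.
Proof. apply uE_ext; [apply uav1|apply ae1]. Qed.

Lemma uaeM g h (e : uE L) : umapE (gmul G g h) I e = umapE g I (umapE h I e).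
Proof. apply uE_ext; [apply uavM|apply aeM]. Qed.

Lemma uaf1 (f : uF L) : umapF (gone G) I f = f.
Proof. apply uF_ext; [apply uav1|apply af1]. Qed.

Lemma uafM g h (f : uF L) : umapF (gmul G g h) I f = umapF g I (umapF h I f).
Proof. apply uF_ext; [apply uavM|apply afM]. Qed.

Definition uact : action G (U L) :=
  Action G (U L) (fun h => umapV h I) (fun h => umapE h I) (fun h => umapF h I)
    uav1 uae1 uaf1 uavM uaeM uafM (fun h e => eq_refl) (fun h e => utgt_umapE h I e)
    (fun h f => ubnd_umapF h I f).

End UAction.

(** * The copy of Y in U and the lifting of homotopies *)

Section Lifts.
Context (L : list pface).

(** Only one class contains the empty word at a given vertex, so this is a single copy of Y. *)
Definition Yhat : subcx (U L) := Subcx (U L)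
  (fun v : uV L => exists y, repr v (y, []))
  (fun e : uE L => sE Y (ue e) /\ exists y, repr (usrc e) (y, []))
  (fun f : uF L => sF Y (uf f) /\ exists y, repr (ubase f) (y, [])).

(** Only 2-cells that realise generators of [weq]: they suffice to deform into [Yhat] every path
    with ends there, and they stay within a bounded distance of it. *)
Definition Zplus : subcx (U L) := Subcx (U L) (fun _ => True) (fun _ => True)
  (fun f : uF L => sF Yhat f \/ exists h y g f0, In (y, g, f0) L /\ uf f = af A h f0 /\
     repr (ubase f) (av A h y, pmap A h g)).

Lemma repr_base_Y (v : uV L) y : repr v (y, []) -> sV Y y /\ upr v = y.
Proof.
  intros H. assert (E := upr_ends v _ H). destruct E as [E1 E2]. split; [exact E1|symmetry; exact E2].
Qed.

(** [ws_base] identifies the class of a path of Y with that of the empty word at its end. *)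
Lemma lift_in_Y (u : uV L) p v y z : upath u p v -> repr u (y, []) -> path_in Y y (map upd p) z ->
  path_in Yhat u p v /\ repr v (z, []).
Proof.
  revert u y. induction p as [|d p IH]; intros u y Hp Hu HYp.
  - simpl in Hp. subst v. destruct HYp as (Hy & HYp & _). simpl in HYp. subst z.
    split; auto. apply path_in_nil. now exists y.
  - destruct Hp as [<- Hp]. change (map upd (d :: p)) with ([upd d] ++ map upd p) in HYp.
    apply path_in_app in HYp; auto. destruct HYp as (x & Hd & HYp).
    assert (Hx : repr (udt d) (x, [])).
    { apply (repr_weq _ (y, [upd d])).
      - exact (udart_repr d (y, []) Hu).
      - apply rst_step. exact (ws_base L y [upd d] x [] Hd). }
    destruct (IH (udt d) x Hp Hx HYp) as [H1 H2]. split; auto.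
    split; [now exists y|]. split; [split; [reflexivity|exact Hp]|].
    intros d' [<-|Hd']; [|now apply H1].
    split; [apply (proj2 (proj2 Hd) (upd d)); simpl; auto|].
    destruct d as [e []]; [now exists y|now exists x].
Qed.

Lemma Yhat_sub : is_subcomplex (U L) Yhat.
Proof.
  assert (HE : forall e : uE L, sE Yhat e -> path_in Y (esrc X (ue e)) [(ue e, true)] (etgt X (ue e))).
  { intros e [He _]. apply (path_in_single Y (ue e, true)); auto. }
  split.
  - intros e He. assert (P := HE e He). destruct He as [He [y Hy]]. split; [now exists y|].
    assert (y = esrc X (ue e)) by (rewrite <- upr_usrc; symmetry; now apply repr_base_Y).
    subst y. exists (etgt X (ue e)).
    assert (Hp : upath (usrc e) [(e, true)] (utgt e)) by (split; reflexivity).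
    exact (proj2 (lift_in_Y _ _ _ _ _ Hp Hy P)).
  - intros f [Hf [y Hy]] d Hd. destruct (ubnd_spec f) as [H E].
    assert (P : path_in Y y (map upd (ubnd f)) y).
    { rewrite E. apply fbnd_path_in; auto. rewrite <- E. destruct (repr_base_Y _ _ Hy) as [_ <-].
      now apply upath_upr. }
    apply (proj1 (lift_in_Y _ _ _ _ _ H Hy P)). exact Hd.
Qed.

Lemma Yhat_inv : inv_sub (uact L) Yhat.
Proof.
  assert (HV : forall h (v : uV L), (exists y, repr v (y, [])) -> exists y, repr (umapV h (incl_refl L) v) (y, [])).
  { intros h v [y Hy]. exists (av A h y). exact (umapV_spec h (incl_refl L) v (y, []) Hy). }
  split; [|split].
  - intros h v _ Hv. now apply HV.
  - intros h e _ [He Hv]. split; [now apply IY|now apply HV].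
  - intros h f _ [Hf Hv]. split; [now apply IY|now apply HV].
Qed.

Lemma Zplus_sub : is_subcomplex (U L) Zplus.
Proof. split; simpl; auto. Qed.

Lemma Zplus_path (u : uV L) p v : upath u p v -> path_in Zplus u p v.
Proof. intros H. split; [exact I|]. split; [exact H|]. intros; exact I. Qed.

Lemma repr_path_weq (u : uV L) p v w w' : upath u p v -> repr u w -> repr v w' -> weq L (wapp w (map upd p)) w'.
Proof. intros Hp Hu Hv. apply (repr_weq v); auto. now apply (upath_repr u). Qed.

Lemma map_split {B C} (f : B -> C) l a b : map f l = a ++ b ->
  exists l1 l2, l = l1 ++ l2 /\ map f l1 = a /\ map f l2 = b.
Proof. intros H. apply map_eq_app in H. destruct H as (l1 & l2 & -> & <- & <-). eauto. Qed.

Lemma upath_app (u : uV L) p q v : upath u (p ++ q) v <-> exists w, upath u p w /\ upath w q v.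
Proof. exact (@path_ok_app (U L) u p q v). Qed.

Lemma upath_cancel (u : uV L) (p : list (udart L)) v d : upath u p v -> map upd p = [d; dinv d] ->
  exists d', p = [d'; @dinv (U L) d'] /\ v = u.
Proof.
  intros H E. destruct p as [|d1 [|d2 [|? ?]]]; try discriminate.
  destruct H as [<- [H2 <-]]. change (uds d2 = udt d1) in H2. 
  assert (E1 := f_equal (fun l => nth 0 l d) E). assert (E2 := f_equal (fun l => nth 1 l d) E).
  simpl in E1, E2.
  assert (d2 = @dinv (U L) d1) as ->.
  { apply udart_unique.
    - rewrite H2. symmetry. apply (@dsrc_dinv (U L)).
    - rewrite E2, <- E1. reflexivity. }
  exists d1. split; auto. apply (@dtgt_dinv (U L)).
Qed.

Lemma Zplus_insert (u v : uV L) d (p q : list (udart L)) : upath u (p ++ q) v ->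
  upath u (p ++ [d; @dinv (U L) d] ++ q) v ->
  homotopic Zplus u v (p ++ q) (p ++ [d; @dinv (U L) d] ++ q).
Proof.
  intros H H'. apply rst_step.
  split; [now apply Zplus_path|]. split; [now apply Zplus_path|].
  left. exists p, q, d. auto.
Qed.

Lemma face_lift h y g f (z : uV L) : In (y, g, f) L -> repr z (av A h y, pmap A h g) ->
  (exists v, path_ok y g v /\ path_ok v (fbnd X f) v) ->
  exists f' : fc (U L), sF Zplus f' /\ ubase f' = z /\ uf f' = af A h f.
Proof.
  intros HIn Hz (v & Hg & Hf).
  assert (Ez : upr z = av A h v).
  { apply (upr_eq _ _ _ Hz). destruct (repr_ends _ _ Hz) as [x [Hx _]].
    split; [exact Hx|]. now apply path_ok_pmap. }
  destruct (mkface z (af A h f)) as (f' & Eb & Ef).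
  - rewrite fbnd_af, Ez. now apply path_ok_pmap.
  - intros w Hw. apply (repr_weq z w); auto.
    apply (rst_trans _ _ _ (av A h y, pmap A h g)); [now apply (repr_weq z w)|]. apply rst_sym.
    eapply rst_trans; [apply weq_wapp, (repr_weq z w _ Hw); exact Hz|].
    apply rst_step. unfold wapp; simpl. rewrite fbnd_af.
    pose proof (ws_face L h y g f [] v HIn Hg Hf) as Q. rewrite !app_nil_r, pmap_app in Q. exact Q.
  - exists f'. split; auto. right. exists h, y, g, f. rewrite Eb. auto.
Qed.

(** Each generator of [weq] is realised on lifted paths: a cancellation by a backtrack, a face
    relation by its 2-cell in [Zplus], and a path of Y by the connecting path [q], which records the
    change of starting vertex. *)
Lemma weq_homotopy w w' : weq L w w' -> forall (u u' v v' : uV L) p p',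
  repr u (fst w, []) -> repr u' (fst w', []) -> upath u p v -> upath u' p' v' ->
  map upd p = snd w -> map upd p' = snd w' ->
  exists q, path_in Yhat u q u' /\ homotopic Zplus u v p (q ++ p').
Proof.
  induction 1 as [w w' H|w|w w' H IH|w w1 w' H IH H' IH']; intros u u' v v' p p' Hu Hu' Hp Hp' E E'.
  - destruct H as [y a d b H|y q y' p0 H|h y g f b x H H1 H2]; simpl in *.
    + assert (u = u') by eauto using repr_inj. subst u'.
      exists []. split; [apply path_in_nil; now exists y|]. simpl.
      change (a ++ d :: dinv d :: b) with (a ++ [d; dinv d] ++ b) in E.
      apply map_split in E. destruct E as (pa & pr & -> & Ea & E).
      apply map_split in E. destruct E as (pd & pb & -> & Ed & Eb).
      assert (Hp0 := Hp). apply upath_app in Hp. destruct Hp as (z & Hpa & Hp).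
      apply upath_app in Hp. destruct Hp as (z' & Hpd & Hpb).
      destruct (upath_cancel _ _ _ _ Hpd Ed) as (d' & -> & ->).
      assert (Hab : upath u (pa ++ pb) v) by (apply upath_app; eauto).
      destruct (upath_unique u p' (pa ++ pb) v' v) as [-> ->]; auto.
      { rewrite map_app. congruence. }
      apply rst_sym. now apply Zplus_insert.
    + apply map_split in E. destruct E as (pq & pr & -> & Eq & E).
      apply upath_app in Hp. destruct Hp as (z & Hpq & Hp).
      rewrite <- Eq in H. destruct (lift_in_Y _ _ _ _ _ Hpq Hu H) as [HY1 Hz].
      assert (z = u') by eauto using repr_inj. subst z.
      destruct (upath_unique u' pr p' v v') as [-> ->]; auto; [congruence|].
      exists pq. split; auto. apply rst_refl.
    + assert (u = u') by eauto using repr_inj. subst u'.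
      exists []. split; [apply path_in_nil; now eexists; eauto|]. simpl.
      rewrite pmap_app, <- app_assoc in E.
      apply map_split in E. destruct E as (pa & pr & -> & Ea & E).
      apply map_split in E. destruct E as (pd & pb & -> & Ed & Eb).
      assert (Hp0 := Hp). apply upath_app in Hp. destruct Hp as (z & Hpa & Hp).
      apply upath_app in Hp. destruct Hp as (z' & Hpd & Hpb).
      destruct (face_lift h y g f z H) as (f' & Hf' & Eb' & Ef').
      { pose proof (upath_repr _ _ _ _ Hpa Hu) as Q. rewrite Ea in Q. exact Q. }
      { eauto. }
      destruct (ubnd_spec f') as [Hb Eb2]. rewrite Eb' in Hb.
      destruct (upath_unique z pd (ubnd f') z' z) as [-> ->]; auto.
      { rewrite Ed, Eb2, Ef', fbnd_af. reflexivity. }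
      assert (Hab : upath u (pa ++ pb) v) by (apply upath_app; eauto).
      destruct (upath_unique u p' (pa ++ pb) v' v) as [-> ->]; auto.
      { rewrite map_app. congruence. }
      pose proof (homotopic_whisker Zplus u z z v pa pb (ubnd f') [] Zplus_sub) as Q. simpl in Q.
      apply Q; auto using Zplus_path. apply (homotopic_fbnd Zplus f'); auto using Zplus_sub.
  - assert (u = u') by eauto using repr_inj. subst u'.
    destruct (upath_unique u p p' v v') as [-> ->]; auto; [congruence|].
    exists []. split; [apply path_in_nil; now eexists; eauto|]. apply rst_refl.
  - destruct (IH u' u v' v p' p) as (q & Hq & Hh); auto.
    exists (pinv q). split; [apply path_in_pinv; auto using Yhat_sub|].
    assert (v' = v).
    { assert (Q1 : repr v w').
      { pose proof (upath_repr _ _ _ _ Hp Hu) as Q. rewrite E in Q. destruct w'; exact Q. }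
      apply (repr_inj _ _ w).
      - pose proof (upath_repr _ _ _ _ Hp' Hu') as Q. rewrite E' in Q. destruct w; exact Q.
      - apply (repr_weq _ _ _ Q1). now apply rst_sym. }
    subst v'. assert (Hq2 : upath u' q u) by apply Hq.
    apply rst_sym. eapply rst_trans.
    + eapply homotopic_app_l; [apply Zplus_sub| |exact I|exact Hh].
      apply Zplus_path. exact (@path_ok_pinv (U L) u' q u Hq2).
    + rewrite app_assoc. eapply rst_trans.
      * eapply (homotopic_app_r Zplus u u v p (pinv q ++ q) []); [apply Zplus_sub|exact I|now apply Zplus_path|].
        eapply homotopic_cancel'; [apply Zplus_sub|apply Zplus_path; exact Hq2].
      * apply rst_refl.
  - pose proof (upath_repr _ _ _ _ Hp Hu) as Q. rewrite E in Q.
    change (repr v (fst w, snd w)) in Q. rewrite <- surjective_pairing in Q.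
    (* The intermediate word has an end too, hence a lift from its own starting vertex. *)
    assert (Ew := upr_ends v w Q). apply (weq_ends L w w1 _ H) in Ew.
    assert (E1 : ends (fst w1, []) (fst w1)) by (split; [apply Ew|reflexivity]).
    destruct (repr_mk L _ _ E1) as [u1 Hu1].
    destruct (upath_lift u1 (snd w1) (upr v)) as (p1 & v1 & Hp1 & Ep1).
    { rewrite (upr_eq _ _ _ Hu1 E1). apply Ew. }
    destruct (IH u u1 v v1 p p1) as (q1 & Hq1 & Hh1); auto.
    destruct (IH' u1 u' v1 v' p1 p') as (q2 & Hq2 & Hh2); auto.
    assert (v1 = v).
    { apply (repr_inj _ _ w1).
      - pose proof (upath_repr _ _ _ _ Hp1 Hu1) as Q'. rewrite Ep1 in Q'. destruct w1; exact Q'.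
      - apply (repr_weq _ _ _ Q); auto. }
    subst v1. exists (q1 ++ q2). split.
    + apply path_in_app; [apply Yhat_sub|]. eauto.
    + eapply rst_trans; [exact Hh1|]. rewrite <- app_assoc.
      eapply homotopic_app_l; [apply Zplus_sub| |exact I|exact Hh2].
      apply Zplus_path. apply Hq1.
Qed.

(** Both ends are classes of empty words, so the projected path is equivalent to an empty word, and
    [weq_homotopy] applies with an empty second path. *)
Lemma Zplus_rel_trivial : rel_trivial Yhat Zplus.
Proof.
  intros u v p [y Hy] [y' Hy'] (_ & Hp & _).
  pose proof (repr_path_weq u p v _ _ Hp Hy Hy') as Hw. unfold wapp in Hw; simpl in Hw.
  destruct (weq_homotopy _ _ Hw u v v v p []) as (q & Hq & Hh); auto; [reflexivity|].
  rewrite app_nil_r in Hh. eauto.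
Qed.

End Lifts.

Lemma path_in_full u p v : path_in (full X) u p v <-> path_ok u p v.
Proof. split; [intros H; apply H|]. intros H. split; [exact I|]. split; auto. intros; exact I. Qed.

(* A homotopy of X lifts once the finitely many pointed 2-cells it sweeps are available. *)
Lemma homotopy_lift y v p q : homotopic (full X) y v p q -> path_ok y p v ->
  exists Lc, forall L, incl Lc L -> forall (u v1 v2 : uV L) p' q',
    repr u (y, []) -> upath u p' v1 -> map upd p' = p -> upath u q' v2 -> map upd q' = q ->
    v1 = v2 /\ homotopic (Zplus L) u v1 p' q'.
Proof.
  induction 1 as [p q H|p|p q H IH|p m q H IH H' IH']; intros Hok.
  - destruct H as (Hp & Hq & [(a & b & d & Ep & Eq)|(a & b & f & k & r & Hf & Hk & Hr & Ep & Eq)]).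
    + exists []. intros L HL u v1 v2 p' q' Hu Hp' E Hq' E'. subst p q.
      change (a ++ d :: dinv d :: b) with (a ++ [d; dinv d] ++ b) in E'.
      apply map_split in E'. destruct E' as (pa & pr & -> & Ea & E').
      apply map_split in E'. destruct E' as (pd & pb & -> & Ed & Eb).
      assert (Hq0 := Hq'). apply upath_app in Hq'. destruct Hq' as (z & Hpa & Hq').
      apply upath_app in Hq'. destruct Hq' as (z' & Hpd & Hpb).
      destruct (upath_cancel _ _ _ _ _ Hpd Ed) as (d' & -> & ->).
      assert (Hab : upath u (pa ++ pb) v2) by (apply upath_app; eauto).
      destruct (upath_unique u p' (pa ++ pb) v1 v2) as [-> ->]; auto.
      { rewrite map_app. congruence. }
      split; auto. now apply Zplus_insert.
    + subst p q. apply path_in_full in Hq. apply path_ok_app in Hq. destruct Hq as (x & Ha & Hq).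
      apply path_ok_app in Hq. destruct Hq as (x1 & Hrx & Hb).
      destruct (fbnd_loop f) as [v0 Hv0].
      (* the boundary path or its inverse, cut as s1 s2 with r = s2 s1 *)
      assert (exists l0, r = rot k l0 /\ length l0 = length (fbnd X f) /\ path_ok v0 l0 v0 /\
         (l0 = fbnd X f \/ l0 = pinv (fbnd X f))) as (l0 & Er & Hlen & Hv0' & Hl0).
      { destruct Hr; [exists (fbnd X f)|exists (pinv (fbnd X f))]; rewrite ?pinv_length;
          auto 6 using path_ok_pinv. }
      clear Hr Hf. set (s1 := firstn k l0). set (s2 := skipn k l0).
      assert (El : l0 = s1 ++ s2) by (symmetry; apply firstn_skipn).
      assert (L1 : length s1 = k) by (unfold s1; rewrite length_firstn; lia).
      change (r = s2 ++ s1) in Er. subst r.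
      assert (Hs2 : path_ok x s2 v0).
      { rewrite El in Hv0'. apply path_ok_app in Hv0'. destruct Hv0' as (w' & H1 & H2).
        apply path_ok_app in Hrx. destruct Hrx as (z & H3 & _).
        destruct s2 as [|d s2'] eqn:E2.
        - exfalso. rewrite El, app_nil_r in Hlen. lia.
        - rewrite path_ok_cons in *. destruct H2 as [_ H2], H3 as [H3 _]. auto. }
      (* The inserted word reads [s2 ++ s1], so the base point of [f] is met after [a ++ s2];
         pointing the 2-cell by this path makes it available at the right vertex. *)
      exists [(y, a ++ s2, f)]. intros L HL u v1 v2 p' q' Hu Hp' E Hq' E'.
      apply map_split in E'. destruct E' as (pa & pr & -> & Ea & E').
      apply map_split in E'. destruct E' as (pd & pb & -> & Ed & Eb).
      apply map_split in Ed. destruct Ed as (p2 & p1 & -> & E2 & E1).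
      assert (Hq0 := Hq'). apply upath_app in Hq'. destruct Hq' as (xh & Hpa & Hq').
      apply upath_app in Hq'. destruct Hq' as (xh' & Hpd & Hpb).
      apply upath_app in Hpd. destruct Hpd as (zh & Hp2 & Hp1).
      assert (Hz : repr zh (y, a ++ s2)).
      { pose proof (upath_repr _ _ _ _ Hpa Hu) as Q. pose proof (upath_repr _ _ _ _ Hp2 Q) as Q'.
        rewrite Ea, E2 in Q'. exact Q'. }
      destruct (face_lift L (gone G) y (a ++ s2) f zh) as (f' & Hf' & Eb' & Ef').
      { apply HL; simpl; auto. }
      { now rewrite av1, pmap1. }
      { exists v0. split; auto. apply path_ok_app; eauto. }
      rewrite af1 in Ef'. destruct (ubnd_spec f') as [Hbd Ebd]. rewrite Eb', Ef' in *.
      assert (exists l', upath zh l' zh /\ map upd l' = l0 /\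
         (l' = fbnd (U L) f' \/ l' = @pinv (U L) (fbnd (U L) f'))) as (l' & Hl' & El' & Hor).
      { destruct Hl0 as [->| ->].
        - exists (ubnd f'). auto.
        - exists (@pinv (U L) (ubnd f')). split; [exact (@path_ok_pinv (U L) _ _ _ Hbd)|].
          split; auto. rewrite map_upd_pinv, Ebd. reflexivity. }
      rewrite El in El'. apply map_split in El'. destruct El' as (t1 & t2 & -> & F1 & F2).
      apply upath_app in Hl'. destruct Hl' as (m & Ht1 & Ht2).
      (* The boundary lifted at [zh] is closed, and reading [s2] backwards from there leads to the
         vertex where the inserted word starts. *)
      assert (m = xh) by (apply (upath_back _ _ _ _ _ Ht2 Hp2); congruence). subst m.
      destruct (upath_unique _ _ _ _ _ Ht2 Hp2) as [-> _]; [congruence|].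
      destruct (upath_unique _ _ _ _ _ Ht1 Hp1) as [-> <-]; [congruence|].
      assert (Hab : upath u (pa ++ pb) v2) by (apply upath_app; eauto).
      destruct (upath_unique u p' (pa ++ pb) v1 v2) as [-> ->]; auto.
      { rewrite map_app. congruence. }
      split; auto. apply rst_step.
      split; [now apply Zplus_path|]. split; [now apply Zplus_path|]. right.
      assert (Lp1 : length p1 = k) by (rewrite <- L1, <- E1, length_map; reflexivity).
      exists pa, pb, f', k, (p2 ++ p1). split; auto. split.
      { change (k < length (ubnd f'))%nat. rewrite <- (length_map upd), Ebd. exact Hk. }
      split; auto.
      assert (Hrot : p2 ++ p1 = @rot (U L) k (p1 ++ p2)).
      { unfold rot. rewrite <- Lp1, firstn_app, skipn_app, firstn_all, skipn_all, Nat.sub_diag.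
        simpl. now rewrite app_nil_r. }
      rewrite Hrot. destruct Hor as [<-|<-]; auto.
  - exists []. intros L HL u v1 v2 p' q' Hu Hp' E Hq' E'.
    destruct (upath_unique u p' q' v1 v2) as [-> ->]; auto; [congruence|].
    split; auto. apply rst_refl.
  - destruct IH as (Lc & HLc).
    { apply path_in_full. apply path_in_full in Hok. now apply (homotopic_ends _ _ _ _ _ H). }
    exists Lc. intros L HL u v1 v2 p' q' Hu Hp' E Hq' E'.
    destruct (HLc L HL u v2 v1 q' p') as [-> Hh]; auto. split; auto. now apply rst_sym.
  - assert (Hm : path_ok y m v).
    { apply path_in_full. apply path_in_full in Hok. now apply (homotopic_ends _ _ _ _ _ H). }
    destruct (IH Hok) as (Lc & HLc). destruct (IH' Hm) as (Lc' & HLc').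
    exists (Lc ++ Lc'). intros L HL u v1 v2 p' q' Hu Hp' E Hq' E'.
    apply incl_app_inv in HL. destruct HL as [HL HL'].
    destruct (upath_lift u m v) as (m' & vm & Hm' & Em).
    { now destruct (repr_base_Y L u y Hu) as [_ ->]. }
    destruct (HLc L HL u v1 vm p' m') as [-> Hh]; auto.
    destruct (HLc' L HL' u vm v2 m' q') as [-> Hh']; auto.
    split; auto. eapply rst_trans; eauto.
Qed.

(** * Curvature and finiteness bounds for U *)

Section Transfer.
Context (L : list pface).

Definition ucorner (c : fc (U L) * nat) : fc X * nat := (uf (fst c), snd c).

Lemma ubnd_nth (f : fc (U L)) i d : nth_error (fbnd (U L) f) i = Some d ->
  nth_error (fbnd X (uf f)) i = Some (upd d).
Proof.
  intros H. destruct (ubnd_spec f) as [_ E]. rewrite <- E. exact (map_nth_error upd _ _ H).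
Qed.

Lemma ubnd_length (f : fc (U L)) : length (fbnd (U L) f) = length (fbnd X (uf f)).
Proof. destruct (ubnd_spec f) as [_ E]. rewrite <- E, length_map. reflexivity. Qed.

Lemma corner_ends_U (f : fc (U L)) i a b : corner_ends (U L) f i a b ->
  corner_ends X (uf f) i (upd a) (upd b).
Proof.
  intros (x & y & Hx & Hy & -> & ->). exists (upd x), (upd y).
  rewrite ubnd_length in Hy. split; [now apply ubnd_nth|]. split; [now apply ubnd_nth|]. split; reflexivity.
Qed.

Lemma corner_end_U c s d : corner_end (U L) c s d -> corner_end X (ucorner c) s (upd d).
Proof.
  intros (a & b & H & ->). exists (upd a), (upd b). split; [now apply corner_ends_U|].
  now destruct s.
Qed.

Lemma corner_at_U v c : @corner_at (U L) v c -> corner_at (upr v) (ucorner c).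
Proof.
  intros (d & Hd & <-). exists (upd d). split; [now apply ubnd_nth|].
  symmetry. exact (upr_udt d).
Qed.

Lemma ucorner_inj v c c' : @corner_at (U L) v c -> @corner_at (U L) v c' ->
  ucorner c = ucorner c' -> c = c'.
Proof.
  destruct c as [f i], c' as [f' i']. intros (d & Hd & <-) (d' & Hd' & Ht) E.
  unfold ucorner in E; simpl in E. injection E as E <-. f_equal.
  eapply U_corner_inj; eauto.
Qed.

Lemma NoDup_map_in {B C} (f : B -> C) l : NoDup l ->
  (forall x y, In x l -> In y l -> f x = f y -> x = y) -> NoDup (map f l).
Proof.
  induction 1 as [|a l Ha N IH]; intros H; simpl; constructor.
  - intros Hin. apply in_map_iff in Hin. destruct Hin as (b & E & Hb). apply Ha.
    rewrite (H a b); simpl; auto.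
  - apply IH. intros x y Hx Hy. apply H; simpl; auto.
Qed.

Variables (ang : fc X -> nat -> R) (alpha : R).
Definition uang (f : fc (U L)) (i : nat) : R := ang (uf f) i.

Lemma uang_inv : invariant_angles G X A ang -> invariant_angles G (U L) (uact L) uang.
Proof. intros H h f i. exact (H h (uf f) i). Qed.

(** Links of U embed in links of X with the same angles, so a subgraph upstairs has an image with
    the same counts, and a vertex of valence one in the image would have valence one upstairs. *)
Lemma curvature_U : sectional_curvature_le X ang alpha -> sectional_curvature_le (U L) uang alpha.
Proof.
  intros [H1 H2]. split.
  - intros x Lv Lc (NV & NC & Hne & Hsrc & Hc & Hconn & Hval).
    assert (Hat : forall c, In c Lc -> @corner_at (U L) x c).
    { intros c Hin. destruct (Hc c Hin) as (_ & a & b & Hab & Ha & _).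
      destruct Hab as (di & dj & Hi & _ & -> & _). exists di. split; auto.
      rewrite <- (Hsrc _ Ha). symmetry. apply dsrc_dinv. }
    assert (Vinj : forall d d', In d Lv -> In d' Lv -> upd d = upd d' -> d = d').
    { intros d d' Hd Hd' E. apply udart_unique; auto.
      transitivity x; [exact (Hsrc d Hd)|symmetry; exact (Hsrc d' Hd')]. }
    assert (Cinj : forall c c', In c Lc -> In c' Lc -> ucorner c = ucorner c' -> c = c').
    { intros c c' Hin Hin'. apply (ucorner_inj x); auto. }
    assert (Ends : forall c s v, In c Lc -> corner_end (U L) c s v -> In v Lv).
    { intros c s v Hin (a & b & Hab & ->). destruct (Hc c Hin) as (_ & a' & b' & Hab' & Ha & Hb).
      destruct (corner_ends_fun _ _ _ _ _ _ Hab Hab') as [-> ->]. now destruct s. }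
    specialize (H1 (upr x) (map upd Lv) (map ucorner Lc)).
    rewrite length_map, map_map in H1. apply H1. clear H1 H2.
    refine (conj _ (conj _ (conj _ (conj _ (conj _ (conj _ _)))))).
    + now apply NoDup_map_in.
    + now apply NoDup_map_in.
    + destruct Lc; [congruence|discriminate].
    + intros d Hd. apply in_map_iff in Hd. destruct Hd as (d' & <- & Hd').
      rewrite <- (Hsrc d' Hd'). symmetry. exact (upr_uds d').
    + intros c Hin. apply in_map_iff in Hin. destruct Hin as (c' & <- & Hin').
      destruct (Hc c' Hin') as (Hlt & a & b & Hab & Ha & Hb). split.
      * unfold ucorner; cbn [fst snd]. now rewrite <- ubnd_length.
      * exists (upd a), (upd b). split; [now apply corner_ends_U|]. split; now apply in_map.
    + intros u w Hu Hw. apply in_map_iff in Hu, Hw.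
      destruct Hu as (u' & <- & Hu), Hw as (w' & <- & Hw). specialize (Hconn u' w' Hu Hw).
      clear -Hconn HY IY. induction Hconn as [a b (c & Hin & H)|a|a b c _ IH _ IH'];
        [|apply rt_refl|eapply rt_trans; eauto].
      apply rt_step. exists (ucorner c). split; [now apply in_map|].
      destruct H as [[Ha Hb]|[Ha Hb]]; [left|right]; split; now apply corner_end_U.
    + intros v Hv ([c0 s] & (Hin0 & Hce0) & Huniq). apply in_map_iff in Hv.
      destruct Hv as (v' & <- & Hv). cbn [fst snd] in *. apply in_map_iff in Hin0.
      destruct Hin0 as (c & <- & Hin).
      assert (Hce : corner_end (U L) c s v').
      { destruct (Hc c Hin) as (_ & a & b & Hab & Ha & Hb).
        destruct Hce0 as (a' & b' & Hab' & E).
        destruct (corner_ends_fun _ _ _ _ _ _ (corner_ends_U _ _ _ _ Hab) Hab') as [<- <-].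
        exists a, b. split; auto. apply Vinj; auto; [destruct s; auto|]. rewrite E. now destruct s. }
      apply (Hval v' Hv). exists (c, s). split; [split; auto|].
      intros [c' s'] [Hin' Hce']. cbn [fst snd] in *.
      specialize (Huniq (ucorner c', s')). cbn [fst snd] in Huniq.
      assert (E : (ucorner c', s') = (ucorner c, s)).
      { apply Huniq. split; [now apply in_map|now apply corner_end_U]. }
      assert (E1 := f_equal snd E). assert (E2 := f_equal fst E). simpl in E1. subst s'.
      f_equal. apply Cinj; auto.
  - intros f. specialize (H2 (uf f)). rewrite ubnd_length. exact H2.
Qed.

Lemma stab_bound_U K : stab_bound A K -> stab_bound (uact L) K.
Proof.
  intros (K1 & K2 & K3). split; [|split].
  - intros v. destruct (K1 (upr v)) as (l & Hl & H). exists l. split; auto.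
    intros h E. apply H. simpl in *. rewrite <- (upr_umapV h (incl_refl L)), E. reflexivity.
  - intros e. destruct (K2 (ue e)) as (l & Hl & H). exists l. split; auto.
    intros h E. apply H. simpl in *. exact (f_equal ue E).
  - intros f. destruct (K3 (uf f)) as (l & Hl & H). exists l. split; auto.
    intros h E. apply H. simpl in *. exact (f_equal uf E).
Qed.

Lemma corner_mass_U m v Lc :
  (forall Lc', NoDup Lc' -> (forall c, In c Lc' -> corner_at (upr v) c) ->
    sum_R (map (fun c => Rabs (PI - ang (fst c) (snd c))) Lc') <= m) ->
  NoDup Lc -> (forall c, In c Lc -> @corner_at (U L) v c) ->
  sum_R (map (fun c => Rabs (PI - uang (fst c) (snd c))) Lc) <= m.
Proof.
  intros H N Hc. specialize (H (map ucorner Lc)). rewrite map_map in H. apply H.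
  - apply NoDup_map_in; auto. intros c c' Hin Hin'. apply (ucorner_inj v); auto.
  - intros c Hin. apply in_map_iff in Hin. destruct Hin as (c' & <- & Hin). now apply corner_at_U, Hc.
Qed.

(** At most one class contains the empty word at a given vertex, so [Yhat] needs no more
    representatives than Y; this keeps the radius the same for every list. *)
Lemma Yhat_reps LY : (forall v, sV Y v -> exists h y, In y LY /\ v = av A h y) ->
  exists LY' : list (vtx (U L)), (length LY' <= length LY)%nat /\
   forall v, sV (Yhat L) v -> exists h y, In y LY' /\ v = av (uact L) h y.
Proof.
  intros HLY.
  assert (Q : forall l : list (vtx X), exists l' : list (vtx (U L)), (length l' <= length l)%nat /\
     forall y (v : uV L), In y l -> repr v (y, []) -> In v l').
  { induction l as [|y l (l' & Hl & IH)]; [exists []; simpl; split; [lia|tauto]|].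
    destruct (classic (exists v : uV L, repr v (y, []))) as [[v Hv]|Hn].
    - exists (v :: l'). split; [exact (le_n_S _ _ Hl)|]. intros z w [<-|Hz] Hw; simpl; [left|right; eauto].
      eapply repr_inj; eauto.
    - exists l'. split; [exact (le_S _ _ Hl)|]. intros z w [<-|Hz] Hw; [exfalso; eauto|eauto]. }
  destruct (Q LY) as (LY' & Hl & H). exists LY'. split; auto.
  intros v [y Hy]. destruct (repr_base_Y L v y Hy) as [HYy _].
  destruct (HLY y HYy) as (h & y0 & Hy0 & ->).
  exists h, (umapV (ginv G h) (incl_refl L) v). split.
  - apply (H y0); auto. pose proof (umapV_spec (ginv G h) (incl_refl L) v _ Hy) as E.
    unfold wact in E; simpl in E. now rewrite avV in E.
  - pose proof (@gaVr G (gV (uact L)) h v) as E. simpl in E. now symmetry.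
Qed.

End Transfer.

(** * Balls around Y *)

Section Ball.
Context (L : list pface) (n : nat).
Hypothesis Hn : forall y g f, In (y, g, f) L -> (length g + length (fbnd X f) <= n)%nat.

Definition ballV (v : uV L) := exists y p, repr v (y, p) /\ (length p <= n)%nat.
Definition ballE (e : uE L) := ballV (usrc e) /\ ballV (utgt e).
Definition Zball : subcx (U L) :=
  Subcx (U L) ballV ballE (fun f => sF (Zplus L) f /\ forall d, In d (ubnd f) -> ballE (fst d)).

Lemma Zball_sub : is_subcomplex (U L) Zball.
Proof. split; simpl; [intros e [H1 H2]; auto|]. intros f [_ H] d Hd. auto. Qed.

Lemma Zball_le : subcx_le (U L) Zball (Zplus L).
Proof. split; [|split]; simpl; tauto. Qed.

Lemma ball_path (u : uV L) y p0 p v : repr u (y, p0) -> upath u p v ->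
  (length p0 + length p <= n)%nat -> path_in Zball u p v.
Proof.
  revert u p0. induction p as [|d p IH]; intros u p0 Hu Hp Hl; simpl in Hl.
  - simpl in Hp. subst v. apply path_in_nil. exists y, p0. split; [auto|lia].
  - assert (Vu : ballV u) by (exists y, p0; split; [auto|lia]).
    destruct Hp as [<- Hp].
    assert (Hd : repr (udt d) (y, p0 ++ [upd d])) by exact (udart_repr d _ Hu).
    assert (Vd : ballV (udt d)).
    { exists y, (p0 ++ [upd d]). split; auto. rewrite length_app; simpl; lia. }
    destruct (IH (udt d) _ Hd Hp) as (_ & H1 & H2); [rewrite length_app; simpl; lia|].
    split; [exact Vu|]. split; [split; [reflexivity|exact H1]|].
    intros d' [<-|Hd']; [|now apply H2]. destruct d as [e []]; split; auto.
Qed.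

Lemma Yhat_ballV v : sV (Yhat L) v -> ballV v.
Proof. intros [y Hy]. exists y, []. split; [auto|simpl; lia]. Qed.

Lemma Yhat_ballE e : sE (Yhat L) e -> ballE e.
Proof. intros He. destruct (proj1 (Yhat_sub L) e He). split; now apply Yhat_ballV. Qed.

Lemma Zball_above : subcx_le (U L) (Yhat L) Zball.
Proof.
  split; [exact Yhat_ballV|split; [exact Yhat_ballE|]].
  intros f Hf. split; [now left|]. intros d Hd. apply Yhat_ballE. eapply (proj2 (Yhat_sub L)); eauto.
Qed.

Lemma Zball_reach : reach (Yhat L) Zball.
Proof.
  intros v (y & p & Hv & Hl). assert (E := upr_ends v _ Hv). destruct E as [E1 E2]. simpl in E1, E2.
  assert (E0 : ends (y, []) y) by (split; [auto|reflexivity]).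
  destruct (repr_mk L _ _ E0) as [u Hu].
  destruct (upath_lift u p (upr v)) as (p' & v' & Hp' & Ep); [now rewrite (upr_eq _ _ _ Hu E0)|].
  assert (v' = v).
  { apply (repr_inj _ _ (y, p)); auto. pose proof (upath_repr _ _ _ _ Hp' Hu) as Q.
    rewrite Ep in Q. exact Q. }
  subst v'. exists u, p'. split; [now exists y|]. eapply ball_path; eauto.
  rewrite <- Ep, length_map in Hl. simpl; lia.
Qed.

(** A vertex on a listed 2-cell is represented by the path to its base followed by part of its
    boundary; [Hn] bounds the length of such words. *)
Lemma Zplus_faces_ball f : sF (Zplus L) f -> forall d, In d (ubnd f) -> ballE (fst d).
Proof.
  intros [Hf|(h & y & g & f0 & HIn & Ef & Hb)] d Hd.
  - apply Yhat_ballE. eapply (proj2 (Yhat_sub L)); eauto.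
  - destruct (ubnd_spec f) as [H E].
    refine (proj2 (proj2 (ball_path _ _ _ _ _ Hb H _)) d Hd).
    rewrite <- (length_map upd), E, Ef, fbnd_af. unfold pmap. rewrite !length_map. eauto.
Qed.

(** An edge outside the ball lies in no 2-cell of [Zplus], so cutting along all such edges is an
    instance of [trim], and what remains is exactly [Zball]. *)
Lemma Zball_keeps : (exists y, sV Y y) -> keeps_homotopy (Zplus L) Zball.
Proof.
  intros [y Hy] u v p q Hp Hq H.
  assert (E0 : ends (y, []) y) by (split; [auto|reflexivity]).
  destruct (repr_mk L _ _ E0) as [u0 Hu0].
  set (cut := fun e : edg (U L) => ~ ballE e).
  assert (HY0 : sV (Yhat L) u0) by now exists y.
  assert (HYZ : subcx_le (U L) (Yhat L) (Zplus L)) by (eapply subcx_le_trans; [apply Zball_above|apply Zball_le]).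
  assert (HT : subcx_le (U L) Zball (trim (Yhat L) (Zplus L) cut)).
  { apply trim_contains; auto using Zball_sub, Zball_le, Zball_reach, Zplus_sub, Yhat_sub. }
  assert (HT' : subcx_le (U L) (trim (Yhat L) (Zplus L) cut) Zball).
  { assert (HE : forall e, trimE (Yhat L) (Zplus L) cut e -> ballE e).
    { intros e (_ & He & _). now apply NNPP. }
    split; [|split].
    - intros x (z & r & Hz & Hr & Hin). destruct r as [|d r] using rev_ind.
      + destruct Hr as (_ & Hr & _). simpl in Hr. subst x. now apply Yhat_ballV.
      + destruct Hr as (_ & Hr & _). apply (@path_ok_app (U L)) in Hr. destruct Hr as (x' & _ & Hr).
        destruct Hr as [_ Hr]. assert (Hb : ballE (fst d)).
        { apply NNPP. apply (Hin d). apply in_or_app; simpl; auto. }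
        simpl in Hr. subst x. destruct d as [e []]; apply Hb.
    - exact HE.
    - intros f [Hf Hd]. split; [exact Hf|]. intros d Hd'. apply HE. now apply Hd. }
  apply (homotopic_mono (trim (Yhat L) (Zplus L) cut)); auto.
  apply (trim_homotopy (Yhat L) (Zplus L) cut u0); auto using Zplus_sub, Yhat_sub.
  - apply Zplus_rel_trivial.
  - intros e He Hc. apply Hc. now apply Yhat_ballE.
  - intros f Hf d Hd Hc. apply Hc. eapply Zplus_faces_ball; eauto.
  - eapply path_in_mono; eauto.
  - eapply path_in_mono; eauto.
Qed.

Lemma Zplus_inv : inv_sub (uact L) (Zplus L).
Proof.
  split; [intros; exact I|split; [intros; exact I|]].
  intros h f _ [Hf|(k & y & g & f0 & HIn & Ef & Hb)].
  - left. now apply Yhat_inv.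
  - right. exists (gmul G h k), y, g, f0. split; auto. split.
    + simpl. change (uf (umapF h (incl_refl L) f)) with (af A h (uf f)). now rewrite Ef, afM.
    + pose proof (umapV_spec h (incl_refl L) _ _ Hb) as Q. unfold wact in Q; simpl in Q.
      rewrite <- avM, <- pmapM in Q. exact Q.
Qed.

Lemma ballV_inv h (v : uV L) : ballV v -> ballV (umapV h (incl_refl L) v).
Proof.
  intros (y & p & Hv & Hl). exists (av A h y), (pmap A h p). split.
  - exact (umapV_spec h (incl_refl L) _ _ Hv).
  - unfold pmap. now rewrite length_map.
Qed.

Lemma ballE_inv h (e : uE L) : ballE e -> ballE (umapE h (incl_refl L) e).
Proof.
  intros [H1 H2]. split; [exact (ballV_inv h _ H1)|]. rewrite utgt_umapE. now apply ballV_inv.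
Qed.

Lemma Zball_inv : inv_sub (uact L) Zball.
Proof.
  split; [intros h v _; apply ballV_inv|split; [intros h e _; apply ballE_inv|]].
  intros h f _ [Hf Hd]. split; [now apply Zplus_inv|].
  intros d Hd'. simpl in Hd'. rewrite ubnd_umapF in Hd'. apply in_map_iff in Hd'.
  destruct Hd' as (d' & <- & Hd'). apply ballE_inv. now apply Hd.
Qed.

Hypothesis Xlf : forall x, exists l : list (dart X), forall d, dsrc d = x -> In d l.
Hypothesis Xff : forall x, exists l : list (fc X), forall f, path_ok x (fbnd X f) x -> In f l.
Variable LY : list (vtx X).
Hypothesis HLY : forall v, sV Y v -> exists h y, In y LY /\ v = av A h y.

Lemma paths_finite k : forall x, exists l : list (list (dart X)),
  forall p v, path_ok x p v -> (length p <= k)%nat -> In p l.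
Proof.
  induction k as [|k IH]; intros x.
  - exists [[]]. intros [|d p] v _ H; simpl in *; [auto|lia].
  - destruct (Xlf x) as [ld Hld].
    assert (exists l, forall d p v, In d ld -> path_ok (dtgt d) p v -> (length p <= k)%nat -> In (d :: p) l)
      as [l Hl].
    { clear Hld. induction ld as [|d ld [l Hl]]; [exists []; simpl; tauto|].
      destruct (IH (dtgt d)) as [l' Hl']. exists (map (cons d) l' ++ l).
      intros d0 p v [<-|Hd] Hp Hlen; apply in_or_app; [left|right; eauto].
      apply in_map. eauto. }
    exists ([] :: l). intros [|d p] v Hp Hlen; simpl in *; [auto|]. right.
    destruct Hp as [Hd Hp]. eapply Hl; eauto. lia.
Qed.

Lemma fiber_cofinite {S T : gset G} (pr : S -> T) (DT : T -> Prop) (DS : S -> Prop) :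
  (forall h s, pr (ga h s) = ga h (pr s)) -> cofinite DT ->
  (forall t, exists l, forall s, pr s = t -> In s l) -> (forall s, DS s -> DT (pr s)) -> cofinite DS.
Proof.
  intros Heq [l Hl] Hfib HD.
  assert (exists l', forall t s, In t l -> pr s = t -> In s l') as [l' Hl'].
  { clear Hl. induction l as [|t l [l' IH]]; [exists []; simpl; tauto|].
    destruct (Hfib t) as [lt Hlt]. exists (lt ++ l').
    intros t' s [<-|Ht] E; apply in_or_app; eauto. }
  exists l'. intros s Hs. destruct (Hl _ (HD s Hs)) as (h & t & Ht & E).
  exists h, (ga (ginv G h) s). split; [|now rewrite gaVr].
  apply (Hl' t); auto. now rewrite Heq, E, gaV.
Qed.

(** Up to translation a vertex of the ball is represented by a word of length at most [n] starting
    in [LY], and there are finitely many of these; edges and 2-cells have finite fibres over their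
    base vertices since X is locally finite. *)
Lemma Zball_cofin : cofin_sub (uact L) Zball.
Proof.
  assert (CV : @cofinite G (gV (uact L)) ballV).
  { assert (exists lw : list word, forall y p v, In y LY -> path_ok y p v -> (length p <= n)%nat ->
        In (y, p) lw) as [lw Hlw].
    { clear HLY. induction LY as [|y l [lw IH]]; [exists []; simpl; tauto|].
      destruct (paths_finite n y) as [lp Hlp]. exists (map (fun p => (y, p)) lp ++ lw).
      intros z p v [<-|Hz] Hp Hlen; apply in_or_app; [left|right; eauto].
      apply (in_map (fun p => (y, p))). eauto. }
    assert (exists lv : list (uV L), forall w v, In w lw -> repr v w -> In v lv) as [lv Hlv].
    { clear. induction lw as [|w l [lv IH]]; [exists []; simpl; tauto|].
      destruct (classic (exists v : uV L, repr v w)) as [[v Hv]|Hn].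
      - exists (v :: lv). intros w' v' [<-|Hw] Hv'; [left; eapply repr_inj; eauto|right; eauto].
      - exists lv. intros w' v' [<-|Hw] Hv'; [exfalso; eauto|eauto]. }
    exists lv. intros v (y & p & Hv & Hlen). assert (E := upr_ends v _ Hv). destruct E as [E1 E2].
    destruct (HLY y E1) as (h & y0 & Hy0 & ->).
    exists h, (umapV (ginv G h) (incl_refl L) v). split.
    - apply (Hlv (y0, pmap A (ginv G h) p)).
      + apply (path_ok_pmap A (ginv G h)) in E2. simpl in E2. rewrite avV in E2.
        eapply Hlw; eauto. unfold pmap. now rewrite length_map.
      + pose proof (umapV_spec (ginv G h) (incl_refl L) v _ Hv) as E.
        unfold wact in E; simpl in E. now rewrite avV in E.
    - pose proof (@gaVr G (gV (uact L)) h v) as E. simpl in E. now symmetry. }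
  split; [exact CV|split].
  - apply (@fiber_cofinite (gE (uact L)) (gV (uact L)) usrc ballV); auto.
    + intros v. destruct (Xlf (upr v)) as [ld Hld].
      assert (Q : forall l : list (dart X), exists l' : list (uE L),
         forall e : uE L, usrc e = v -> In (ue e, true) l -> In e l').
      { induction l as [|d l [l' IH]]; [exists []; simpl; tauto|].
        destruct (classic (exists e : uE L, usrc e = v /\ (ue e, true) = d)) as [(e & He & Ed)|Hno].
        - exists (e :: l'). intros e' He' [E|E]; [left|right; eauto]. apply uE_ext; congruence.
        - exists l'. intros e' He' [E|E]; [exfalso; eauto|eauto]. }
      destruct (Q ld) as [l' Hl']. exists l'. intros e He. apply Hl'; auto. apply Hld.
      rewrite <- He. symmetry. apply upr_usrc.
    + intros e [He _]. exact He.
  - apply (@fiber_cofinite (gF (uact L)) (gV (uact L)) ubase ballV); auto.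
    + intros v. destruct (Xff (upr v)) as [ld Hld].
      assert (Q : forall l : list (fc X), exists l' : list (uF L),
         forall f : uF L, ubase f = v -> In (uf f) l -> In f l').
      { induction l as [|d l [l' IH]]; [exists []; simpl; tauto|].
        destruct (classic (exists f : uF L, ubase f = v /\ uf f = d)) as [(f & He & Ed)|Hno].
        - exists (f :: l'). intros e' He' [E|E]; [left|right; eauto]. apply uF_ext; congruence.
        - exists l'. intros e' He' [E|E]; [exfalso; eauto|eauto]. }
      destruct (Q ld) as [l' Hl']. exists l'. intros f Hf. apply Hl'; auto. apply Hld.
      rewrite <- Hf. apply (proj1 (proj2_sig f)).
    + intros f [_ Hd]. destruct (ubnd_spec f) as [H _]. destruct (ubnd_closed f) as [Hne _].
      destruct (ubnd f) as [|d l]; [congruence|]. destruct H as [<- _].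
      assert (Hb : ballE (fst d)) by (apply Hd; simpl; auto). destruct d as [e []]; apply Hb.
Qed.

Lemma Zball_admissible : (exists y, sV Y y) -> admissible (uact L) (Yhat L) Zball.
Proof.
  intros Hy. constructor.
  - apply Zball_sub.
  - apply Zball_above.
  - apply Zball_inv.
  - apply Zball_cofin.
  - apply Zball_reach.
  - eapply rel_trivial_keep; [apply Zball_le|apply Zball_above|now apply Zball_keeps|apply Zplus_rel_trivial].
Qed.

End Ball.

(** * Merging reduced complexes *)

Section Images.
Context {L L' : list pface} (HL : incl L L') (Z : subcx (U L)).

Definition img : subcx (U L') := Subcx (U L')
  (fun v' : uV L' => exists v, sV Z v /\ v' = umapV (gone G) HL v)
  (fun e' : uE L' => exists e, sE Z e /\ e' = umapE (gone G) HL e)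
  (fun f' : uF L' => exists f, sF Z f /\ f' = umapF (gone G) HL f).

Lemma repr_img (v : uV L) w : repr v w -> repr (umapV (gone G) HL v) w.
Proof. intros H. rewrite <- (wact1 w). now apply umapV_spec. Qed.

Lemma img_Yhat v : sV (Yhat L) v -> sV (Yhat L') (umapV (gone G) HL v).
Proof. intros [y Hy]. exists y. now apply repr_img. Qed.

Lemma map_upd_img p : map upd (map (umapD (gone G) HL) p) = map upd p.
Proof. rewrite map_upd_umapD. apply pmap1. Qed.

Hypothesis HZ : is_subcomplex (U L) Z.

Lemma img_sub : is_subcomplex (U L') img.
Proof.
  split.
  - intros e' (e & He & ->). destruct (proj1 HZ e He) as [H1 H2]. split.
    + exists (usrc e). split; auto.
    + exists (utgt e). split; [exact H2|]. apply utgt_umapE.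
  - intros f' (f & Hf & ->) d Hd. simpl in Hd. rewrite ubnd_umapF in Hd. apply in_map_iff in Hd.
    destruct Hd as (d' & <- & Hd'). exists (fst d'). split; auto. eapply (proj2 HZ); eauto.
Qed.

Lemma img_path u p v : path_in Z u p v ->
  path_in img (umapV (gone G) HL u) (map (umapD (gone G) HL) p) (umapV (gone G) HL v).
Proof.
  intros (Hu & Hp & Hin). split; [exists u; auto|]. split; [exact (upath_umapD _ _ _ _ _ Hp)|].
  intros d Hd. apply in_map_iff in Hd. destruct Hd as (d' & <- & Hd').
  exists (fst d'). split; [now apply Hin|reflexivity].
Qed.

Lemma img_reach : reach (Yhat L) Z -> reach (Yhat L') img.
Proof.
  intros H v' (v & Hv & ->). destruct (H v Hv) as (u & p & Hu & Hp).
  eexists. eexists. split; [apply img_Yhat; exact Hu|]. apply img_path; exact Hp.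
Qed.

(** Traversals that become equal have the same index and lie over the same 2-cell of X; since both
    run over the same edge upstairs, [U_corner_inj] shows that they were already equal. *)
Lemma img_reduced : reduced (Yhat L) Z -> reduced (Yhat L') img.
Proof.
  intros H e' (e & He & ->) HnY. destruct (H e He) as (t & t' & Hneq & Ht & Ht').
  { intros [H1 H2]. apply HnY. split; [|now apply img_Yhat].
    change (sE Y (ae A (gone G) (ue e))). now rewrite ae1. }
  assert (T : forall t, traverses Z e t ->
    traverses img (umapE (gone G) HL e) (umapF (gone G) HL (fst t), snd t)).
  { intros [f i] (Hf & d & Hd & Ed). split; [exists f; auto|].
    exists (umapD (gone G) HL d). split; [|exact (f_equal (umapE (gone G) HL) Ed)].
    cbn [fst snd] in *. change (nth_error (ubnd (umapF (gone G) HL f)) i = Some (umapD (gone G) HL d)).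
    rewrite ubnd_umapF. exact (map_nth_error _ _ _ Hd). }
  eexists. eexists. split; [|split; [apply T; exact Ht|apply T; exact Ht']].
  intros E. apply Hneq. destruct t as [f i], t' as [f' i']. cbn [fst snd] in E.
  assert (Ei := f_equal snd E). assert (Ef := f_equal fst E). cbn [fst snd] in Ei, Ef. subst i'.
  assert (Euf : uf f = uf f').
  { rewrite <- (af1 G X A (uf f)), <- (af1 G X A (uf f')). exact (f_equal uf Ef). }
  f_equal. destruct Ht as (_ & d & Hd & Ed), Ht' as (_ & d' & Hd' & Ed'). cbn [fst snd] in *.
  apply (U_corner_inj f f' i d d'); auto. f_equal.
  pose proof (ubnd_nth L _ _ _ Hd) as Q. pose proof (ubnd_nth L _ _ _ Hd') as Q'.
  rewrite Euf, Q' in Q. destruct d as [e1 b1], d' as [e2 b2]. simpl in *. subst. injection Q as Q.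
  congruence.
Qed.

Lemma img_Zplus : subcx_le (U L) Z (Zplus L) -> subcx_le (U L') img (Zplus L').
Proof.
  intros (_ & _ & H). split; [intros; exact I|split; [intros; exact I|]].
  intros f' (f & Hf & ->). destruct (H f Hf) as [[H1 H2]|(h & y & g & f0 & HIn & Ef & Hb)].
  - left. split; [|now apply img_Yhat]. change (sF Y (af A (gone G) (uf f))). now rewrite af1.
  - right. exists h, y, g, f0. split; auto. split; [|now apply repr_img].
    change (af A (gone G) (uf f) = af A h f0). now rewrite af1.
Qed.

(** A path of length at most r from [Yhat] exhibits the image of a vertex as a word of length at
    most [n], whichever list is used; this is where a uniform radius is required. *)
Lemma img_ball n r : (r <= n)%nat -> subcx_le (U L) Z (Zplus L) ->
  (forall v, sV Z v -> exists u p, sV (Yhat L) u /\ path_in Z u p v /\ (length p <= r)%nat) ->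
  subcx_le (U L') img (Zball L' n).
Proof.
  intros Hr HP Hrad.
  assert (HV : forall v, sV Z v -> ballV L' n (umapV (gone G) HL v)).
  { intros v Hv. destruct (Hrad v Hv) as (u & p & [y Hy] & Hp & Hl).
    exists y, (map upd p). split; [|rewrite length_map; exact (Nat.le_trans _ _ _ Hl Hr)].
    apply repr_img. exact (upath_repr _ _ _ _ (proj1 (proj2 Hp)) Hy). }
  assert (HE : forall e, sE Z e -> ballE L' n (umapE (gone G) HL e)).
  { intros e He. destruct (proj1 HZ e He) as [H1 H2]. split; [now apply HV|].
    rewrite utgt_umapE. now apply HV. }
  split; [|split].
  - intros v' (v & Hv & ->). exact (HV v Hv).
  - intros e' (e & He & ->). exact (HE e He).
  - intros f' (f & Hf & ->). split; [apply img_Zplus; auto; exists f; auto|].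
    intros d Hd. rewrite ubnd_umapF in Hd. apply in_map_iff in Hd. destruct Hd as (d' & <- & Hd').
    apply HE. eapply (proj2 HZ); eauto.
Qed.

End Images.

(** * The union of the reduced complexes and its simple connectivity *)

Section Core.
Variables (K : nat) (LY : list (vtx X)) (ang : fc X -> nat -> R) (alpha m : R) (Rad : nat).
Hypothesis HK : stab_bound A K.
Hypothesis Xlf : forall x, exists l : list (dart X), forall d, dsrc d = x -> In d l.
Hypothesis Xff : forall x, exists l : list (fc X), forall f, path_ok x (fbnd X f) x -> In f l.
Hypothesis HLY : forall v, sV Y v -> exists h y, In y LY /\ v = av A h y.
Hypothesis Hang : invariant_angles G X A ang.
Hypothesis Hcurv : sectional_curvature_le X ang alpha.
Hypothesis Halpha : alpha < 0.
Hypothesis m_pos : 0 <= m.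
Hypothesis Hm : forall v Lc, NoDup Lc -> (forall c, In c Lc -> corner_at v c) ->
  sum_R (map (fun c => Rabs (PI - ang (fst c) (snd c))) Lc) <= m.
Hypothesis HRad : INR K * (INR (length LY) * m) <= - alpha * INR Rad.
Hypothesis Xsc : simply_connected X (full X).
Hypothesis Yconn : connected X Y.

Definition good L (Z : subcx (U L)) : Prop :=
  admissible (uact L) (Yhat L) Z /\ reduced (Yhat L) Z /\ subcx_le (U L) Z (Zplus L).

Lemma good_radius L Z : good L Z ->
  forall v, sV Z v -> exists u p, sV (Yhat L) u /\ path_in Z u p v /\ (length p <= Rad)%nat.
Proof.
  intros ([S1 S2 S3 S4 S5 S6] & HR & _).
  destruct (Yhat_reps L LY HLY) as (LY' & Hl & HLY').
  apply (radius_bound (uact L) K (Yhat L) Z (uang L ang) alpha m LY' Rad); auto.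
  - now apply stab_bound_U.
  - apply Yhat_sub.
  - apply Yhat_inv.
  - now apply uang_inv.
  - now apply curvature_U.
  - intros v Lc _ N Hc. apply (corner_mass_U L ang m v); [intros Lc'; apply Hm|exact N|exact Hc].
  - etransitivity; [|exact HRad]. apply Rmult_le_compat_l; [apply pos_INR|].
    apply Rmult_le_compat_r; auto. now apply le_INR.
Qed.

(** Take the reduction of a ball for the joint list. Both images are reduced, reachable from [Yhat]
    and, by the uniform radius, inside the ball, so they survive. [Lc] supplies further 2-cells, to
    be chosen so that a prescribed homotopy lifts. *)
Lemma merge L1 Z1 L2 Z2 Lc : good L1 Z1 -> good L2 Z2 ->
  exists L' (H1 : incl L1 L') (H2 : incl L2 L') Z', incl Lc L' /\ good L' Z' /\
    subcx_le (U L') (img H1 Z1) Z' /\ subcx_le (U L') (img H2 Z2) Z' /\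
    keeps_homotopy (Zplus L') Z'.
Proof.
  intros G1 G2. set (L' := L1 ++ L2 ++ Lc).
  assert (H1 : incl L1 L') by (intros x Hx; apply in_or_app; auto).
  assert (H2 : incl L2 L') by (intros x Hx; apply in_or_app; right; apply in_or_app; auto).
  assert (H3 : incl Lc L') by (intros x Hx; apply in_or_app; right; apply in_or_app; auto).
  (* Large enough for the images of both complexes and for all listed 2-cells. *)
  assert (exists n, (Rad <= n)%nat /\
    forall y g f, In (y, g, f) L' -> (length g + length (fbnd X f) <= n)%nat) as (n & Hn & Hbd).
  { clear. induction L' as [|[[y g] f] l (n & Hn & IH)]; [exists Rad; simpl; split; [lia|tauto]|].
    exists (n + length g + length (fbnd X f))%nat. split; [lia|].
    intros y' g' f' [E|E]; [injection E as <- <- <-; lia|]. specialize (IH _ _ _ E). lia. }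
  assert (Yne : exists y, sV Y y) by apply Yconn. assert (Yne' := Yne). destruct Yne' as [y Hy].
  destruct (repr_mk L' (y, []) y) as [u0 Hu0]; [split; [auto|reflexivity]|].
  assert (AB : admissible (uact L') (Yhat L') (Zball L' n)) by (eapply Zball_admissible; eauto).
  destruct (adm_cof _ _ _ AB) as (_ & [Le HLe] & _).
  destruct (reduction (uact L') (Yhat L') u0 (Yhat_sub L') (ex_intro _ y Hu0) (Yhat_inv L')
    (length Le) (Zball L' n) Le AB HLe (le_n _)) as (Z' & AZ & LZ & RZ & BZ & KZ).
  exists L', H1, H2, Z'. split; auto.
  assert (KP : keeps_homotopy (Zplus L') Z').
  { intros u v p q Hp Hq H. apply KZ; auto. eapply Zball_keeps; eauto; eapply path_in_mono; eauto. }
  split; [split; [auto|split; auto]|].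
  - eapply subcx_le_trans; [exact LZ|]. apply Zball_le.
  - assert (Q : forall L Z (H : incl L L'), good L Z -> subcx_le (U L') (img H Z) Z').
    { intros L Z H HG. assert (HR := good_radius L Z HG).
      destruct HG as ([S1 S2 S3 S4 S5 S6] & HRd & HP). apply BZ.
      - now apply img_sub.
      - now apply (img_ball H Z S1 n Rad).
      - now apply img_reach.
      - now apply img_reduced. }
    auto.
Qed.

Lemma good_exists : exists L Z, good L Z.
Proof.
  assert (Yne : exists y, sV Y y) by apply Yconn. assert (Yne' := Yne). destruct Yne' as [y Hy].
  destruct (repr_mk [] (y, []) y) as [u0 Hu0]; [split; [auto|reflexivity]|].
  assert (AB : admissible (uact []) (Yhat []) (Zball [] 0)).
  { eapply Zball_admissible; eauto. simpl. tauto. }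
  destruct (adm_cof _ _ _ AB) as (_ & [Le HLe] & _).
  destruct (reduction (uact []) (Yhat []) u0 (Yhat_sub []) (ex_intro _ y Hu0) (Yhat_inv [])
    (length Le) (Zball [] 0) Le AB HLe (le_n _)) as (Z' & AZ & LZ & RZ & _).
  exists [], Z'. split; [auto|split; auto]. eapply subcx_le_trans; [exact LZ|]. apply Zball_le.
Qed.

Definition core : subcx X := Subcx X
  (fun x => exists L Z (v : uV L), good L Z /\ sV Z v /\ upr v = x)
  (fun e => exists L Z (e' : uE L), good L Z /\ sE Z e' /\ ue e' = e)
  (fun f => exists L Z (f' : uF L), good L Z /\ sF Z f' /\ uf f' = f).

Lemma good_sub L Z : good L Z -> is_subcomplex (U L) Z.
Proof. intros [H _]. apply H. Qed.

Lemma core_sub : is_subcomplex X core.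
Proof.
  split.
  - intros e (L & Z & e' & HG & He & <-). destruct (proj1 (good_sub _ _ HG) e' He) as [H1 H2].
    split; exists L, Z.
    + exists (usrc e'). split; auto. split; [exact H1|apply upr_usrc].
    + exists (utgt e'). split; auto. split; [exact H2|apply upr_utgt].
  - intros f (L & Z & f' & HG & Hf & <-) d Hd.
    destruct (ubnd_spec f') as [_ E]. rewrite <- E in Hd. apply in_map_iff in Hd.
    destruct Hd as (d' & <- & Hd'). exists L, Z, (fst d'). split; auto. split; [|reflexivity].
    eapply (proj2 (good_sub _ _ HG)); eauto.
Qed.

Lemma core_path L Z u p v : good L Z -> path_in Z u p v -> path_in core (upr u) (map upd p) (upr v).
Proof.
  intros HG (Hu & Hp & Hin). split; [exists L, Z, u; auto|]. split; [now apply upath_upr|].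
  intros d Hd. apply in_map_iff in Hd. destruct Hd as (d' & <- & Hd').
  exists L, Z, (fst d'). split; [exact HG|split; [now apply Hin|reflexivity]].
Qed.

Lemma core_homotopy L Z u v p q : good L Z -> homotopic Z u v p q ->
  homotopic core (upr u) (upr v) (map upd p) (map upd q).
Proof.
  intros HG H.
  assert (E : forall l : list (udart L), flat_map (fun d => [upd d]) l = map upd l).
  { induction l; simpl; congruence. }
  rewrite <- !E.
  apply (@transport_homotopy (U L) X Z core upr (fun d => [upd d]) (good_sub _ _ HG) core_sub); auto.
  - intros w Hw. exists L, Z, w. auto.
  - intros d Hd. change (path_in core (upr (uds d)) [upd d] (upr (udt d))). rewrite upr_uds, upr_udt.
    apply path_in_single; [apply core_sub|]. exists L, Z, (fst d). auto.
  - intros d Hd. change (homotopic core (upr (uds d)) (upr (uds d)) ([upd d] ++ pinv [upd d]) []).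
    rewrite upr_uds. eapply homotopic_cancel; [apply core_sub|].
    apply path_in_single; [apply core_sub|]. exists L, Z, (fst d). auto.
  - intros f w Hf Hw. rewrite E. assert (w = ubase f) by now apply U_bnd_base. subst w.
    destruct (ubnd_spec f) as [H1 E1]. change (map upd (ubnd f)) with (map upd (fbnd (U L) f)) in E1.
    rewrite E1. apply homotopic_fbnd; [apply core_sub|exists L, Z, f; auto|].
    rewrite <- E1. now apply upath_upr.
Qed.

Lemma core_above : subcx_le X Y core.
Proof.
  destruct good_exists as (L & Z & HG).
  destruct (adm_above _ _ _ (proj1 HG)) as (A1 & A2 & A3).
  assert (Hv : forall y, sV Y y -> exists v : uV L, repr v (y, []) /\ upr v = y).
  { intros y Hy. destruct (repr_mk L (y, []) y) as [v Hv]; [split; [auto|reflexivity]|].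
    exists v. split; auto. now apply (repr_base_Y L). }
  split; [|split].
  - intros y Hy. destruct (Hv y Hy) as (v & H1 & H2). exists L, Z, v. split; auto. split; auto.
    apply A1. now exists y.
  - intros e He. destruct (Hv (esrc X e)) as (v & H1 & H2); [now apply HY|].
    exists L, Z, (exist _ (v, e) H2). split; auto. split; [|reflexivity].
    apply A2. split; [exact He|]. now exists (esrc X e).
  - intros f Hf. destruct (fbnd_loop f) as [y Hy].
    assert (Hp := fbnd_path_in Y f y HY Hf Hy).
    destruct (Hv y) as (v & H1 & H2); [apply Hp|].
    destruct (mkface v f) as (f' & Eb & Ef).
    + now rewrite H2.
    + intros w Hw. apply (repr_weq v w); auto.
      apply (rst_trans _ _ _ (y, [])); [now apply (repr_weq v w)|]. apply rst_sym.
      eapply rst_trans; [apply weq_wapp, (repr_weq v w _ Hw); exact H1|].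
      apply rst_step. pose proof (ws_base L y (fbnd X f) y [] Hp) as Q. rewrite app_nil_r in Q. exact Q.
    + exists L, Z, f'. split; auto. split; auto. apply A3. split; [now rewrite Ef|].
      exists y. now rewrite Eb.
Qed.

Lemma core_inv : inv_sub A core.
Proof.
  split; [|split].
  - intros h x _ (L & Z & v & HG & Hv & <-). exists L, Z, (umapV h (incl_refl L) v).
    split; auto. split; [|apply upr_umapV].
    exact (proj1 (adm_inv _ _ _ (proj1 HG)) h v I Hv).
  - intros h x _ (L & Z & v & HG & Hv & <-). exists L, Z, (umapE h (incl_refl L) v).
    split; auto. split; [|reflexivity].
    exact (proj1 (proj2 (adm_inv _ _ _ (proj1 HG))) h v I Hv).
  - intros h x _ (L & Z & v & HG & Hv & <-). exists L, Z, (umapF h (incl_refl L) v).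
    split; auto. split; [|reflexivity].
    exact (proj2 (proj2 (adm_inv _ _ _ (proj1 HG))) h v I Hv).
Qed.

Lemma core_near x : sV core x -> exists y p, sV Y y /\ path_in core y p x /\ (length p <= Rad)%nat.
Proof.
  intros (L & Z & v & HG & Hv & <-). destruct (good_radius L Z HG v Hv) as (u & p & [y Hy] & Hp & Hl).
  destruct (repr_base_Y L u y Hy) as [H1 H2]. exists y, (map upd p). split; auto.
  split; [|now rewrite length_map]. rewrite <- H2. now apply (core_path L Z).
Qed.

Lemma core_cofin : cofin_sub A core.
Proof.
  assert (CV : @cofinite G (gV A) (sV core)).
  { assert (exists lv : list (vtx X), forall y p v, In y LY -> path_ok y p v -> (length p <= Rad)%nat ->
        In v lv) as [lv Hlv].
    { clear HLY HRad. induction LY as [|y l [lw IH]]; [exists []; simpl; tauto|].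
      destruct (paths_finite Xlf Rad y) as [lp Hlp].
      (* The end of a path is the target of its last dart. *)
      exists (map (fun p => match rev p with [] => y | d :: _ => dtgt d end) lp ++ lw).
      intros z p v [<-|Hz] Hp Hlen; apply in_or_app; [left|right; eauto].
      apply in_map_iff. exists p. split; [|eauto].
      destruct p as [|d p] using rev_ind; [exact Hp|]. rewrite rev_app_distr. simpl.
      apply path_ok_app in Hp. destruct Hp as (w & _ & Hd). apply Hd. }
    exists lv. intros x Hx. destruct (core_near x Hx) as (y & p & Hy & Hp & Hl).
    destruct (HLY y Hy) as (h & y0 & Hy0 & ->). exists h, (av A (ginv G h) x). split.
    - destruct Hp as (_ & Hp & _). apply (path_ok_pmap A (ginv G h)) in Hp. rewrite avV in Hp.
      eapply Hlv; eauto. unfold pmap. now rewrite length_map.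
    - symmetry. exact (@gaVr G (gV A) h x). }
  split; [exact CV|split].
  - apply (@fiber_cofinite (gE A) (gV A) (esrc X) (sV core)); auto.
    + intros h e. apply ae_src.
    + intros x. destruct (Xlf x) as [l Hl]. exists (map fst l). intros e He.
      apply (in_map fst l (e, true)). apply Hl. exact He.
    + intros e He. now apply core_sub.
  - set (base := fun f : fc X => proj1_sig (constructive_indefinite_description _ (fbnd_loop f))).
    assert (Hb : forall f, path_ok (base f) (fbnd X f) (base f)).
    { intros f. unfold base. now destruct (constructive_indefinite_description _ _). }
    assert (Hu : forall f v, path_ok v (fbnd X f) v -> v = base f).
    { intros f v Hv. specialize (Hb f). destruct (fbnd_closed X f) as [Hne _].
      destruct (fbnd X f); [congruence|]. destruct Hv as [<- _], Hb as [<- _]. reflexivity. }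
    apply (@fiber_cofinite (gF A) (gV A) base (sV core)); auto.
    + intros h f. symmetry. apply Hu. simpl. rewrite fbnd_af. now apply path_ok_pmap.
    + intros x. destruct (Xff x) as [l Hl]. exists l. intros f Hf. apply Hl. rewrite <- Hf. apply Hb.
    + intros f Hf. apply (fbnd_path_in core f); auto. apply core_sub.
Qed.

(** The place where simple connectivity of X enters. *)
Lemma X_homotopic u v p q : path_ok u p v -> path_ok u q v -> homotopic (full X) u v p q.
Proof.
  intros Hp Hq. assert (HS : is_subcomplex X (full X)) by (split; simpl; auto).
  apply homotopic_loop; auto; try now apply path_in_full.
  apply Xsc. apply path_in_full. apply path_ok_app. exists v. split; auto. now apply path_ok_pinv.
Qed.

(* One merge per edge: the homotopy added to the list of pointed 2-cells makes the end of the
   path lifted so far meet the next edge. *)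
Lemma core_lift x p z : path_in core x p z -> exists L Z y g (u v : uV L) p',
  good L Z /\ sV Y y /\ path_ok y g x /\ repr u (y, []) /\ path_in Z u p' v /\ map upd p' = g ++ p.
Proof.
  revert z. induction p as [|d p IH] using rev_ind; intros z Hp.
  - destruct Hp as ((L & Z & v & HG & Hv & <-) & _ & _).
    destruct (adm_reach _ _ _ (proj1 HG) v Hv) as (u & p' & [y Hy] & Hp').
    destruct (repr_base_Y L u y Hy) as [H1 H2].
    exists L, Z, y, (map upd p'), u, v, p'. split; auto. split; auto. split.
    + rewrite <- H2. apply upath_upr. apply Hp'.
    + split; auto. split; auto. now rewrite app_nil_r.
  - apply path_in_app in Hp; [|apply core_sub]. destruct Hp as (x' & Hp & Hd).
    destruct (IH x' Hp) as (L1 & Z1 & y & g & u & v & p' & HG1 & Hy & Hg & Hu & Hp' & Ep').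
    destruct Hd as (_ & Hdok & Hin). rewrite path_ok_cons, path_ok_nil in Hdok. destruct Hdok as [Ed _].
    destruct (Hin d) as (L2 & Z2 & e' & HG2 & He' & Ee'); [simpl; auto|].
    set (d' := (e', snd d) : udart L2).
    assert (Ed' : upd d' = d) by (unfold upd, d'; simpl; rewrite Ee'; now destruct d).
    assert (S2 := good_sub _ _ HG2).
    assert (Hsd : sV Z2 (uds d')) by (apply (@sV_dsrc (U L2) Z2 d' S2); exact He').
    destruct (adm_reach _ _ _ (proj1 HG2) _ Hsd) as (u2 & p2 & [y2 Hy2] & Hp2).
    destruct (repr_base_Y L2 u2 y2 Hy2) as [H1 H2].
    destruct (proj2 Yconn y y2 Hy H1) as (q & Hq).
    assert (E2 : upr (uds d') = x') by (rewrite upr_uds, Ed'; exact Ed).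
    assert (Hg2 : path_ok y2 (map upd p2) x').
    { rewrite <- H2, <- E2. apply upath_upr. apply Hp2. }
    assert (Hgp : path_ok y (g ++ p) x') by (apply path_ok_app; exists x; split; [auto|apply Hp]).
    assert (Hqg : path_ok y (q ++ map upd p2) x').
    { apply path_ok_app. exists y2. split; [apply Hq|auto]. }
    (* Two paths from [y] to the start of [d] are compared: the one lifted so far, and one through Y
       and the complex that contains a lift of [d]. *)
    destruct (homotopy_lift _ _ _ _ (X_homotopic _ _ _ _ Hgp Hqg) Hgp) as (Lc & HLc).
    destruct (merge L1 Z1 L2 Z2 Lc HG1 HG2) as (L' & I1 & I2 & Z' & Ic & HG & B1 & B2 & _).
    assert (P1 := path_in_mono _ _ _ _ _ B1 (img_path I1 Z1 _ _ _ Hp')).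
    assert (P2 := img_path I2 Z2 _ _ _ Hp2).
    assert (R1 := repr_img I1 _ _ Hu). assert (R2 := repr_img I2 _ _ Hy2).
    destruct (upath_lift (umapV (gone G) I1 u) q y2) as (q' & v' & Hq' & Eq').
    { destruct (repr_base_Y L' _ _ R1) as [_ ->]. apply Hq. }
    rewrite <- Eq' in Hq. destruct (lift_in_Y L' _ _ _ _ _ Hq' R1 Hq) as [_ Rv'].
    assert (v' = umapV (gone G) I2 u2) by eauto using repr_inj. subst v'.
    assert (Eend : umapV (gone G) I1 v = umapV (gone G) I2 (uds d')).
    { apply (HLc L' Ic (umapV (gone G) I1 u) _ _ (map (umapD (gone G) I1) p')
        (q' ++ map (umapD (gone G) I2) p2)); auto.
      - apply P1.
      - now rewrite map_upd_img.
      - apply upath_app. eexists. split; [exact Hq'|apply P2].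
      - now rewrite map_app, map_upd_img, Eq'. }
    exists L', Z', y, g, (umapV (gone G) I1 u), (udt (umapD (gone G) I2 d')),
      (map (umapD (gone G) I1) p' ++ [umapD (gone G) I2 d']).
    split; auto. split; auto. split; auto. split; auto. split.
    + refine (proj2 (@path_in_app (U L') Z' _ _ _ _ (good_sub _ _ HG)) _). exists (umapV (gone G) I1 v). split; [exact P1|].
      rewrite Eend, <- uds_umapD. apply (@path_in_single (U L') Z' (umapD (gone G) I2 d')).
      * now apply good_sub.
      * apply B2. exists e'. split; auto.
    + rewrite map_app, map_upd_img, Ep', <- app_assoc. do 2 f_equal. simpl.
      rewrite upd_umapD, Ed'. f_equal. destruct d. unfold dmap; simpl. now rewrite ae1.
Qed.

(** For a loop p lift g p, where g leads from Y to the base point. In X this path is homotopic to g;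
    after one more merge the homotopy lifts, so the lift of p closes up and contracts in a reduced
    complex, whose image lies in the core. *)
Lemma core_simply_connected : simply_connected X core.
Proof.
  split; [split|].
  - destruct (proj1 Yconn) as [y Hy]. exists y. now apply core_above.
  - intros x x' Hx Hx'. destruct (core_near x Hx) as (y & p & Hy & Hp & _).
    destruct (core_near x' Hx') as (y' & p' & Hy' & Hp' & _).
    destruct (proj2 Yconn y y' Hy Hy') as (q & Hq).
    exists (pinv p ++ q ++ p'). apply path_in_app; [apply core_sub|]. exists y. split.
    + apply path_in_pinv; auto. apply core_sub.
    + apply path_in_app; [apply core_sub|]. exists y'. split; auto.
      eapply path_in_mono; [apply core_above|exact Hq].
  - intros x p Hp.
    destruct (core_lift x p x Hp) as (L & Z & y & g & u & v & p' & HG & Hy & Hg & Hu & Hp' & Ep').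
    assert (Hgp : path_ok y (g ++ p) x) by (apply path_ok_app; exists x; split; [auto|apply Hp]).
    destruct (homotopy_lift _ _ _ _ (X_homotopic _ _ _ _ Hgp Hg) Hgp) as (Lc & HLc).
    destruct (merge L Z L Z Lc HG HG) as (L' & I1 & _ & Z' & Ic & HG' & B1 & _ & KP).
    assert (P1 := path_in_mono _ _ _ _ _ B1 (img_path I1 Z _ _ _ Hp')).
    assert (R1 := repr_img I1 _ _ Hu). assert (S' := good_sub _ _ HG').
    apply map_split in Ep'. destruct Ep' as (gh & ph & -> & Eg & Ep).
    rewrite map_app in P1. apply (@path_in_app (U L') Z') in P1; auto. destruct P1 as (w & Pg & Pp).
    assert (Egi : map upd (map (umapD (gone G) I1) gh) = g) by now rewrite map_upd_img.
    assert (Epi : map upd (map (umapD (gone G) I1) ph) = p) by now rewrite map_upd_img.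
    set (gi := map (umapD (gone G) I1) gh) in *. set (pi := map (umapD (gone G) I1) ph) in *.
    set (ui := umapV (gone G) I1 u) in *. set (vi := umapV (gone G) I1 v) in *.
    (* Lifts of homotopic paths from one vertex have the same end, so the lift of [p] is closed. *)
    destruct (HLc L' Ic ui vi w (gi ++ pi) gi) as [Ev Hh]; auto.
    + apply upath_app. exists w. split; [apply Pg|apply Pp].
    + rewrite map_app. congruence.
    + apply Pg.
    + rewrite Ev in *.
      assert (Hh' : @homotopic (U L') Z' ui w (gi ++ pi) gi).
      { apply KP; auto. refine (proj2 (@path_in_app (U L') Z' _ _ _ _ S') _). eauto. }
      assert (Hnull : @homotopic (U L') Z' w w pi []).
      { assert (Pg' := path_in_pinv _ _ _ _ S' Pg).
        apply (rst_trans _ _ _ (@pinv (U L') gi ++ gi ++ pi)).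
        - rewrite app_assoc. apply rst_sym.
          eapply (@homotopic_app_r (U L') Z' w w w pi (@pinv (U L') gi ++ gi) []); auto; [apply Pg'|].
          eapply homotopic_cancel'; eauto.
        - eapply rst_trans; [eapply (@homotopic_app_l (U L') Z'); [auto|exact Pg'|exact (proj1 Pg')|exact Hh']|].
          eapply homotopic_cancel'; eauto. }
      apply (core_homotopy L' Z' _ _ _ _ HG') in Hnull. rewrite Epi in Hnull. simpl in Hnull.
      assert (upr w = x).
      { pose proof (upath_upr _ _ _ (proj1 (proj2 Pg))) as Q. rewrite Egi in Q.
        destruct (repr_base_Y L' _ _ R1) as [_ E]. fold ui in E. rewrite E in Q.
        eauto using path_ok_fun. }
      subst x. exact Hnull.
Qed.

End Core.

End Words.

(** * Restriction to the subgroup *)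

Section Subgroup.
Context {G : group} (H : G -> Prop) (HS : subgroup G H).

Lemma sub_ext (a b : {g : G | H g}) : proj1_sig a = proj1_sig b -> a = b.
Proof. apply eq_sig_hprop. intros; apply proof_irrelevance. Qed.

Definition subgrp : group.
Proof.
  refine (Group {g : G | H g}
    (fun a b => exist _ (gmul G (proj1_sig a) (proj1_sig b))
       (proj1 (proj2 HS) _ _ (proj2_sig a) (proj2_sig b)))
    (exist _ (gone G) (proj1 HS))
    (fun a => exist _ (ginv G (proj1_sig a)) (proj2 (proj2 HS) _ (proj2_sig a))) _ _ _).
  - intros a b c. apply sub_ext, gmulA.
  - intros a. apply sub_ext, gmul1.
  - intros a. apply sub_ext, gmulV.
Defined.

Context {X : complex} (A : action G X).

Definition subact : action subgrp X :=
  Action subgrp X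
    (fun h => av A (proj1_sig h)) (fun h => ae A (proj1_sig h)) (fun h => af A (proj1_sig h))
    (av1 G X A) (ae1 G X A) (af1 G X A)
    (fun g h => avM G X A (proj1_sig g) (proj1_sig h))
    (fun g h => aeM G X A (proj1_sig g) (proj1_sig h))
    (fun g h => afM G X A (proj1_sig g) (proj1_sig h))
    (fun h => ae_src G X A (proj1_sig h)) (fun h => ae_tgt G X A (proj1_sig h))
    (fun h => af_bnd G X A (proj1_sig h)).

Lemma sub_list (l : list G) : exists l' : list subgrp, (length l' <= length l)%nat /\
  forall h : subgrp, In (proj1_sig h) l -> In h l'.
Proof.
  induction l as [|g l (l' & Hl & IH)]; [exists []; split; [auto|simpl; tauto]|].
  destruct (classic (H g)) as [Hg|Hg].
  - exists (exist _ g Hg :: l'). split; [exact (le_n_S _ _ Hl)|].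
    intros h [E|E]; [left; apply sub_ext; exact E|right; auto].
  - exists l'. split; [exact (le_S _ _ Hl)|]. intros h [E|E]; [|auto].
    exfalso. apply Hg. rewrite E. exact (proj2_sig h).
Qed.

Lemma stab_bound_subact K : stab_bound A K -> stab_bound subact K.
Proof.
  intros (K1 & K2 & K3). split; [|split]; intros s.
  - destruct (K1 s) as (l & Hl & HK). destruct (sub_list l) as (l' & Hl' & HK').
    exists l'. split; [lia|]. intros h E. apply HK', HK. exact E.
  - destruct (K2 s) as (l & Hl & HK). destruct (sub_list l) as (l' & Hl' & HK').
    exists l'. split; [lia|]. intros h E. apply HK', HK. exact E.
  - destruct (K3 s) as (l & Hl & HK). destruct (sub_list l) as (l' & Hl' & HK').
    exists l'. split; [lia|]. intros h E. apply HK', HK. exact E.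
Qed.

Lemma inv_subact (S : subcx X) : invariant G X A H S <-> inv_sub subact S.
Proof.
  split; intros (I1 & I2 & I3); split; [| split | |split].
  - intros h x _. exact (I1 _ x (proj2_sig h)).
  - intros h x _. exact (I2 _ x (proj2_sig h)).
  - intros h x _. exact (I3 _ x (proj2_sig h)).
  - intros h x Hh. exact (I1 (exist _ h Hh) x I).
  - intros h x Hh. exact (I2 (exist _ h Hh) x I).
  - intros h x Hh. exact (I3 (exist _ h Hh) x I).
Qed.

(** [cocompact_in] asks for representatives inside the subcomplex, which [cofinite] does not; by
    invariance those outside can be discarded. *)
Lemma cofinite_inner {T : gset subgrp} (D : T -> Prop) : cofinite D -> invar D ->
  exists l, (forall x, In x l -> D x) /\ forall x, D x -> exists h y, In y l /\ x = ga h y.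
Proof.
  intros [l Hl] HD. exists (filterP D l). split.
  - intros x Hx. now apply filterP_In in Hx.
  - intros x Hx. destruct (Hl x Hx) as (h & y & Hy & E). exists h, y. split; auto.
    apply filterP_In. split; auto. apply (invar_iff D HD h). now rewrite <- E.
Qed.

Lemma cocompact_subact (S : subcx X) : cofin_sub subact S -> inv_sub subact S ->
  cocompact_in G X A H S.
Proof.
  intros (C1 & C2 & C3) (I1 & I2 & I3).
  destruct (@cofinite_inner (gV subact) (sV S) C1 (fun h s => I1 h s I)) as (l1 & L1 & L1').
  destruct (@cofinite_inner (gE subact) (sE S) C2 (fun h s => I2 h s I)) as (l2 & L2 & L2').
  destruct (@cofinite_inner (gF subact) (sF S) C3 (fun h s => I3 h s I)) as (l3 & L3 & L3').
  exists l1, l2, l3. repeat (split; [assumption|]).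
  split; [|split]; intros x Hx; [destruct (L1' x Hx) as (h & y & Hy & E)
    |destruct (L2' x Hx) as (h & y & Hy & E)|destruct (L3' x Hx) as (h & y & Hy & E)];
    exists (proj1_sig h), y; (split; [exact (proj2_sig h)|split; [exact Hy|exact E]]).
Qed.

End Subgroup.

(** * Finiteness from proper cocompact actions *)

(** Stabilisers along an orbit are conjugate, so finitely many orbits give a uniform bound. Allowing
    every larger [K'] lets the bounds for vertices, edges and 2-cells be replaced by their sum. *)
Lemma stab_le_of_finite {G : group} (S : gset G) : cofinite (fun _ : S => True) ->
  (forall s : S, exists l : list G, forall h, ga h s = s -> In h l) ->
  exists K, forall K', (K <= K')%nat -> stab_le S K'.
Proof.
  intros [l Hl] Hfin.
  assert (exists K, forall y, In y l -> exists l' : list G, (length l' <= K)%nat /\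
     forall h, ga h y = y -> In h l') as [K HK].
  { clear Hl. induction l as [|y l [K IH]]; [exists 0%nat; simpl; tauto|].
    destruct (Hfin y) as [ly Hly]. exists (K + length ly)%nat. intros z [<-|Hz].
    - exists ly. split; [lia|auto].
    - destruct (IH z Hz) as (l' & Hl' & H). exists l'. split; [lia|auto]. }
  exists K. intros K' HKK' s. destruct (Hl s I) as (h & y & Hy & ->).
  destruct (HK y Hy) as (l' & Hl' & H).
  exists (map (fun k => gmul G (gmul G h k) (ginv G h)) l'). split; [rewrite length_map; lia|].
  intros k E. replace k with (gmul G (gmul G h (gmul G (gmul G (ginv G h) k) h)) (ginv G h)).
  - apply in_map_iff. eexists. split; [reflexivity|]. apply H.
    rewrite !gaM, E. apply gaV.
  - rewrite !gmulA, gmulVr, gmul1, <- gmulA, gmulVr. apply gmul1r.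
Qed.

Section Cocompact.
Context {G : group} {X : complex} (A : action G X).
Hypothesis Hprop : proper_action G X A.
Hypothesis Hcoc : cocompact_in G X A (fun _ => True) (full X).

Lemma full_cofin : cofin_sub A (full X).
Proof.
  destruct Hcoc as (l1 & l2 & l3 & _ & _ & _ & H1 & H2 & H3). split; [|split].
  - exists l1. intros s Hs. destruct (H1 s Hs) as (h & y & _ & Hy & E). eauto.
  - exists l2. intros s Hs. destruct (H2 s Hs) as (h & y & _ & Hy & E). eauto.
  - exists l3. intros s Hs. destruct (H3 s Hs) as (h & y & _ & Hy & E). eauto.
Qed.

Lemma proper_stab_bound : exists K, stab_bound A K.
Proof.
  destruct full_cofin as (C1 & C2 & C3), Hprop as (P1 & P2 & P3).
  destruct (stab_le_of_finite (gV A) C1 P1) as [K1 H1].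
  destruct (stab_le_of_finite (gE A) C2 P2) as [K2 H2].
  destruct (stab_le_of_finite (gF A) C3 P3) as [K3 H3].
  exists (K1 + K2 + K3)%nat. split; [apply H1; lia|split; [apply H2; lia|apply H3; lia]].
Qed.

Lemma locally_finite x : exists l : list (dart X), forall d, dsrc d = x -> In d l.
Proof.
  destruct proper_stab_bound as [K HK].
  destruct (edges_at A K (full X) HK full_cofin x) as [l Hl].
  exists (map (fun e => (e, true)) l ++ map (fun e => (e, false)) l).
  intros [e b] E. apply in_or_app.
  assert (In e l) by (apply Hl; [exact I|]; destruct b; auto).
  destruct b; [left; now apply (in_map (fun e => (e, true)))|right; now apply (in_map (fun e => (e, false)))].
Qed.

Lemma locally_finite_faces x : exists l : list (fc X), forall f, path_ok x (fbnd X f) x -> In f l.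
Proof.
  destruct proper_stab_bound as [K HK].
  destruct (locally_finite x) as [ld Hld].
  assert (Q : forall ld : list (dart X), exists l : list (fc X),
     forall f d, In d ld -> In d (fbnd X f) -> In f l).
  { induction ld0 as [|d ld0 [l IH]]; [exists []; simpl; tauto|].
    destruct (faces_at A K (full X) HK full_cofin (fst d)) as [l' Hl'].
    exists (l' ++ l). intros f d' [<-|Hd] Hin; apply in_or_app; [left|right; eauto].
    apply Hl'; [exact I|eauto]. }
  destruct (Q ld) as [l Hl]. exists l. intros f Hf.
  destruct (fbnd_closed X f) as [Hne _]. destruct (fbnd X f) as [|d p] eqn:E; [congruence|].
  apply (Hl f d); [apply Hld; apply Hf|rewrite E; simpl; auto].
Qed.

(** The total of |pi - angle| at a vertex is finite by local finiteness and constant on orbits; [m]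
    is its sum over representatives of the vertex orbits of X. *)
Lemma corner_mass (ang : fc X -> nat -> R) : invariant_angles G X A ang ->
  exists m, 0 <= m /\ forall v Lc, NoDup Lc -> (forall c, In c Lc -> corner_at v c) ->
    sum_R (map (fun c => Rabs (PI - ang (fst c) (snd c))) Lc) <= m.
Proof.
  intros Hang. destruct proper_stab_bound as [K HK]. destruct full_cofin as ([l Hl] & _).
  set (g := fun v c => indic (corner_at v c) * Rabs (PI - ang (fst c) (snd c))).
  assert (gpos : forall v c, 0 <= g v c).
  { intros v c. apply Rmult_le_pos; [apply indic_bounds|apply Rabs_pos]. }
  assert (Fg : forall v, fsupp (g v)).
  { intros v. destruct (corners_at_finite A K (full X) HK full_cofin v) as [lc Hlc].
    exists lc. intros c E. apply Hlc; [exact I|]. apply NNPP. intros Hn. apply E.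
    unfold g. rewrite indic_false by auto. ring. }
  exists (sum_R (map (fun v => fsum (g v)) l)).
  assert (Spos : forall l : list (vtx X), 0 <= sum_R (map (fun v => fsum (g v)) l)).
  { induction l0 as [|v l0 IH]; simpl; [lra|]. pose proof (fsum_ge0 (g v) (gpos v)). lra. }
  split; auto. intros v Lc N Hc. destruct (Hl v I) as (h & y & Hy & ->).
  transitivity (fsum (g y)).
  - rewrite (sumR_ext _ (fun c => g y (cact A (ginv G h) c))).
    + rewrite <- (map_map (cact A (ginv G h)) (g y)). apply fsum_NoDup_le; auto.
      apply FinFun.Injective_map_NoDup; auto. intros c c' E.
      apply (f_equal (cact A h)) in E.
      pose proof (@gaVr G (gC A) h c) as E1. pose proof (@gaVr G (gC A) h c') as E2.
      simpl in E1, E2. congruence.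
    + intros c Hin. unfold g. rewrite indic_true.
      * unfold cact; cbn [fst snd]. rewrite Hang. ring.
      * rewrite <- (avV A h y). apply corner_at_act. exact (Hc c Hin).
  - clear -Hy Spos gpos. induction l as [|z l IH]; simpl; [destruct Hy|].
    destruct Hy as [->|Hy]; [specialize (Spos l); lra|].
    specialize (IH Hy). pose proof (fsum_ge0 (g z) (gpos z)). lra.
Qed.

End Cocompact.

Theorem theorem1p3 :
  forall (G : group) (X : complex) (A : action G X) (ang : fc X -> nat -> R),
    invariant_angles G X A ang ->
    simply_connected X (full X) ->
    proper_action G X A ->
    cocompact_in G X A (fun _ => True) (full X) ->
    negative_sectional_curvature X ang ->
    forall (H : G -> Prop) (Y : subcx X),
      subgroup G H ->
      is_subcomplex X Y ->
      connected X Y ->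
      invariant G X A H Y ->
      cocompact_in G X A H Y ->
      exists Z : subcx X,
        is_subcomplex X Z /\ simply_connected X Z /\
        invariant G X A H Z /\ cocompact_in G X A H Z /\
        subcx_le X Y Z.
Proof.
  intros G X A ang Hang Xsc Hprop Hcoc (alpha & Halpha & Hcurv) H Y HS HY Yconn IY CY.
  destruct (proper_stab_bound A Hprop Hcoc) as [K HK].
  destruct (corner_mass A Hprop Hcoc ang Hang) as (m & m_pos & Hm).
  destruct CY as (LY & _ & _ & _ & _ & _ & HLY & _).
  (* The radius of the vertex estimate: [K] and [m] come from the action of G on X, and [LY] from
     the orbits of H on Y. *)
  destruct (INR_unbounded (INR K * (INR (length LY) * m) / - alpha)) as [Rad HRad].
  assert (HRad' : INR K * (INR (length LY) * m) <= - alpha * INR Rad).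
  { left. apply (Rmult_lt_compat_l (- alpha)) in HRad; [|lra].
    replace (- alpha * (INR K * (INR (length LY) * m) / - alpha))
      with (INR K * (INR (length LY) * m)) in HRad by (field; lra). exact HRad. }
  (* From here H acts as a group in its own right. Stabiliser bounds, angles and local finiteness
     are inherited from the action of G, while X itself need not be H-cocompact. *)
  set (B := subact H HS A).
  assert (IB : inv_sub B Y) by now apply inv_subact.
  assert (HKB : stab_bound B K) by now apply stab_bound_subact.
  assert (HLB : forall v, sV Y v -> exists (h : subgrp H HS) y, In y LY /\ v = av B h y).
  { intros v Hv. destruct (HLY v Hv) as (h & y & Hh & Hy & E).
    exists (exist _ h Hh), y. split; [exact Hy|exact E]. }
  assert (HangB : invariant_angles (subgrp H HS) X B ang) by (intros h f i; apply Hang).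
  assert (Xlf := locally_finite A Hprop Hcoc). assert (Xff := locally_finite_faces A Hprop Hcoc).
  exists (core B Y HY IB).
  assert (CI : inv_sub B (core B Y HY IB)) by apply core_inv.
  split; [apply core_sub|]. split; [|split; [|split]].
  - eapply core_simply_connected; eauto.
  - now apply (inv_subact H HS A).
  - apply (cocompact_subact H HS A); auto. eapply core_cofin; eauto.
  - eapply core_above; eauto.
Qed.
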